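(* Let $n$ be a positive integer. For every (piecewise linear) embedding $f \colon M^{(n)} \to \mathbb{R}^{2n}$, there exists an element $\lambda \in \Lambda^{n-1,n}(M^{(n)})$ such that ${\rm lk}_2(f(\lambda)) = 1$.
   Context: Everything is in the piecewise linear category; a simplicial complex is identified with its polyhedron. For a simplicial complex $K$, $\varDelta^{k}(K)$ denotes the set of all $k$-simplices of $K$. Let $\sigma_{m} = |a_{0}a_{1}\cdots a_{m}|$ be an $m$-simplex with vertices $a_0,\ldots,a_m$, regarded as a simplicial $m$-complex; $\sigma_m^k$ denotes its $k$-skeleton. The symbol $*$ denotes join, and finite sets of vertices such as $\{a,b\}$ and $\{a,b,c\}$ are regarded as discrete ($0$-dimensional) complexes. Definition of $M^{(n)}$: let $J=\sigma_{2n}^{n-1}$, the $(n-1)$-skeleton of the $2n$-simplex with vertices $a_0,\ldots,a_{2n}$, and let $a,b,c$ be three distinct vertices not belonging to $J$. Then $M^{(n)}$ is the simplicial $n$-complex $$M^{(n)} = \bigl( J * \{a,b,c\} \bigr) \setminus \{ c * s \mid s \in \varDelta^{n-1}(J) \} = \bigl( J * \{a,b\} \bigr) \cup \bigl\{ c * t \mid t \in \varDelta^{n-2}(J) \bigr\},$$ i.e. the subcomplex of $J*\{a,b,c\}$ obtained by removing all (open) $n$-simplices $|c\, a_{i_0}\cdots a_{i_{n-1}}|$ with $0\le i_0<\cdots<i_{n-1}\le 2n$. Equivalently, it is obtained from $J*\{a,b\}$ by adding all $(n-1)$-simplices $|c\,a_{i_0}\cdots a_{i_{n-2}}|$ with $0\le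 i_0<\cdots<i_{n-2}\le 2n$. For $n=1$, $\varDelta^{-1}(J)$ consists of the empty simplex, so the added simplex is the isolated vertex $c$ and $M^{(1)}$ is the disjoint union of $K_{2,3}$ and a point. For a simplicial complex $K$ and non-negative integers $p,q$, $\Lambda^{p,q}(K)$ is the set of all unordered pairs $\{\gamma,\delta\}$ of mutually disjoint subcomplexes of $K$ with $\gamma$ homeomorphic to the $p$-sphere and $\delta$ homeomorphic to the $q$-sphere. The pair is identified with the disjoint union $\gamma\sqcup\delta$. For $\lambda=\gamma\sqcup\delta\in\Lambda^{p,q}(K)$ and an embedding $f\colon K\to\mathbb{R}^m$ with $m=p+q+1$, $f(\lambda)=f(\gamma)\sqcup f(\delta)$ is a two-component link, and ${\rm lk}_2(f(\lambda))={\rm lk}_2(f(\gamma),f(\delta))\in\mathbb{Z}_2$ is its mod $2$ linking number (the mod $2$ intersection number of one component with a $\mathbb{Z}_2$-chain in general position bounded by the other; for a $0$-sphere, the bounding chain joins its two points). *)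

(* Defs.v *)
From HB Require Import structures.
From mathcomp Require Import all_boot all_order all_algebra finmap.

Set Implicit Arguments.
Unset Strict Implicit.
Unset Printing Implicit Defensive.

Import Order.TTheory GRing.Theory Num.Theory.

(** * Abstract simplicial complexes

A complex on a finite vertex type [V] is a [{set {set V}}] of vertex sets.
The empty simplex (of dimension -1) is always a face, so that joins need no
special case; a simplex of dimension [k] is a face with [k.+1] vertices. *)

Section AbstractComplexes.
Variable V : finType.
Implicit Types K L : {set {set V}}.

Definition is_complex K : Prop :=
  set0 \in K /\ forall s t : {set V}, s \in K -> t \subset s -> t \in K.

Definition subcomplex L K : Prop := is_complex L /\ L \subset K.

Definition simplices (k : nat) K : {set {set V}} := [set s in K | #|s| == k.+1].

Definition skeleton (k : nat) K : {set {set V}} := [set s in K | (#|s| <= k.+1)%N].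

Definition full_simplex : {set {set V}} := [set: {set V}].

Definition discrete_complex : {set {set V}} := [set s : {set V} | (#|s| <= 1)%N].

Definition disjoint_complexes K L : Prop := K :&: L = [set set0].

End AbstractComplexes.

Arguments full_simplex : clear implicits.
Arguments discrete_complex : clear implicits.

Section Join.
Variables V W : finType.

Definition join_simplex (s : {set V}) (t : {set W}) : {set V + W} :=
  [set inl v | v in s] :|: [set inr w | w in t].

Definition join_complex (K : {set {set V}}) (L : {set {set W}}) :
  {set {set V + W}} := [set join_simplex s t | s in K, t in L].

End Join.

(** * The complex M^(n), for n > 0

The vertices a_0, ..., a_{2n} are [inl i] with [i : 'I_(2 * n).+1], and a, b, c
are [inr 0], [inr 1], [inr 2]. *)

Definition M_vertex (n : nat) : finType := ('I_(2 * n).+1 + 'I_3)%type.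

Definition J_complex (n : nat) : {set {set 'I_(2 * n).+1}} :=
  skeleton n.-1 (full_simplex 'I_(2 * n).+1).

Definition vertex_c : 'I_3 := ord_max.

Definition M_complex (n : nat) : {set {set M_vertex n}} :=
  join_complex (J_complex n) (discrete_complex 'I_3)
  :\: [set join_simplex s [set vertex_c] | s in simplices n.-1 (J_complex n)].

From mathcomp Require Import boolp classical_sets functions reals.

Local Open Scope classical_set_scope.
Local Open Scope ring_scope.

(** * Polyhedra and piecewise linear maps *)

Section Polyhedra.
Variable R : realType.

(** The polyhedron of an abstract complex, in barycentric coordinates. *)
Definition realization (V : finType) (K : {set {set V}}) : set {ffun V -> R^o} :=
  [set x | [/\ forall v, 0 <= x v, \sum_v x v = 1
             & [set v | x v != 0]%SET \in K]].

Section GeometricComplexes.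
Variable E : lmodType R.

Definition aff_indep (s : {fset E}) : Prop :=
  forall w : E -> R, \sum_(v <- s) w v = 0 -> \sum_(v <- s) w v *: v = 0 ->
  forall v, v \in s -> w v = 0.

(** Convex hull of a finite set; it is empty if [s] is. *)
Definition hull (s : {fset E}) : set E :=
  [set x | exists w : E -> R, [/\ forall v, v \in s -> 0 <= w v,
    \sum_(v <- s) w v = 1 & x = \sum_(v <- s) w v *: v]].

Definition geometric_complex (T : {fset {fset E}}) : Prop :=
  [/\ forall s, s \in T -> aff_indep s,
      forall s t, s \in T -> (t `<=` s)%fset -> t \in T
    & forall s t, s \in T -> t \in T ->
        hull s `&` hull t `<=` hull (s `&` t)%fset].

Definition triangulates (T : {fset {fset E}}) (X : set E) : Prop :=
  geometric_complex T /\ X = [set x | exists2 s, s \in T & hull s x].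

Definition facets (k : nat) (T : {fset {fset E}}) : {fset {fset E}} :=
  [fset s in T | #|` s| == k.+1]%fset.

End GeometricComplexes.

Definition affine_on (E F : lmodType R) (A : set E) (f : E -> F) : Prop :=
  forall (t : R) (x y : E), 0 <= t <= 1 -> A x -> A y ->
  f (t *: x + (1 - t) *: y) = t *: f x + (1 - t) *: f y.

(** Only the values of [f] on [X] matter. Such an [f] is continuous on [X],
being affine on each of finitely many simplices that cover it. *)
Definition PL_map (E F : lmodType R) (X : set E) (f : E -> F) : Prop :=
  exists T : {fset {fset E}},
    triangulates T X /\ forall s, s \in T -> affine_on (hull s) f.

(** [X] is compact in both definitions below, so an injective PL map is a
homeomorphism onto its image, and its inverse is PL. *)
Definition PL_embedding (E F : lmodType R) (X : set E) (f : E -> F) : Prop :=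
  PL_map X f /\ set_inj X f.

Definition PL_homeomorphic (E F : lmodType R) (X : set E) (Y : set F) : Prop :=
  exists2 g : E -> F, PL_map X g & set_bij X Y g.

(** The model of the [p]-sphere is the boundary of the [p.+1]-simplex. *)
Definition sphere (p : nat) : set {ffun 'I_p.+2 -> R^o} :=
  realization (skeleton p (full_simplex 'I_p.+2)).

Arguments sphere : clear implicits.

(** Lambda^{p,q}(K). The pairs are ordered by listing the [p]-sphere first,
which loses nothing when [p != q]. *)
Definition Lambda (V : finType) (p q : nat) (K : {set {set V}}) :
    set ({set {set V}} * {set {set V}}) :=
  [set l | [/\ subcomplex l.1 K, subcomplex l.2 K, disjoint_complexes l.1 l.2,
      PL_homeomorphic (realization l.1) (sphere p)
    & PL_homeomorphic (realization l.2) (sphere q)]].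

(** * Mod 2 linking numbers

A mod 2 affine [k]-chain is a finite set of nondegenerate [k]-simplices, each
given by its [k.+1] vertices; the simplices of a chain may overlap. *)

Section Linking.
Variable F : lmodType R.

Definition is_chain (k : nat) (C : {fset {fset F}}) : Prop :=
  forall s, s \in C -> aff_indep s /\ #|` s| = k.+1.

(** [Z] is the mod 2 boundary of the [k.+1]-chain [C]. For [k = 0] there is no
augmentation: a path from [x] to [y] is bounded by [x + y]. *)
Definition is_boundary (k : nat) (C Z : {fset {fset F}}) : Prop :=
  forall s : {fset F}, s \in Z =
    (#|` s| == k.+1) && odd #|` [fset t in C | (s `<=` t)%fset]%fset|.

(** Simplices of complementary dimensions may meet only at points interior to
both; each nonempty intersection is then a single transverse point. *)
Definition general_position (C D : {fset {fset F}}) : Prop :=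
  forall s t s' t', s \in C -> t \in D -> (s' `<=` s)%fset -> (t' `<=` t)%fset ->
  hull s' `&` hull t' !=set0 -> s' = s /\ t' = t.

Definition intersection_number (C D : {fset {fset F}}) : 'F_2 :=
  \sum_(s <- C) \sum_(t <- D) (`[< hull s `&` hull t !=set0 >] : nat)%:R.

(** [i] is the mod 2 intersection number of [Y] with a chain in general position
bounded by [X], both [X] and [Y] being triangulated. *)
Definition bounding_intersection (p q : nat) (X Y : set F) (i : 'F_2) : Prop :=
  exists TX TY C : {fset {fset F}},
    [/\ triangulates TX X, triangulates TY Y, is_chain p.+1 C,
        is_boundary p C (facets p TX)
      & general_position C (facets q TY)
        /\ intersection_number C (facets q TY) = i].

(** The linking number of disjoint polyhedral spheres [X] and [Y] of dimensions
[p] and [q] in dimension [p + q + 1], where [bounding_intersection p q X Y i]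
holds for exactly one [i]. *)
Definition lk2 (p q : nat) (X Y : set F) : 'F_2 :=
  if `[< bounding_intersection p q X Y 1 >] then 1 else 0.

End Linking.

End Polyhedra.

Arguments sphere : clear implicits.

(* Main.v *)
(* For an [n]-subset [s] of the vertices of [J], let [delta_s] be the suspension
{a, b} * bd(V \ s), an [n]-sphere disjoint from the (n-1)-sphere bd(c * s). Extend [f]
over the missing simplices [c * s] by cones from one generic point [p]. The linking
number of the images of bd(c * s) and [delta_s] is then the number of crossings of
c * s with [delta_s], and since other disjoint [n]-simplices do not cross, the sum of
these numbers over [s] is the van Kampen number of the extended map on J * {a, b, c}.

It is odd. For disjoint simplices [s], [t] with dim s + dim t = k, let O(s, t) count
the crossings of their images projected to the first [k] coordinates, and U(s, t)
those where [s] lies above [t] in coordinate k + 1. Then O(s, t) = U(s, t) + U(t, s),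
and O(s, t) = U(bd(s x t)) because the preimage of a crossing of the projections to
one coordinate less is a segment whose ends are counted by [U]. Alternately using the
two relations moves the sum down one dimension at a time, to a single vertex.

Crossings are read off from the signs of affine dependences. A small perturbation
makes all projections generic; it preserves disjointness and transverse crossings. *)

Require Import Defs.
From HB Require Import structures.
From mathcomp Require Import all_boot all_order all_algebra finmap.
From mathcomp Require Import zify lra ring boolp.

Set Implicit Arguments.
Unset Strict Implicit.
Unset Printing Implicit Defensive.

Import Order.TTheory GRing.Theory Num.Theory.

Local Open Scope ring_scope.

(** A PL map is affine only on a subdivision, so a simplex of the join is replaced by the mod 2
    chain of the small simplices that fill it, and O and U are extended bilinearly to chains. The
    parity argument uses only that this assignment commutes with boundaries mod 2 and sends disjoint
    simplices to chains without common vertices. One apex serves all missing simplices because each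
    of them contains [c]: two of them are never disjoint, so the apex never occurs on both sides of
    a pair. The apex is on no affine span of at most 2n vertices. Hence an affine dependence that
    involves it uses at least 2n + 1 other vertices, and n + (n + 1) is exactly the number available
    when a cone simplex meets an n-simplex. All its coefficients are therefore nonzero: the meeting
    is transverse, and it survives the perturbation that the projections to lower dimensions
    require. *)

(** * Sums over boundaries and over disjoint pairs, modulo 2 *)

Lemma addFF (x : 'F_2) : x + x = 0.
Proof. by rewrite -mulr2n -mulr_natr (@pchar_Zp 2) // mulr0. Qed.

Lemma natrF2 (k : nat) : k%:R = (odd k)%:R :> 'F_2.
Proof.
elim: k => // k IHk; rewrite -natr1 IHk oddS.
by case: (odd k); rewrite /= ?add0r // mulr1n addFF.
Qed.

(** A face [r = s :\ v] arises once for each vertex that completes it to a simplex satisfying [Q].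
    Later boundary formulas are thereby reduced to parities of numbers of cofaces. *)
Lemma sum_boundary (V : finType) (Q : pred {set V}) (g : {set V} -> 'F_2) :
  \sum_(s | Q s) \sum_(v in s) g (s :\ v) =
  \sum_(r : {set V}) (odd #|[set v | (v \notin r) && Q (v |: r)]|)%:R * g r.
Proof.
rewrite (exchange_big_dep xpredT) //=.
have -> : \sum_(v : V) \sum_(s | Q s && (v \in s)) g (s :\ v) =
    \sum_v \sum_(r : {set V}) ((v \notin r) && Q (v |: r))%:R * g r.
  apply: eq_bigr => v _.
  rewrite [RHS](bigID (fun r : {set V} => (v \notin r) && Q (v |: r))) /=.
  rewrite [X in _ = _ + X]big1 ?addr0; last by move=> r /negPf ->; rewrite mul0r.
  rewrite (reindex_onto (fun r => v |: r) (fun s => s :\ v)) /=; last first.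
    by move=> s /andP[_ vs]; rewrite setD1K.
  have eqP1 (r : {set V}) : ((v |: r) :\ v == r) = (v \notin r).
    apply/eqP/idP => [<-|vr]; first by rewrite !inE eqxx.
    by rewrite setU1K.
  apply: eq_big => [r|r].
    by rewrite eqP1 setU11 andbT andbC.
  by rewrite eqP1 setU11 andbT andbC => /[dup] /andP[vr _] ->; rewrite mul1r setU1K.
rewrite exchange_big /=; apply: eq_bigr => r _.
rewrite -mulr_suml -natr_sum; congr (_ * _); rewrite -natrF2.
congr (_%:R); rewrite -sum1_card big_mkcond /=.
by rewrite [RHS]big_mkcond /=; apply: eq_bigr => v _; rewrite inE; case: ifP.
Qed.

Lemma disjoint_setU1l (V : finType) (v : V) (r u : {set V}) :
  [disjoint v |: r & u] = (v \notin u) && [disjoint r & u].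
Proof. by rewrite -disjointU1; apply: eq_disjoint => z; rewrite !inE. Qed.

Lemma disjoint_setU1r (V : finType) (v : V) (r u : {set V}) :
  [disjoint r & v |: u] = (v \notin r) && [disjoint r & u].
Proof. by rewrite disjoint_sym disjoint_setU1l disjoint_sym. Qed.

Section DisjointPairs.
Variable V : finType.
Implicit Types (r s t u W : {set V}).

(** Used with [#|W| = m.*2.+1], so that a pair leaves out exactly one vertex of [W]. *)
Definition disjoint_pair W (m : nat) s u :=
  [&& s \subset W, u \subset W, [disjoint s & u], #|s| == m & #|u| == m].

Lemma disjoint_pairC W m s u : disjoint_pair W m s u = disjoint_pair W m u s.
Proof.
rewrite /disjoint_pair disjoint_sym andbCA; do 3!congr (_ && _).
exact: andbC.
Qed.

Lemma card_rest W r u (k : nat) : r \subset W -> u \subset W -> [disjoint r & u] ->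
  (#|W| = k + #|r| + #|u|)%N -> #|W :\: (r :|: u)| = k.
Proof.
move=> rW uW ru cW; rewrite cardsD (setIidPr _); last by rewrite finset.subUset rW uW.
by rewrite cardsU (disjoint_setI0 ru) cards0 subn0 cW -addnA addnK.
Qed.

Lemma disjoint_pair_even W m r u : #|W| = m.*2.+1 ->
  odd #|[set v | (v \notin r) && disjoint_pair W m (v |: r) u]| = false.
Proof.
move=> cW; have [/and5P[rW uW ru /eqP cr /eqP cu]|N] := boolP
    [&& r \subset W, u \subset W, [disjoint r & u], #|r|.+1 == m & #|u| == m].
  have -> : [set v | (v \notin r) && disjoint_pair W m (v |: r) u] = W :\: (r :|: u).
    apply/setP => v; rewrite !inE negb_or.
    have [vr|vr] //= := boolP (v \in r).
    rewrite /disjoint_pair finset.subUset sub1set rW uW andbT disjoint_setU1l ru.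
    by rewrite cardsU1 vr add1n cr cu !eqxx !andbT andbC.
  by rewrite (@card_rest _ _ _ 2) //; lia.
rewrite (_ : [set v | _] = set0) ?cards0 //; apply/setP => v; rewrite !inE.
apply/negP => /andP[vr /and5P[]]; rewrite finset.subUset => /andP[_ rW] uW.
rewrite disjoint_setU1l => /andP[_ ru]; rewrite cardsU1 vr add1n => cr cu.
by case/negP: N; apply/and5P.
Qed.

Variables (W : {set V}) (m : nat).
Hypothesis card_W : #|W| = m.*2.+1.

Lemma disjoint_pair_boundary (h : {set V} -> {set V} -> 'F_2) :
  \sum_s \sum_(u | disjoint_pair W m s u) \sum_(v in s) h (s :\ v) u = 0.
Proof.
rewrite (exchange_big_dep xpredT) //= big1 // => u _.
rewrite (sum_boundary _ (h^~ u)) big1 // => r _.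
by rewrite disjoint_pair_even // mul0r.
Qed.

(** The boundary of [x * s] consists of [s] and the cone over the boundary of [s]; the second part
    cancels in the sum by [disjoint_pair_boundary]. *)
Lemma disjoint_pair_cone (h : {set V} -> {set V} -> 'F_2) (x : V) : x \notin W ->
  \sum_s \sum_(u | disjoint_pair W m s u) \sum_(v in x |: s) h ((x |: s) :\ v) u =
  \sum_s \sum_(u | disjoint_pair W m s u) h s u.
Proof.
move=> xW; rewrite -[RHS]addr0 -[X in _ = _ + X](disjoint_pair_boundary (fun r => h (x |: r))).
rewrite -[RHS]big_split /=; apply: eq_bigr => s _ .
rewrite -[RHS]big_split /=; apply: eq_bigr => u /and5P[sW _ _ _ _] /=.
have xs : x \notin s by apply: contra xW; apply: (fintype.subsetP sW).
rewrite big_setU1 //= setU1K //; congr (_ + _); apply: eq_bigr => v vs.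
congr h; apply/setP => z; rewrite !inE; have [->|zx] //= := eqVneq z x.
by rewrite andbT; apply: contraNN xs => /eqP ->.
Qed.

Lemma disjoint_pair_swap (h : {set V} -> {set V} -> 'F_2) :
  \sum_s \sum_(u | disjoint_pair W m s u) h s u =
  \sum_s \sum_(u | disjoint_pair W m s u) h u s.
Proof.
rewrite (exchange_big_dep xpredT) //=.
by apply: eq_bigr => s _; apply: eq_bigl => u; rewrite disjoint_pairC.
Qed.

End DisjointPairs.

Lemma odd_card_setI2 (V : finType) (x y : V) (p : pred V) : x != y ->
  odd #|[set v in [set x; y] | p v]| = p x (+) p y.
Proof.
move=> xy; rewrite -sum1dep_card big_mkcondr /= big_setU1 ?inE //= big_set1.
by case: (p x); case: (p y).
Qed.

(** * The descent that evaluates the van Kampen number *)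

Section VanKampen.
Variables (V : finType) (O U : {set V} -> {set V} -> 'F_2).
Variables (K : {set {set V}}) (N : nat).
Implicit Types (r s t u W : {set V}) (x y z v : V).

(** With k = #|s| + #|t| - 2, this relation compares heights in coordinate k + 1, whereas
    [O_boundary] needs only k coordinates. There are 2n coordinates and [N] will be 2n + 1, hence
    the bounds [N] here and [N.+1] there. *)
Hypothesis O_sym : forall s t, s \in K -> t \in K -> [disjoint s & t] ->
  (0 < #|s| + #|t| <= N)%N -> U s t + U t s = O s t.
Hypothesis O_boundary : forall s t, s \in K -> t \in K -> [disjoint s & t] ->
  (1 < #|s| + #|t| <= N.+1)%N ->
  \sum_(v in s) U (s :\ v) t + \sum_(v in t) U s (t :\ v) = O s t.
Hypothesis O_vertex : forall v, [set v] \in K -> O [set v] set0 = 1.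
Hypothesis K_sub : forall s t, s \in K -> t \subset s -> t \in K.

(** Of the boundary of the product of [y * s] and [u], only the part from the base [s] survives: the
    faces of [s] coned from [y], and the faces of [u], each have an even number of completions. *)
Lemma sum_cone1 W (m : nat) y : #|W| = m.*2.+1 -> y \notin W -> (0 < m)%N -> (m.*2 <= N)%N ->
  (forall s, s \subset W -> (#|s| <= m)%N -> s \in K) ->
  (forall s, s \subset W -> (#|s| <= m)%N -> y |: s \in K) ->
  \sum_s \sum_(u | disjoint_pair W m s u) O (y |: s) u =
  \sum_s \sum_(u | disjoint_pair W m s u) U s u.
Proof.
move=> cW yW m0 mN K1 K2.
rewrite -(disjoint_pair_cone cW U yW) -[RHS]addr0.
(* Adds the vanishing sum over the faces of [u], written with the two simplices exchanged and turned
   back by [disjoint_pair_swap]. *)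
rewrite -[X in _ = _ + X](disjoint_pair_boundary cW (fun r u => U (y |: u) r)).
rewrite [X in _ = _ + X]disjoint_pair_swap -[RHS]big_split /=.
apply: eq_bigr => s _; rewrite -[RHS]big_split /=.
apply: eq_bigr => u /and5P[sW uW su /eqP cs /eqP cu].
have [ys yu] : y \notin s /\ y \notin u.
  by split; apply: contra yW; apply: (fintype.subsetP _).
rewrite -O_boundary ?K2 ?K1 ?cs ?cu //; last by rewrite cardsU1 ys ?cs ?cu; clear -m0 mN; lia.
by rewrite disjoint_setU1l yu.
Qed.

Lemma sum_cone2 W (m : nat) x y : #|W| = m.*2.+1 -> x \notin W -> y \notin W ->
  x != y -> (m.*2.+1 <= N)%N ->
  (forall s, s \subset W -> (#|s| <= m)%N -> x |: s \in K) ->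
  (forall s, s \subset W -> (#|s| <= m)%N -> y |: s \in K) ->
  \sum_s \sum_(u | disjoint_pair W m s u) O (x |: s) (y |: u) =
  \sum_s \sum_(u | disjoint_pair W m s u) U s (y |: u) +
  \sum_s \sum_(u | disjoint_pair W m s u) U (x |: s) u.
Proof.
move=> cW xW yW xy mN K1 K2.
rewrite -(disjoint_pair_cone cW (fun s u => U s (y |: u)) xW).
rewrite [X in _ = _ + X]disjoint_pair_swap.
rewrite -(disjoint_pair_cone cW (fun s u => U (x |: u) s) yW).
rewrite [X in _ = _ + X]disjoint_pair_swap -[RHS]big_split /=.
apply: eq_bigr => s _; rewrite -[RHS]big_split /=.
apply: eq_bigr => u /and5P[sW uW su /eqP cs /eqP cu].
have [xs xu] : x \notin s /\ x \notin u.
  by split; apply: contra xW; apply: (fintype.subsetP _).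
have [ys yu] : y \notin s /\ y \notin u.
  by split; apply: contra yW; apply: (fintype.subsetP _).
rewrite -O_boundary ?K2 ?K1 ?cs ?cu //; last by rewrite !cardsU1 xs yu ?cs ?cu; clear -mN; lia.
by rewrite disjoint_setU1l disjoint_setU1r !inE (negPf xy) xu ys.
Qed.

(* Selects one of [(s, u)] and [(u, s)] for each disjoint pair. *)
Let half W (m : nat) y z s u :=
  disjoint_pair (z |: (y |: W)) m.+1 s u && ((z \in s) || (z \notin u) && (y \in s)).

(** A disjoint pair omits just one of the [m.*2.+3] vertices, so [z] occurs in it or, if [z] is the
    omitted one, [y] does. The side containing this vertex tells the two orders apart. *)
Lemma half_sym W (m : nat) y z s u : #|W| = m.*2.+1 -> y \notin W -> z \notin y |: W ->
  (disjoint_pair (z |: (y |: W)) m.+1 s u : nat) =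
  (half W m y z s u + half W m y z u s)%N.
Proof.
move=> cW yW zW; rewrite /half disjoint_pairC.
have [/and5P[uW sW us /eqP cu /eqP cs]|_] //= := boolP (disjoint_pair _ _ u s).
have dis v : v \in u -> v \notin s by move=> vu; rewrite (disjointFr us vu).
have [zu|zu] := boolP (z \in u); first by rewrite (negPf (dis _ zu)).
have [zs|zs] //= := boolP (z \in s).
have : y \in u :|: s.
  have -> : u :|: s = y |: W; last by rewrite setU11.
  apply/eqP; rewrite eqEcard; apply/andP; split.
    apply/fintype.subsetP => v; rewrite inE => /orP[] vin.
      have := fintype.subsetP uW _ vin; rewrite in_setU1 => /orP[/eqP e|] //.
      by rewrite -e vin in zu.
    have := fintype.subsetP sW _ vin; rewrite in_setU1 => /orP[/eqP e|] //.
    by rewrite -e vin in zs.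
  rewrite cardsU1 yW cW cardsU (disjoint_setI0 us) cards0 cs cu; clear; lia.
rewrite inE; have [yu _|yu] := boolP (y \in u); first by rewrite (negPf (dis _ yu)).
by rewrite /= => ->.
Qed.

Lemma disjoint_pairD1 W (m : nat) y z r u : y \notin W -> z \notin y |: W ->
  (y \in u) && disjoint_pair W m r (u :\ y) =
  [&& y \in u, z \notin r, z \notin u, r \subset z |: (y |: W), u \subset z |: (y |: W),
      [disjoint r & u], #|r| == m & #|u| == m.+1].
Proof.
move=> yW zW; have [yu|//] := boolP (y \in u); rewrite /disjoint_pair /=.
have subW s : y \notin s -> z \notin s -> (s \subset W) = (s \subset z |: (y |: W)).
  move=> ys zs; apply/idP/idP => sW; apply/fintype.subsetP => v vs.
    by rewrite !inE (fintype.subsetP sW _ vs) !orbT.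
  have := fintype.subsetP sW _ vs; rewrite !inE => /or3P[/eqP e|/eqP e|//].
    by rewrite -e vs in zs.
  by rewrite -e vs in ys.
have zy : z != y by apply: contraNneq zW => ->; rewrite setU11.
have -> : (#|u :\ y| == m) = (#|u| == m.+1) by rewrite (cardsD1 y u) yu.
have [zr|zr] := boolP (z \in r).
  rewrite (_ : r \subset W = false) //; apply: contraNF zW => /fintype.subsetP/(_ _ zr).
  by rewrite in_setU1 => ->; rewrite orbT.
have [zu|zu] := boolP (z \in u).
  rewrite (_ : u :\ y \subset W = false) ?andbF //.
  apply: contraNF zW => /fintype.subsetP/(_ z); rewrite !inE zu zy => /(_ isT) ->.
  by rewrite orbT.
have [yr|yr] := boolP (y \in r).
  rewrite (_ : r \subset W = false); last first.
    by apply: contraNF yW => /fintype.subsetP/(_ _ yr).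
  rewrite (_ : [disjoint r & u] = false) ?andbF //.
  by apply/negP => /disjointFr /(_ yr); rewrite yu.
rewrite subW // [(u :\ y \subset W)]subW ?inE ?eqxx ?(negPf zu) ?andbF //.
have -> : (u \subset z |: (y |: W)) = (u :\ y \subset z |: (y |: W)).
  by rewrite -{1}(setD1K yu) finset.subUset sub1set !inE eqxx orbT.
by have -> : [disjoint r & u] = [disjoint r & u :\ y]
  by rewrite -{1}(setD1K yu) disjoint_setU1r yr.
Qed.

Lemma odd_half W (m : nat) y z r u : #|W| = m.*2.+1 -> y \notin W -> z \notin y |: W ->
  odd #|[set v | (v \notin r) && half W m y z (v |: r) u]| (+)
  odd #|[set v | (v \notin u) && half W m y z r (v |: u)]| =
  ((y \in r) && disjoint_pair W m (r :\ y) u) (+)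
  ((y \in u) && disjoint_pair W m r (u :\ y)).
Proof.
move=> cW yW zW; rewrite addbC; set W' := z |: (y |: W).
have cW' : #|W'| = m.*2.+3 by rewrite !cardsU1 zW yW cW.
have zy : z != y by apply: contraNneq zW => ->; rewrite setU11.
have yW' : y \in W' by rewrite !inE eqxx orbT.
have rest s t : s \subset W' -> t \subset W' -> [disjoint s & t] ->
    #|s| = m -> #|t| = m.+1 -> z \notin s -> z \notin t ->
    exists2 w, W' :\: (s :|: t) = [set z; w] & w != z.
  move=> sW tW st cs ct zs zt.
  have cR : #|W' :\: (s :|: t)| = 2 by apply: card_rest => //; rewrite cW' cs ct; clear; lia.
  have zR : z \in W' :\: (s :|: t) by rewrite !inE eqxx negb_or zs zt.
  move: cR; rewrite (cardsD1 z) zR add1n => /eqP; rewrite eqSS => /cards1P[w Ew].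
  exists w; first by rewrite -(setD1K zR) Ew.
  by have := set11 w; rewrite -Ew !inE => /andP[].
have first s t :
   odd #|[set v | (v \notin s) && half W m y z (v |: s) t]| = 
  ((y \in t) && disjoint_pair W m s (t :\ y)).
  rewrite (disjoint_pairD1 _ _ _ yW zW) -/W'.
  rewrite (_ : [set v | _] = [set v in W' :\: (s :|: t) | [&& s \subset W', t \subset W',
     [disjoint s & t], #|s| == m & #|t| == m.+1]
     && ((z \in v |: s) || (z \notin t) && (y \in v |: s))]); last first.
    apply/setP => v; rewrite !inE /half -/W' negb_or.
    have [vs|vs] //= := boolP (v \in s).
    rewrite /disjoint_pair finset.subUset sub1set disjoint_setU1l cardsU1 vs add1n eqSS.
    rewrite !inE.
    have -> : [|| v == z, v == y | v \in W] = (v \in W') by rewrite !inE.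
    move: (v \in W') (v \in t) (s \subset W') (t \subset W') [disjoint s & t].
    move: (#|s| == m) (#|t| == m.+1) (_ || _ && _).
    by do 5![case; rewrite ?andbF //=]; do 3![case; rewrite ?andbF //=].
  have [/and5P[sW tW st /eqP cs /eqP ct]|N0] := boolP [&& s \subset W', t \subset W',
     [disjoint s & t], #|s| == m & #|t| == m.+1]; last first.
    rewrite !andbF (_ : [set v in _ | _] = set0) ?cards0 //.
    by apply/setP => v; rewrite !inE andbF.
  rewrite /= !andbT.
  have [zs|zs] /= := boolP (z \in s).
    rewrite andbF (_ : [set v in _ | _] = W' :\: (s :|: t)).
      by rewrite (@card_rest _ _ _ _ 2) // cW' cs ct; clear; lia.
    by apply/setP => v; rewrite !inE zs !orbT !andbT.
  have [zt|zt] /= := boolP (z \in t).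
    rewrite andbF (_ : [set v in _ | _] = set0) ?cards0 //.
    apply/setP => v; rewrite !inE (negPf zs) /=.
    by apply/negP => /andP[/andP[/norP[_ vt] _]]; rewrite !orbF => /eqP zv; rewrite -zv zt in vt.
  have [w Ew wz] := rest _ _ sW tW st cs ct zs zt.
  rewrite Ew odd_card_setI2 1?eq_sym // setU11 !in_setU1 [z == w]eq_sym (negPf wz) (negPf zs) /= andbT.
  have := yW'; rewrite -(setID W' (s :|: t)) (setIidPr _) ?finset.subUset ?sW // Ew.
  rewrite !inE eq_sym (negPf zy) /= -orbA.
  have [ys _|ys /=] := boolP (y \in s); first by rewrite (disjointFr st ys) orbT.
  have [yt _|yt /= ->] //= := boolP (y \in t); rewrite orbF.
  apply/eqP => yw.
  by have := set22 z w; rewrite -Ew !inE -yw yt orbT.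
have second s t :
   odd #|[set v | (v \notin t) && half W m y z s (v |: t)]| = 
  ((y \in s) && disjoint_pair W m (s :\ y) t).
  rewrite disjoint_pairC (disjoint_pairD1 _ _ _ yW zW) -/W'.
  rewrite (_ : [set v | _] = [set v in W' :\: (t :|: s) | [&& t \subset W', s \subset W',
     [disjoint t & s], #|t| == m & #|s| == m.+1]
     && ((z \in s) || (z \notin v |: t) && (y \in s))]); last first.
    apply/setP => v; rewrite !inE /half -/W' negb_or.
    have [vt|vt] //= := boolP (v \in t).
    rewrite disjoint_pairC /disjoint_pair finset.subUset sub1set disjoint_setU1l.
    rewrite cardsU1 vt add1n eqSS !inE.
    have -> : [|| v == z, v == y | v \in W] = (v \in W') by rewrite !inE.
    move: (v \in W') (v \in s) (s \subset W') (t \subset W') [disjoint t & s].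
    move: (#|t| == m) (#|s| == m.+1) (_ || _ && _).
    by do 5![case; rewrite ?andbF //=]; do 3![case; rewrite ?andbF //=].
  have [/and5P[tW sW ts /eqP ct /eqP cs]|N0] := boolP [&& t \subset W', s \subset W',
     [disjoint t & s], #|t| == m & #|s| == m.+1]; last first.
    rewrite !andbF (_ : [set v in _ | _] = set0) ?cards0 //.
    by apply/setP => v; rewrite !inE andbF.
  rewrite /= !andbT.
  have [zs|zs] /= := boolP (z \in s).
    rewrite !andbF (_ : [set v in _ | _] = W' :\: (t :|: s)).
      by rewrite (@card_rest _ _ _ _ 2) // cW' cs ct; clear; lia.
    by apply/setP => v; rewrite !inE !andbT.
  have [zt|zt] /= := boolP (z \in t).
    rewrite andbF (_ : [set v in _ | _] = set0) ?cards0 //.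
    by apply/setP => v; rewrite !inE zt !orbT !andbF.
  (* Here completing by [z] never counts, and completing by [w] counts exactly if [y] lies in
     [s]. *)
  have [w Ew wz] := rest _ _ tW sW ts ct cs zt zs.
  by rewrite Ew odd_card_setI2 1?eq_sym // setU11 /= in_setU1 [z == w]eq_sym (negPf wz) (negPf zt) /= andbT.
by rewrite first second addbC.
Qed.

(** Joining the two orders of each pair turns [U] into [O] on [half]; the boundary relation turns
    this into [U] on the boundary of [half], whose two orders again combine to [O]. *)
Lemma sum_step W (m : nat) y z : #|W| = m.*2.+1 -> y \notin W -> z \notin y |: W ->
  (m.*2.+2 <= N)%N ->
  (forall s, s \subset z |: (y |: W) -> (#|s| <= m.+1)%N -> s \in K) ->
  \sum_s \sum_(u | disjoint_pair (z |: (y |: W)) m.+1 s u) U s u =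
  \sum_s \sum_(u | disjoint_pair W m s u) O (y |: s) u.
Proof.
move=> cW yW zW mN Ks.
have -> : \sum_s \sum_(u | disjoint_pair (z |: (y |: W)) m.+1 s u) U s u =
    \sum_s \sum_(u | half W m y z s u) O s u.
  transitivity (\sum_(s : {set V}) \sum_(u : {set V}) (half W m y z s u : nat)%:R * U s u +
                \sum_(s : {set V}) \sum_(u : {set V}) (half W m y z u s : nat)%:R * U s u).
    rewrite -big_split; apply: eq_bigr => s _ /=; rewrite -big_split big_mkcond /=.
    apply: eq_bigr => u _; rewrite -mulrDl -natrD -(half_sym _ _ cW yW zW).
    by case: ifP; rewrite ?mul1r ?mul0r.
  rewrite [X in _ + X]exchange_big -big_split; apply: eq_bigr => s _ /=.
  rewrite -big_split [RHS]big_mkcond; apply: eq_bigr => u _ /=; rewrite -mulrDr.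
  have [H|_] := boolP (half W m y z s u); rewrite ?mul0r // mul1r.
  case/andP: H => /and5P[sW uW su /eqP cs /eqP cu] _.
  by rewrite O_sym ?Ks ?cs ?cu //; clear -mN; lia.
have -> : \sum_s \sum_(u | half W m y z s u) O s u =
    \sum_s \sum_(u | half W m y z s u)
      (\sum_(v in s) U (s :\ v) u + \sum_(v in u) U s (u :\ v)).
  apply: eq_bigr => s _; apply: eq_bigr => u /andP[/and5P[sW uW su /eqP cs /eqP cu] _].
  by rewrite O_boundary ?Ks ?cs ?cu //; clear -mN; lia.
under eq_bigr do rewrite big_split; rewrite big_split /=.
rewrite (exchange_big_dep xpredT) //=.
under eq_bigr => u _ do rewrite (sum_boundary (half W m y z ^~ u) (U^~ u)).
under [X in _ + X]eq_bigr => s _ do rewrite (sum_boundary (half W m y z s) (U s)).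
rewrite exchange_big -big_split /=.
under eq_bigr => s _ do rewrite -big_split /=.
have b2F (a b c d : bool) (x : 'F_2) : a (+) b = c (+) d ->
    (a : nat)%:R * x + (b : nat)%:R * x = (c : nat)%:R * x + (d : nat)%:R * x.
  by case: a b c d => [] [] [] [] //= _; rewrite ?mul1r ?mul0r ?addr0 ?add0r ?addFF.
under eq_bigr => s _ do under eq_bigr => u _ do
  rewrite (b2F _ _ _ _ _ (odd_half s u cW yW zW)).
have reindex_cone (h : {set V} -> {set V} -> 'F_2) :
    \sum_(s : {set V}) \sum_(u : {set V}) ((y \in s) && disjoint_pair W m (s :\ y) u : nat)%:R * h s u =
    \sum_s \sum_(u | disjoint_pair W m s u) h (y |: s) u.
  rewrite exchange_big [RHS](exchange_big_dep xpredT) //=; apply: eq_bigr => u _.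
  rewrite (bigID (fun s : {set V} => (y \in s) && disjoint_pair W m (s :\ y) u)) /=.
  rewrite [X in _ + X]big1 ?addr0; last by move=> s /negPf ->; rewrite mul0r.
  rewrite (reindex_onto (fun s => y |: s) (fun s => s :\ y)) /=; last first.
    by move=> s /andP[ys _]; rewrite setD1K.
  apply: eq_big => [s|s].
    have [ys|ys] := boolP (y \in s).
      rewrite [RHS](_ : _ = false); last first.
        by apply/negP => /and5P[/fintype.subsetP/(_ _ ys)]; rewrite (negPf yW).
      apply/negP => /andP[_ /eqP E]; have := setD11 y (y |: s); rewrite E ys.
      by [].
    by rewrite setU1K // setU11 eqxx andbT.
  by move=> /andP[-> _]; rewrite mul1r.
under eq_bigr => s _ do rewrite big_split /=; rewrite big_split /= reindex_cone.
under [X in _ + X]eq_bigr => s _ do under eq_bigr => u _ do rewrite disjoint_pairC.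
rewrite [X in _ + X]exchange_big /= (reindex_cone (fun s u => U u s)).
rewrite -big_split; apply: eq_bigr => s _; rewrite -big_split.
apply: eq_bigr => u /and5P[sW uW su /eqP cs /eqP cu] /=.
have [ys yu] : y \notin s /\ y \notin u.
  by split; apply: contra yW; apply: (fintype.subsetP _).
have subW t : t \subset W -> t \subset z |: (y |: W).
  by move=> tW; rewrite finset.setUA; apply: fintype.subset_trans tW (subsetUr _ _).
have cys : #|y |: s| = m.+1 by rewrite cardsU1 ys cs.
have Ky : y |: s \in K.
  by rewrite Ks ?cys // finset.subUset sub1set subW // !inE eqxx orbT.
rewrite O_sym ?Ky ?Ks ?cu ?subW ?disjoint_setU1l ?yu ?cys //.
by clear -mN; lia.
Qed.

(** Induction on [m]: [sum_cone1] removes the cone point, and [sum_step] makes one vertex of [W] the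
    new cone point and drops another. The descent ends with one vertex paired with the empty
    simplex. *)
Lemma sum_disjoint_cone W (m : nat) y : #|W| = m.*2.+1 -> y \notin W ->
  (m.*2 <= N)%N ->
  (forall s, s \subset W -> (#|s| <= m)%N -> s \in K) ->
  (forall s, s \subset W -> (#|s| <= m)%N -> y |: s \in K) ->
  \sum_s \sum_(u | disjoint_pair W m s u) O (y |: s) u = 1.
Proof.
elim: m W y => [|m IHm] W y cW yW mN K1 K2.
  have e s u : disjoint_pair W 0 s u = (s == set0) && (u == set0).
    rewrite /disjoint_pair !cards_eq0; apply/idP/idP => [/and5P[_ _ _ -> ->]//|].
    by move=> /andP[/eqP -> /eqP ->]; rewrite !sub0set eqxx -setI_eq0 finset.setI0 eqxx.
  rewrite (bigD1 set0) //= [X in _ + X]big1 ?addr0 => [|s /negPf s0]; last first.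
    by rewrite big1 // => u; rewrite e s0.
  rewrite (big_pred1 set0) => [|u]; last by rewrite e eqxx.
  have := K2 set0; rewrite sub0set cards0 finset.setU0 => /(_ isT isT).
  exact: O_vertex.
rewrite sum_cone1 //.
have [z zW] : exists z, z \in W by apply/card_gt0P; rewrite cW.
have [x xW] : exists x, x \in W :\ z.
  by apply/card_gt0P; move: cW; rewrite (cardsD1 z) zW add1n => -[->].
have eW : W = z |: (x |: W :\ z :\ x) by rewrite !setD1K.
have c' : #|W :\ z :\ x| = m.*2.+1.
  by move: cW; rewrite (cardsD1 z) zW (cardsD1 x) xW !add1n => -[].
have sub s : s \subset W :\ z :\ x -> s \subset W.
  by move=> /fintype.subset_trans; apply; rewrite !finset.subDset finset.setUA subsetUr.
rewrite eW sum_step ?c' -?eW //.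
- apply: IHm => //; first by rewrite !inE eqxx.
  + by lia.
  + by move=> s sW cs; rewrite K1 ?sub // leqW.
  + move=> s sW cs; apply: K1.
      rewrite finset.subUset sub1set sub // andbT.
      by move: xW; rewrite inE => /andP[].
    by rewrite cardsU1; case: (_ \notin _); rewrite ?add1n ?add0n // leqW.
- by rewrite !inE eqxx.
- by rewrite setD1K // !inE eqxx.
Qed.

(** After [sum_cone2], the terms in which only [a] or only [c] remains occur twice and cancel. Those
    with [b] occur once in each order, and together they form the cone sum of [b] over [W]. *)
Theorem van_kampen_parity W (n : nat) a b c : #|W| = n.*2.+1 ->
  a \notin W -> b \notin W -> c \notin W -> a != b -> a != c -> b != c ->
  (n.*2.+1 <= N)%N ->
  (forall s x, s \subset W -> (#|s| <= n)%N -> x \in [set a; b; c] -> x |: s \in K) ->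
  \sum_s \sum_(u | disjoint_pair W n s u)
    (O (c |: s) (a |: u) + O (c |: s) (b |: u) + O (b |: s) (a |: u)) = 1.
Proof.
move=> cW aW bW cW' ab ac bc nN KW.
have Ka s : s \subset W -> (#|s| <= n)%N -> a |: s \in K.
  by move=> sW cs; apply: KW; rewrite ?inE ?eqxx ?orbT.
have Kb s : s \subset W -> (#|s| <= n)%N -> b |: s \in K.
  by move=> sW cs; apply: KW; rewrite ?inE ?eqxx ?orbT.
have Kc s : s \subset W -> (#|s| <= n)%N -> c |: s \in K.
  by move=> sW cs; apply: KW; rewrite ?inE ?eqxx ?orbT.
under eq_bigr => s _ do rewrite !big_split /=; rewrite !big_split /=.
have [ca cb ba] : [/\ c != a, c != b & b != a] by split; rewrite eq_sym.
rewrite !sum_cone2 //.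
set A := \sum_s \sum_(u | _) U s (a |: u); set C := \sum_s \sum_(u | _) U (c |: s) u.
set B := \sum_s \sum_(u | _) U s (b |: u); set B' := \sum_s \sum_(u | _) U (b |: s) u.
have -> : A + C + (B + C) + (A + B') = B' + B.
  by rewrite (addrACA A) addFF addr0 addrACA addFF add0r addrC.
rewrite /B (disjoint_pair_swap W n (fun s u => U s (b |: u))) -big_split /=.
rewrite -(sum_disjoint_cone cW bW) //; first last.
- by move=> s sW cs; apply: K_sub (Kb s sW cs) _; apply: subsetUr.
- by clear -nN; lia.
apply: eq_bigr => s _; rewrite -big_split.
apply: eq_bigr => u /and5P[sW uW su /eqP cs /eqP cu] /=.
have [bs bu] : b \notin s /\ b \notin u.
  by split; apply: contra bW; apply: (fintype.subsetP _).
apply: O_sym; rewrite ?Kb ?disjoint_setU1l ?bu ?cardsU1 ?bs ?cs ?cu //; last by clear -nN; lia.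
by apply: K_sub (Kb u uW _) _; rewrite ?cu ?subsetUr.
Qed.
End VanKampen.

(** * Signs of affine dependences *)

Section CountEndpoints.
Variables (R : realFieldType) (X : finType) (S : {set X}) (z a : X -> R).
Hypothesis S_neq0 : S != set0.
Hypothesis z_inj : {in S &, injective z}.
Hypothesis a_neq0 : {in S, forall x, a x != 0}.

(* The solution set of the inequalities [(s - z x) * a x > 0] is an interval; its
endpoints are counted on the left, and on the right it is tested whether it is
unbounded. *)
Lemma odd_endpoints :
  odd #|[set v in S | [forall (x | (x \in S) && (x != v)), 0 < (z v - z x) * a x]]| =
  [forall (x | x \in S), 0 < a x] (+) [forall (x | x \in S), a x < 0].
Proof.
set G := [set v in S | _].
have condP v : v \in S -> reflect
    ((forall x, x \in S -> x != v -> 0 < a x -> z x < z v) /\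
     (forall x, x \in S -> x != v -> a x < 0 -> z v < z x)) (v \in G).
  move=> vS; rewrite inE vS /=; apply: (iffP forallP) => [H|[H1 H2] x].
    split=> x xS xv ax; have := implyP (H x); rewrite xS xv => /(_ isT).
      by rewrite pmulr_lgt0 // subr_gt0.
    by rewrite nmulr_lgt0 // subr_lt0.
  apply/implyP => /andP[xS xv]; have := a_neq0 xS.
  case/lt_total/orP => ax; first by rewrite nmulr_lgt0 // subr_lt0 H2.
  by rewrite pmulr_lgt0 // subr_gt0 H1.
have ltz v x : v \in S -> x \in S -> x != v -> z x <= z v -> z x < z v.
  move=> vS xS xv le; rewrite lt_neqAle le andbT.
  by apply: contraNneq xv => /z_inj -> .
have maxP p : p \in S -> 0 < a p -> exists p', [/\ p' \in S, 0 < a p' &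
    forall x, x \in S -> 0 < a x -> z x <= z p'].
  move=> pS ap; case: (arg_maxP (P := fun x => (x \in S) && (0 < a x)) z (i0 := p)).
    by rewrite pS ap.
  move=> q /andP[qS aq] qmax; exists q; split=> // x xS ax.
  by apply: qmax; rewrite xS ax.
have minP p : p \in S -> a p < 0 -> exists p', [/\ p' \in S, a p' < 0 &
    forall x, x \in S -> a x < 0 -> z p' <= z x].
  move=> pS ap; case: (arg_minP (P := fun x => (x \in S) && (a x < 0)) z (i0 := p)).
    by rewrite pS ap.
  move=> q /andP[qS aq] qmin; exists q; split=> // x xS ax.
  by apply: qmin; rewrite xS ax.
have [Pos|] := boolP [forall (x | x \in S), 0 < a x].
  have {}Pos x : x \in S -> 0 < a x by move=> xS; exact: (implyP (forallP Pos x)).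
  have [p pS] := set0Pn _ S_neq0.
  have [q [qS aq qmax]] := maxP p pS (Pos p pS).
  rewrite (_ : [forall (x | _), a x < 0] = false); last first.
    by apply/negP => /forallP/(_ p)/implyP/(_ pS) /lt_trans/(_ (Pos p pS)); rewrite ltxx.
  rewrite (_ : G = [set q]) ?cards1 //; apply/setP => v; rewrite in_set1.
  have [vS|vS] := boolP (v \in S); last first.
    by rewrite inE (negPf vS); apply/esym/negP => /eqP e; rewrite e qS in vS.
  apply/(condP _ vS)/eqP => [[H _]|->].
    apply/eqP; apply: contraT => vq; have := H q qS; rewrite eq_sym => /(_ vq aq).
    by rewrite ltNge qmax // Pos.
  split=> x xS xq ax; first by apply: ltz => //; apply: qmax.
  by have := lt_trans (Pos x xS) ax; rewrite ltxx.
rewrite negb_forall => /existsP[n]; rewrite negb_imply => /andP[nS an].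
have {}an : a n < 0 by have := a_neq0 nS; rewrite real_neqr_lt ?num_real // (negPf an) orbF.
have [q [qS aq qmin]] := minP n nS an.
have [Neg|] := boolP [forall (x | x \in S), a x < 0].
  have {}Neg x : x \in S -> a x < 0 by move=> xS; exact: (implyP (forallP Neg x)).
  rewrite (_ : G = [set q]) ?cards1 //; apply/setP => v; rewrite in_set1.
  have [vS|vS] := boolP (v \in S); last first.
    by rewrite inE (negPf vS); apply/esym/negP => /eqP e; rewrite e qS in vS.
  apply/(condP _ vS)/eqP => [[_ H]|->].
    apply/eqP; apply: contraT => vq; have := H q qS; rewrite eq_sym => /(_ vq aq).
    by rewrite ltNge qmin // Neg.
  split=> x xS xq ax; first by have := lt_trans (Neg x xS) ax; rewrite ltxx.
  by apply: ltz => //; [rewrite eq_sym|apply: qmin].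
rewrite negb_forall => /existsP[m]; rewrite negb_imply => /andP[mS am].
have {}am : 0 < a m by have := a_neq0 mS; rewrite real_neqr_lt ?num_real // (negPf am).
have [p [pS ap pmax]] := maxP m mS am.
have pq : p != q by apply: contraTneq ap => ->; rewrite -leNgt ltW.
(* [p] gives the largest lower bound and [q] the smallest upper bound: the interval has these two
   endpoints, or it is empty. *)
have [lt|ge] := ltP (z p) (z q).
  rewrite (_ : G = [set p; q]) ?cards2 ?pq //; apply/setP => v; rewrite in_set2.
  have [vS|vS] := boolP (v \in S); last first.
    rewrite inE (negPf vS); apply/esym/negP => /orP[] /eqP e.
      by rewrite e pS in vS.
    by rewrite e qS in vS.
  apply/(condP _ vS)/orP => [[H1 H2]|[]/eqP->].
  - have [vp|vp] := eqVneq v p; [by left|have [vq|vq] := eqVneq v q; [by right|]].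
    have := a_neq0 vS; rewrite real_neqr_lt ?num_real // => /orP[av|av].
      by have := H2 q qS; rewrite eq_sym => /(_ vq aq); rewrite ltNge qmin.
    by have := H1 p pS; rewrite eq_sym => /(_ vp ap); rewrite ltNge pmax.
  - split=> x xS xp ax; first by apply: ltz => //; apply: pmax.
    by apply: lt_le_trans lt _; apply: qmin.
  - split=> x xS xq ax; first by apply: le_lt_trans lt; apply: pmax.
    by apply: ltz => //; [rewrite eq_sym|apply: qmin].
rewrite (_ : G = set0) ?cards0 //; apply/setP => v; rewrite in_set0.
have [vS|vS] := boolP (v \in S); last by rewrite inE (negPf vS).
apply/(condP _ vS) => -[H1 H2].
have := a_neq0 vS; rewrite real_neqr_lt ?num_real // => /orP[av|av].
  have vp : p != v by apply: contraTneq av => <-; rewrite -leNgt ltW.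
  have [vq|vq] := eqVneq v q.
    by have := H1 p pS vp ap; rewrite vq ltNge ge.
  by have := H2 q qS; rewrite eq_sym => /(_ vq aq); rewrite ltNge qmin.
have vq : q != v by apply: contraTneq av => <-; rewrite -leNgt ltW.
have [vp|vp] := eqVneq v p.
  by have := H2 q qS vq aq; rewrite vp ltNge ge.
by have := H1 p pS; rewrite eq_sym => /(_ vp ap); rewrite ltNge pmax.
Qed.

End CountEndpoints.

Section Circuits.
Variables (R : realFieldType) (X : finType) (g : X -> nat -> R).
Implicit Types (S t u : {set X}) (w : X -> R).

(* [g x 0 = 1] and the other [g x i] are the coordinates of a point, so that
[dependence k w] is an affine dependence in the space of dimension [k.-1]. *)
Definition dependence k w : Prop := forall i, (i < k)%N -> \sum_x w x * g x i = 0.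

Definition supported S w : Prop := forall x, x \notin S -> w x = 0.

(** The positive part of such a dependence and the negated negative part describe, after scaling, a
    common point of the open simplices [t] and [u]. *)
Definition separating t u w : Prop :=
  [/\ forall x, x \in t -> 0 < w x, forall x, x \in u -> w x < 0
    & supported (t :|: u) w].

(** One condition is for the total weight; the others are coordinates of a projection to dimension
    [#|t| + #|u| - 2], which is the sum of the dimensions of [t] and [u]. *)
Definition crosses t u : bool :=
  `[< exists2 w, separating t u w & dependence (#|t| + #|u|).-1 w >].

(* Intersection after dropping a coordinate, with [t] above [u] in it. *)
Definition above t u : bool :=
  `[< exists w, [/\ separating t u w, dependence (#|t| + #|u|).-1 w
                  & 0 < \sum_x w x * g x (#|t| + #|u|).-1] >].

(** Since [dependence #|S|] reads only the first [#|S|] coordinates, this is general position of all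
    the projections at once. *)
Definition generic (k : nat) : Prop := forall S w, (#|S| <= k)%N ->
  supported S w -> dependence #|S| w -> forall x, w x = 0.

Lemma dependence_combine k w1 w2 (c1 c2 : R) : dependence k w1 -> dependence k w2 ->
  dependence k (fun x => c1 * w1 x + c2 * w2 x).
Proof.
move=> d1 d2 i ik; under eq_bigr do rewrite mulrDl -!mulrA.
by rewrite big_split /= -!mulr_sumr d1 // d2 // !mulr0 addr0.
Qed.

Lemma sum_combine w1 w2 (c1 c2 : R) i :
  \sum_x (c1 * w1 x + c2 * w2 x) * g x i =
  c1 * \sum_x w1 x * g x i + c2 * \sum_x w2 x * g x i.
Proof.
by rewrite !mulr_sumr -big_split; apply: eq_bigr => x _ /=; rewrite mulrDl !mulrA.
Qed.

Lemma exists_dependence S k : (k < #|S|)%N ->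
  exists w, [/\ supported S w, dependence k w & exists x, w x != 0].
Proof.
move=> kS; pose A : 'M[R]_(#|S|, k) := \matrix_(i, j) g (enum_val i) j.
have : kermx A != 0.
  by rewrite -mxrank_eq0 mxrank_ker subn_eq0 -ltnNge (leq_ltn_trans (rank_leq_col A)).
case/rowV0Pn => v /sub_kermxP vA v0.
pose w x := \sum_i v 0 i * (enum_val i == x)%:R.
have sum_w f : \sum_x w x * f x = \sum_i v 0 i * f (enum_val i).
  under eq_bigr do rewrite mulr_suml; rewrite exchange_big /=; apply: eq_bigr => i _.
  rewrite (bigD1 (enum_val i)) //= eqxx mulr1 big1 ?addr0 // => x /negPf xi.
  by rewrite eq_sym xi mulr0 mul0r.
have wE i : w (enum_val i) = v 0 i.
  rewrite /w (bigD1 i) //= eqxx mulr1 big1 ?addr0 // => j ji.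
  by rewrite (inj_eq enum_val_inj) (negPf ji) mulr0.
exists w; split.
- move=> x xS; rewrite /w big1 // => i _; case: eqP => [e|]; rewrite ?mulr0 //.
  by rewrite -e enum_valP in xS.
- move=> i ik; rewrite (sum_w (g^~ i)).
  transitivity ((v *m A) 0 (Ordinal ik)); last by rewrite vA mxE.
  by rewrite mxE; apply: eq_bigr => j _; rewrite mxE.
- by case/rV0Pn: v0 => i vi; exists (enum_val i); rewrite wE.
Qed.

Lemma separating_sym t u w : separating t u w -> separating u t (fun x => - w x).
Proof.
move=> [tw uw s]; split=> [x /uw|x /tw|x xs]; rewrite ?oppr_gt0 ?oppr_lt0 //.
by rewrite s ?oppr0 // setUC.
Qed.

Lemma dependenceN k w : dependence k w -> dependence k (fun x => - w x).
Proof.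
move=> d i ik; transitivity (- \sum_x w x * g x i); last by rewrite d ?oppr0.
by rewrite -sumrN; apply: eq_bigr => x _; rewrite mulNr.
Qed.

Lemma separating_add t u w1 w2 (c1 c2 : R) : 0 < c1 -> 0 <= c2 ->
  separating t u w1 -> separating t u w2 ->
  separating t u (fun x => c1 * w1 x + c2 * w2 x).
Proof.
move=> p1 p2 [t1 u1 s1] [t2 u2 s2]; split=> x xin.
- by rewrite ltr_wpDr ?mulr_gt0 ?mulr_ge0 ?t1 // ltW // t2.
- by rewrite ltr_wnDr ?mulr_ge0_le0 ?pmulr_rlt0 ?u1 // ltW // u2.
- by rewrite s1 // s2 // !mulr0 addr0.
Qed.

Variable k : nat.
Hypothesis g_generic : generic k.

(** Genericity makes the height difference at a crossing nonzero. Its sign is well defined, because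
    two separating dependences with heights of opposite sign have a positive combination of height
    zero. *)
Lemma crosses_above t u : [disjoint t & u] -> (0 < #|t| + #|u| <= k)%N ->
  crosses t u = above t u (+) above u t.
Proof.
move=> tu /andP[n0 nk].
have cS : #|t :|: u| = (#|t| + #|u|)%N by rewrite cardsU (disjoint_setI0 tu) cards0 subn0.
have prednE : (#|t| + #|u|).-1.+1 = (#|t| + #|u|)%N by rewrite prednK.
have nz w : separating t u w -> dependence (#|t| + #|u|).-1 w ->
    \sum_x w x * g x (#|t| + #|u|).-1 != 0.
  move=> [tw uw s] d; apply/eqP => z.
  have w0 : forall x, w x = 0.
    apply: (g_generic (S := t :|: u)) => //; rewrite cS // -prednE => i.
    by rewrite ltnS leq_eqVlt => /orP[/eqP ->|/d].
  have [x] : exists x, x \in t :|: u by apply/card_gt0P; rewrite cS.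
  rewrite inE => /orP[/tw|/uw]; by rewrite w0 ltxx.
have aboveC : above u t = `[< exists w, [/\ separating t u w, dependence (#|t| + #|u|).-1 w
                  & \sum_x w x * g x (#|t| + #|u|).-1 < 0] >].
  apply/asboolP/asboolP => -[w [s d h]]; exists (fun x => - w x);
    move: d h; rewrite addnC => d h; split;
    [exact: separating_sym|exact: dependenceN| |exact: separating_sym|exact: dependenceN| ];
    under eq_bigr do rewrite mulNr; by rewrite sumrN ?oppr_lt0 ?oppr_gt0.
rewrite aboveC; apply/asboolP/idP => [[w s d]|].
  have [p|p|e] := ltgtP 0 (\sum_x w x * g x (#|t| + #|u|).-1).
  - have -> : above t u = true by apply/asboolP; exists w.
    rewrite addTb.
    apply/negP => /asboolP[w' [s' d' h']].
    set a := (\sum_x _) in p; set b := (\sum_x _) in h'.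
    have b0 : 0 < - b by rewrite oppr_gt0.
    have := nz _ (separating_add b0 (ltW p) s s') (dependence_combine _ _ d d').
    by rewrite sum_combine -/a -/b mulNr mulrC addNr eqxx.
  - rewrite [X in _ (+) X](_ : _ = true) ?addbT; last by apply/asboolP; exists w.
    apply/negP => /asboolP[w' [s' d' h']].
    set a := (\sum_x _) in p; set b := (\sum_x _) in h'.
    have a0 : 0 <= - a by rewrite oppr_ge0 ltW.
    have := nz _ (separating_add h' a0 s s') (dependence_combine _ _ d d').
    by rewrite sum_combine -/a -/b mulNr mulrC addrN eqxx.
  - by move: (nz w s d); rewrite -e eqxx.
have [/asboolP[w [s d _]] _|_ /= /asboolP[w [s d _]]] := boolP (above t u); by exists w.
Qed.

(** On [S], the dependences in one dimension less with height 1 form a line of direction [e], on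
    which each sign condition is a linear inequality in the parameter. An endpoint of the solution
    set is a crossing counted by [above] for a face, and the set is unbounded exactly if [e] or its
    negative is separating. *)
Lemma crosses_boundary t u : [disjoint t & u] -> (1 < #|t| + #|u| <= k.+1)%N ->
  (crosses t u)%:R =
  \sum_(v in t) (above (t :\ v) u)%:R + \sum_(v in u) (above t (u :\ v))%:R :> 'F_2.
Proof.
move=> tu /andP[n1 nk]; set S := t :|: u.
have cS : #|S| = (#|t| + #|u|)%N by rewrite cardsU (disjoint_setI0 tu) cards0 subn0.
have [m cSm] : exists m, #|S| = m.+2 by case: #|S| cS n1 => [|[|m]] <- // _; exists m.
have [e [eS ed [x0 ex0]]] : exists w, [/\ supported S w, dependence m.+1 w & exists x, w x != 0].
  by apply: exists_dependence; rewrite cSm.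
have cSv v : v \in S -> #|S :\ v| = m.+1.
  by move=> vS; move: cSm; rewrite (cardsD1 v) vS => -[].
have gen v w : v \in S -> supported S w -> w v = 0 -> dependence m.+1 w -> forall x, w x = 0.
  move=> vS sw wv d; apply: (g_generic (S := S :\ v)); rewrite ?cSv //.
    by move: nk; rewrite -cS cSm.
  move=> x; rewrite !in_setD1 negb_and negbK => /orP[/eqP->//|]; exact: sw.
have e_neq0 v : v \in S -> e v != 0.
  by move=> vS; apply/eqP => ev; move: ex0; rewrite (gen v e) ?eqxx.
(* The point of the line where the weight of [v] vanishes; height 1 fixes its scale, with the sign
   that [above] demands. *)
have exr v : v \in S -> exists r, [/\ supported S r, r v = 0, dependence m r
    & \sum_x r x * g x m = 1].
  move=> vS; have [|w [sw dw [x wx]]] := @exists_dependence (S :\ v) m; first by rewrite cSv.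
  have h0 : \sum_x w x * g x m != 0.
    apply/eqP => h; suff w0 : forall y, w y = 0 by rewrite w0 eqxx in wx.
    apply: (gen v) => //.
    - by move=> y yS; apply: sw; rewrite !in_setD1 (negPf yS) andbF.
    - by apply: sw; rewrite !in_setD1 eqxx.
    - by move=> i; rewrite ltnS leq_eqVlt => /orP[/eqP ->|/dw].
  exists (fun x => w x / \sum_x w x * g x m); split.
  - by move=> y yS; rewrite sw ?mul0r // !in_setD1 (negPf yS) andbF.
  - by rewrite sw ?mul0r // !in_setD1 eqxx.
  - move=> i im; under eq_bigr do rewrite mulrAC.
    by rewrite -[LHS]mulr_suml (dw i im) mul0r.
  - by under eq_bigr do rewrite mulrAC; rewrite -[LHS]mulr_suml divff.
have [r rP] : exists r : X -> X -> R, forall v, v \in S ->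
    [/\ supported S (r v), r v v = 0, dependence m (r v) & \sum_x r v x * g x m = 1].
  have ex v : exists rv : X -> R, v \in S -> [/\ supported S rv, rv v = 0,
      dependence m rv & \sum_x rv x * g x m = 1].
    have [/exr[rv ?]|vS] := boolP (v \in S); first by exists rv.
    by exists e.
  by have [r rP] := choice ex; exists r.
have [v0 v0S] : exists x, x \in S by apply/card_gt0P; rewrite cSm.
(* Parameter of [r v] on the line: the differences of the [r v] are multiples of [e], read off at
   [v0]. *)
pose z v := r v v0 / e v0.
have e_h : \sum_x e x * g x m = 0 by apply: ed.
have rE v x : v \in S -> x \in S -> r v x = (z v - z x) * e x.
  move=> vS xS.
  have [sv rvv dv hv] := rP v vS; have [sx rxx dx hx] := rP x xS.
  pose c := r v v0 / e v0 - r x v0 / e v0.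
  have E y : r v y - r x y - c * e y = 0.
    apply: (gen v0 (fun y => r v y - r x y - c * e y)) => // [y'|| i].
    - by move=> y'S; rewrite sv // sx // eS // mulr0 !subr0.
    - by rewrite /c mulrBl !divfK ?e_neq0 // subrr.
    - rewrite (eq_bigr (fun x0 => 1 * (1 * r v x0 + (-1) * r x x0) * g x0 i +
                                  (- c) * (e x0 * g x0 i))); last by move=> ? _; ring.
      rewrite big_split /= -mulr_sumr ltnS leq_eqVlt => /orP[/eqP ->|im].
        under eq_bigr do rewrite mul1r.
        by rewrite sum_combine hv hx e_h; ring.
      under eq_bigr do rewrite mul1r.
      by rewrite sum_combine dv // dx // ed ?mulr0 ?addr0 // ltnW.
  have := E x; rewrite rxx subr0 => /eqP; rewrite subr_eq0 => /eqP ->.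
  by rewrite /c /z.
(* Multiplying by [s] turns both kinds of sign conditions into positivity. *)
pose s x : R := if x \in t then 1 else -1.
have [sP sN] : (forall x, x \in t -> s x = 1) /\ (forall x, x \in u -> s x = -1).
  split=> x xin; rewrite /s ?xin // (disjointFl tu xin) //.
have s0 x : s x != 0 by rewrite /s; case: ifP; rewrite ?oppr_eq0 oner_eq0.
pose a x := s x * e x.
have aP v t' u' : v \in S -> t' :|: u' = S :\ v -> t' \subset t -> u' \subset u ->
    above t' u' = [forall (x | (x \in S) && (x != v)), 0 < (z v - z x) * a x].
  move=> vS tuS tt uu.
  have tu' : [disjoint t' & u'] by apply: disjointWl tt _; apply: disjointWr uu _.
  have -> : above t' u' = `[< separating t' u' (r v) >].
    have c' : (#|t'| + #|u'|).-1 = m.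
      by rewrite -[m]/(m.+1.-1) -(cSv v vS) -tuS cardsU (disjoint_setI0 tu') cards0 subn0.
    have [sv rvv dv hv] := rP v vS.
    rewrite /above c'; apply/asboolP/asboolP => [[w [sw dw hw]]|sw]; last first.
      by exists (r v); split; rewrite ?hv.
    set h := \sum_x _ in hw.
    have E y : w y - h * r v y = 0.
      apply: (gen v (fun y => w y - h * r v y)) => // [x xS||i].
      - by case: sw => _ _ ->; rewrite ?sv ?mulr0 ?subr0 // tuS !in_setD1 (negPf xS) andbF.
      - by case: sw => _ _ ->; rewrite ?rvv ?mulr0 ?subr0 // tuS !in_setD1 eqxx.
      - rewrite (eq_bigr (fun x0 => (1 * w x0 + (-h) * r v x0) * g x0 i)); last by move=> ? _; ring.
        rewrite sum_combine ltnS leq_eqVlt => /orP[/eqP ->|im]; last first.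
          by rewrite dw // dv // !mulr0 addr0.
        by rewrite hv -/h; ring.
    have {}E y : r v y = h^-1 * w y.
      by move/eqP: (E y); rewrite subr_eq0 => /eqP ->; rewrite mulKf ?gt_eqF.
    case: sw => s1 s2 s3; split=> x xin; rewrite E.
    - by rewrite mulr_gt0 ?invr_gt0 ?s1.
    - by rewrite pmulr_rlt0 ?invr_gt0 ?s2.
    - by rewrite s3 ?mulr0.
  have [sv rvv _ _] := rP v vS.
  have inS x : (x \in S) && (x != v) = (x \in t') || (x \in u').
    by rewrite -in_setU tuS in_setD1 andbC.
  apply/asboolP/forallP => [[s1 s2 s3] x|H].
    apply/implyP; rewrite inS => /orP[xin|xin].
      have /andP[xS xv] : (x \in S) && (x != v) by rewrite inS xin.
      by rewrite /a mulrCA sP ?mul1r -?rE ?s1 //; apply: (fintype.subsetP tt).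
    have /andP[xS xv] : (x \in S) && (x != v) by rewrite inS xin orbT.
    rewrite /a mulrCA sN ?mulN1r -?rE ?oppr_gt0 ?s2 //; exact: (fintype.subsetP uu).
  split=> x xin.
  - have /andP[xS xv] : (x \in S) && (x != v) by rewrite inS xin.
    have := implyP (H x); rewrite xS xv => /(_ isT).
    by rewrite /a mulrCA sP ?mul1r -?rE //; apply: (fintype.subsetP tt).
  - have /andP[xS xv] : (x \in S) && (x != v) by rewrite inS xin orbT.
    have := implyP (H x); rewrite xS xv => /(_ isT).
    rewrite /a mulrCA sN ?mulN1r -?rE ?oppr_gt0 //; exact: (fintype.subsetP uu).
  - move: xin; rewrite tuS !in_setD1 negb_and negbK => /orP[/eqP ->//|]; exact: sv.
(* With equal parameters, [r x] would vanish at two vertices of [S], which genericity excludes. *)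
have z_inj : {in S &, injective z}.
  move=> x y xS yS zxy; apply/eqP; apply: contraT => xy.
  have [sv rvv dv hv] := rP x xS.
  have c2 : #|S :\ x :\ y| = m.
    by have := cSv x xS; rewrite (cardsD1 y) !in_setD1 eq_sym xy yS => -[].
  have r0 (i : X) : r x i = 0.
    apply: (g_generic (S := S :\ x :\ y)); rewrite ?c2 //.
      by move: nk; rewrite -cS cSm ltnS => /ltnW.
    move=> j; rewrite !in_setD1 !negb_and !negbK => /or3P[/eqP ->|/eqP ->|/sv //] //.
    by rewrite rE // zxy subrr mul0r.
  by move: hv; rewrite big1 => [/eqP|w _]; rewrite ?r0 ?mul0r // eq_sym oner_eq0.
have a0 : {in S, forall x, a x != 0} by move=> x xS; rewrite mulf_neq0 ?s0 ?e_neq0.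
have S0 : S != set0 by apply/set0Pn; exists v0.
have crossE : crosses t u = [forall (x | x \in S), 0 < a x] (+) [forall (x | x \in S), a x < 0].
  have nboth : ~~ ([forall (x | x \in S), 0 < a x] && [forall (x | x \in S), a x < 0]).
    apply/negP => /andP[/forallP/(_ v0)/implyP/(_ v0S) p /forallP/(_ v0)/implyP/(_ v0S) n].
    by have := lt_trans p n; rewrite ltxx.
  transitivity ([forall (x | x \in S), 0 < a x] || [forall (x | x \in S), a x < 0]); last first.
    by move: nboth; do 2!case: [forall (x | _), _].
  have pmS : (#|t| + #|u|).-1 = m.+1 by rewrite -cS cSm.
  rewrite /crosses pmS; apply/asboolP/orP.
    move=> [w [s1 s2 s3] dw]; pose c := w v0 / e v0.
    have E x : w x - c * e x = 0.
      apply: (gen v0 (fun x => w x - c * e x)) => // [y yS||i im].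
      - by rewrite s3 // eS // mulr0 subr0.
      - by rewrite /c divfK ?e_neq0 // subrr.
      - rewrite (eq_bigr (fun x0 => (1 * w x0 + (-c) * e x0) * g x0 i)); last by move=> ? _; ring.
        by rewrite sum_combine dw // ed // !mulr0 addr0.
    have {}E x : w x = c * e x by apply/eqP; rewrite -subr_eq0 E.
    have c0 : c != 0.
      by move: v0S; apply: contraTneq => c0; rewrite inE; apply/norP; split; apply/negP;
        [move/s1|move/s2]; rewrite E c0 mul0r ltxx.
    have sx x : x \in S -> 0 < s x * w x.
      rewrite inE => /orP[xin|xin]; first by rewrite sP // mul1r s1.
      by rewrite sN // mulN1r oppr_gt0 s2.
    have [cp|cn|ce] := ltgtP 0 c; last by rewrite -ce eqxx in c0.
      left; apply/forallP => x; apply/implyP => /sx.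
      by rewrite E mulrCA pmulr_rgt0.
    right; apply/forallP => x; apply/implyP => /sx.
    by rewrite E mulrCA nmulr_rgt0.
  have St x : x \in t -> x \in S by move=> xt; rewrite inE xt.
  have Su x : x \in u -> x \in S by move=> xu; rewrite inE xu orbT.
  case=> /forallP H.
    exists e => //; split=> // x xin; have := implyP (H x).
      by move=> /(_ (St _ xin)); rewrite /a sP // mul1r.
    by move=> /(_ (Su _ xin)); rewrite /a sN // mulN1r oppr_gt0.
  exists (fun x => - e x); last exact: dependenceN.
  split=> x xin; last by rewrite eS ?oppr0.
    by have := implyP (H x) (St _ xin); rewrite /a sP // mul1r oppr_gt0.
  by have := implyP (H x) (Su _ xin); rewrite /a sN // mulN1r.
rewrite crossE -(odd_endpoints S0 z_inj a0) -natrF2 -sum1dep_card natr_sum big_mkcondr /=.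
transitivity (\sum_(v in S) [forall (x | (x \in S) && (x != v)), 0 < (z v - z x) * a x]%:R : 'F_2).
  by apply: eq_bigr => v _; case: ifP.
rewrite /S (big_setID t) /= setUK; congr (_ + _).
  apply: eq_bigr => v vt; rewrite (aP v (t :\ v) u) ?subD1set //; first by rewrite inE vt.
  by rewrite /S setDUl [u :\ v](_ : _ = u) //; apply/setDidPl; rewrite disjoint_sym disjoints1 (disjointFr tu vt).
rewrite setDUl setDv finset.set0U (setDidPl _) 1?disjoint_sym //.
apply: eq_bigr => v vu; rewrite (aP v t (u :\ v)) ?subD1set //; first by rewrite inE vu orbT.
by rewrite /S setDUl [t :\ v](_ : _ = t) //; apply/setDidPl; rewrite disjoint_sym disjoints1 (disjointFl tu vu).
Qed.

End Circuits.

(** * Perturbation to generic position *)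

Section SmallParameter.
Variable R : realFieldType.

Definition eventually (Q : R -> Prop) : Prop :=
  exists2 e : R, 0 < e & forall d, 0 < d -> d <= e -> Q d.

Lemma eventually_and Q1 Q2 : eventually Q1 -> eventually Q2 ->
  eventually (fun d => Q1 d /\ Q2 d).
Proof.
move=> [e1 p1 H1] [e2 p2 H2]; exists (Num.min e1 e2); first by rewrite lt_min p1.
by move=> d d0; rewrite le_min => /andP[d1 d2]; split; [apply: H1|apply: H2].
Qed.

Lemma eventually_all (I : finType) (Q : I -> R -> Prop) :
  (forall i, eventually (Q i)) -> eventually (fun d => forall i, Q i d).
Proof.
move=> H; suff : eventually (fun d => forall i, i \in enum I -> Q i d).
  by move=> [e e0 He]; exists e => // d d0 de i; apply: He; rewrite ?mem_enum.
elim: (enum I) => [|i s IHs]; first by exists 1.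
have [e e0 He] := eventually_and (H i) IHs.
exists e => // d d0 de j; have [Qi Qs] := He d d0 de.
by rewrite inE => /orP[/eqP ->|/Qs].
Qed.

Lemma eventually_sub (Q1 Q2 : R -> Prop) : (forall d, 0 < d -> Q1 d -> Q2 d) ->
  eventually Q1 -> eventually Q2.
Proof. by move=> H [e e0 He]; exists e => // d d0 /(He d d0); apply: H. Qed.

Lemma poly_pos_near0 (q : {poly R}) : 0 < q.[0] -> eventually (fun d => 0 < q.[d]).
Proof.
move=> q0; have : root (q - (q.[0])%:P) 0 by rewrite /root !hornerE subrr.
case/factor_theorem => r; rewrite subr0 => qE.
have {qE}qE d : q.[d] = q.[0] + r.[d] * d.
  move/(congr1 (horner^~ d)): qE; rewrite !hornerE => /eqP.
  by rewrite subr_eq => /eqP ->; rewrite addrC.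
have [B HB] := poly_itv_bound r 0 1.
have B0 : 0 <= B by apply: le_trans (HB 0 _); rewrite ?lexx ?ler01.
exists (Num.min 1 (q.[0] / (B + 1) / 2)) => [|d d0].
  by rewrite lt_min ltr01 !divr_gt0 // ltr_wpDl.
rewrite le_min => /andP[d1 dB]; rewrite qE.
have rd : `|r.[d]| <= B by apply: HB; rewrite ltW.
have dq : (B + 1) * d <= q.[0] / 2.
  have -> : q.[0] / 2 = (B + 1) * (q.[0] / (B + 1) / 2).
    by field; rewrite gt_eqF // ltr_wpDl.
  by rewrite ler_pM2l // ltr_wpDl.
have : - (B * d) <= r.[d] * d.
  by rewrite -mulNr ler_pM2r // lerNl (le_trans _ rd) // -normrN ler_norm.
have : 0 < B * d \/ 0 = B * d by move: B0; rewrite le_eqVlt => /orP[/eqP <-|B0]; [right; rewrite mul0r|left; rewrite mulr_gt0].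
nra.
Qed.

(** Dividing out the common power of ['X] keeps a polynomial family of solutions from vanishing at
    0. *)
Lemma poly_factor_X (I : finType) (u : I -> {poly R}) : (exists i, u i != 0) ->
  exists n, exists w : I -> {poly R},
    (forall i, u i = w i * 'X^n) /\ exists i, (w i).[0] != 0.
Proof.
move=> [i0]; move: {2}(size (u i0)) (leqnn (size (u i0))) => s.
elim: s u => [|s IHs] u; first by rewrite leqn0 size_poly_eq0 => ->.
move=> us u0; have [/existsP[i ui]|] := boolP [exists i, (u i).[0] != 0].
  exists 0, u; split; last by exists i.
  by move=> j; rewrite expr0 mulr1.
rewrite negb_exists => /forallP u00.
have ex i : exists q, u i = q * 'X.
  have : root (u i) 0 by rewrite /root -[_ == _]negbK u00.
  by case/factor_theorem => q ->; exists q; rewrite subr0.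
have [q qE] := choice ex.
have q0 : q i0 != 0 by apply: contraNneq u0 => q0; rewrite qE q0 mul0r.
have [|n [w [wE wi]]] := IHs q _ q0.
  by move: us; rewrite qE size_mulX.
by exists n.+1, w; split=> // i; rewrite qE wE exprSr mulrA.
Qed.

Lemma poly_neq0_near0 (q : {poly R}) : q != 0 -> eventually (fun d => q.[d] != 0).
Proof.
move=> q0; have [|n [w [wE [[] w0]]]] := @poly_factor_X unit (fun=> q); first by exists tt.
have : eventually (fun d => (w tt).[d] != 0).
  have := w0; rewrite real_neqr_lt ?num_real // => /orP[wn|wp].
    apply: eventually_sub (@poly_pos_near0 (- w tt) _); rewrite ?hornerN ?oppr_gt0 //.
    by move=> d d0; rewrite hornerN oppr_gt0 => /lt_eqF ->.
  by apply: eventually_sub (poly_pos_near0 wp) => d d0 /gt_eqF ->.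
apply: eventually_sub => d d0 wd; rewrite (wE tt) hornerM hornerXn.
by rewrite mulf_neq0 // expf_neq0 // gt_eqF.
Qed.

End SmallParameter.

Section Perturbation.
Variables (R : realFieldType) (X : finType) (g : X -> nat -> R) (k : nat).
Implicit Types (S t u : {set X}).

Definition weakly_separating t u w : Prop :=
  [/\ forall x, x \in t -> 0 <= w x, forall x, x \in u -> w x <= 0
    & supported (t :|: u) (w : X -> R)].

Let moment (x : X) : R := (enum_rank x)%:R.

(* At [d = 0] these are the given points, at [d = 1] points of the moment curve,
which are generic by Vandermonde. *)
Let G (x : X) (i : nat) : {poly R} := (1 - 'X) * (g x i)%:P + 'X * (moment x ^+ i)%:P.
Definition perturbed (d : R) x i : R := (G x i).[d].

Lemma perturbed0 x i : perturbed 0 x i = g x i.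
Proof. by rewrite /perturbed /G !hornerE; ring. Qed.

Lemma perturbed1 x i : perturbed 1 x i = moment x ^+ i.
Proof. by rewrite /perturbed /G !hornerE; ring. Qed.

Let minor S : {poly R} := \det (\matrix_(i, j < #|S|) G (enum_val i) j).

Lemma horner_minor S d :
  (minor S).[d] = \det (\matrix_(i, j < #|S|) perturbed d (enum_val i) j).
Proof.
rewrite /minor -[LHS]/(horner_eval d _) -det_map_mx; congr (\det _).
by apply/matrixP => i j; rewrite !mxE.
Qed.

Lemma minor_neq0 S : minor S != 0.
Proof.
apply/eqP => m0; have := horner_minor S 1; rewrite m0 horner0.
pose a : 'rV[R]_#|S| := \row_i moment (enum_val i).
rewrite (_ : \matrix_(_, _) _ = (Vandermonde #|S| a)^T); last first.
  by apply/matrixP => i j; rewrite !mxE perturbed1.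
rewrite det_tr det_Vandermonde => /esym/eqP; rewrite prodf_seq_eq0 => /hasP[i _ /=].
rewrite prodf_seq_eq0 => /hasP[j _ /= /andP[ij]].
rewrite !mxE subr_eq0 eqr_nat => /eqP/val_inj/enum_rank_inj/enum_val_inj e.
by rewrite e ltnn in ij.
Qed.

Lemma sum_supported S (w f : X -> R) : supported S w ->
  \sum_x w x * f x = \sum_(i < #|S|) w (enum_val i) * f (enum_val i).
Proof.
move=> sw; rewrite -(big_enum_val (A := mem S) (fun x => w x * f x)) /=.
rewrite (bigID (mem S)) /= [X in _ + X]big1 ?addr0 // => x xS.
by rewrite sw // mul0r.
Qed.

Lemma perturbed_generic : eventually (fun d => generic (perturbed d) k).
Proof.
have : eventually (fun d => forall S, (minor S).[d] != 0).
  by apply: eventually_all => S; apply: poly_neq0_near0; apply: minor_neq0.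
apply: eventually_sub => d d0 mS S w _ sw dw x.
have [xS|/sw //] := boolP (x \in S).
pose v := \row_(i < #|S|) w (enum_val i).
suff v0 : v = 0.
  by have /rowP/(_ (enum_rank_in xS x)) := v0; rewrite !mxE enum_rankK_in.
apply/eqP; apply: contraT => v0; have := mS S; rewrite horner_minor => /det0P[].
exists v => //; apply/rowP => j; rewrite !mxE.
transitivity (\sum_x w x * perturbed d x j); last exact: dw.
by rewrite (sum_supported _ sw); apply: eq_bigr => i _; rewrite !mxE.
Qed.

Lemma polynomial_dependence S : (#|S| = k.+1)%N -> exists W : X -> {poly R},
  [/\ forall d, supported S (fun x => (W x).[d]),
      forall d, dependence (perturbed d) k (fun x => (W x).[d])
    & exists2 x, x \in S & (W x).[0] != 0].
Proof.
(* The zero column makes the square matrix singular, which yields a polynomial kernel vector. *)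
move=> cS; pose B : 'M[{poly R}]_#|S| := \matrix_(i, j) if (j < k)%N then G (enum_val i) j else 0.
have kS : (k < #|S|)%N by rewrite cS.
have : \det B == 0.
  rewrite (expand_det_col _ (Ordinal kS)) big1 // => i _.
  by rewrite mxE /= ltnn mul0r.
case/det0P => v v0 vB.
have [n [w [wE [i0 wi]]]] : exists n, exists w : 'I_#|S| -> {poly R},
    (forall i, v 0 i = w i * 'X^n) /\ exists i, (w i).[0] != 0.
  by apply: poly_factor_X; apply/rV0Pn.
have wB j : (j < k)%N -> \sum_i w i * G (enum_val i) j = 0.
  move=> jk; have jS : (j < #|S|)%N by apply: ltn_trans jk kS.
  have /rowP/(_ (Ordinal jS)) := vB; rewrite !mxE.
  under eq_bigr => i _ do rewrite wE mxE /= jk mulrAC.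
  by rewrite -mulr_suml => /eqP; rewrite mulf_eq0 expf_eq0 polyX_eq0 andbF orbF => /eqP.
pose W x := \sum_i w i * ((enum_val i == x)%:R : {poly R}).
have WE i : W (enum_val i) = w i.
  rewrite /W (bigD1 i) //= eqxx mulr1 big1 ?addr0 // => j ji.
  by rewrite (inj_eq enum_val_inj) (negPf ji) mulr0.
have sW d : supported S (fun x => (W x).[d]).
  move=> x xS; rewrite /W big1 ?horner0 // => i _.
  case: eqP => [e|_]; last by rewrite mulr0.
  by rewrite -e enum_valP in xS.
exists W; split=> //; last by exists (enum_val i0); rewrite ?enum_valP ?WE.
move=> d j jk; rewrite (sum_supported _ (sW d)) -[RHS](horner0 d) -(wB j jk) horner_sum.
by apply: eq_bigr => i _; rewrite WE hornerM.
Qed.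

Lemma dependence_unique (h : X -> nat -> R) S w1 w2 x : generic h k -> #|S| = k.+1 ->
  supported S w1 -> supported S w2 -> dependence h k w1 -> dependence h k w2 ->
  x \in S -> forall y, w1 y * w2 x = w2 y * w1 x.
Proof.
move=> gen cS s1 s2 d1 d2 xS y; apply/eqP; rewrite -subr_eq0; apply/eqP.
have := gen (S :\ x) (fun y => w2 x * w1 y + (- w1 x) * w2 y).
have -> : #|S :\ x| = k by move: cS; rewrite (cardsD1 x) xS => -[].
move=> /(_ (leqnn _)) H.
have -> : w1 y * w2 x - w2 y * w1 x = w2 x * w1 y + (- w1 x) * w2 y by ring.
apply: H.
- move=> z; rewrite !inE negb_and negbK => /orP[/eqP -> /=|zS]; first by ring.
  by rewrite (s1 z zS) (s2 z zS); ring.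
- by apply: dependence_combine.
Qed.

(** If a nonzero weak dependence exists, strictness makes it unique up to scale, and its signs
    persist. If none exists, the limiting dependence and its negative each violate some sign
    condition strictly, and these violations persist. *)
Lemma crosses_perturbed t u : [disjoint t & u] -> (#|t| + #|u| = k.+1)%N ->
  (forall w, weakly_separating t u w -> dependence g k w -> (exists x, w x != 0) ->
     separating t u w) ->
  eventually (fun d => crosses (perturbed d) t u =
    `[< exists w, [/\ weakly_separating t u w, dependence g k w & exists x, w x != 0] >]).
Proof.
move=> tu ctu strict; set S := t :|: u.
have cS : #|S| = k.+1 by rewrite cardsU (disjoint_setI0 tu) cards0 subn0.
have [W [sW dW [x0 x0S W0]]] := polynomial_dependence cS.
have dW0 : dependence g k (fun x => (W x).[0]).
  move=> i ik; transitivity (\sum_x (W x).[0] * perturbed 0 x i); last exact: dW.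
  by apply: eq_bigr => x _; rewrite perturbed0.
have posW x : 0 < (W x).[0] -> eventually (fun d => 0 < (W x).[d]).
  exact: poly_pos_near0.
have negW x : (W x).[0] < 0 -> eventually (fun d => (W x).[d] < 0).
  move=> n; apply: eventually_sub (@poly_pos_near0 _ (- W x) _); rewrite ?hornerN ?oppr_gt0 //.
  by move=> d d0; rewrite hornerN oppr_gt0.
have [[w [ww dw [y wy]]]|N] := asboolP (exists w, [/\ weakly_separating t u w, dependence g k w & exists x, w x != 0]).
  have [s1 s2 s3] := strict w ww dw (ex_intro _ y wy).
  have sw : forall x, x \in S -> w x != 0.
    by move=> x; rewrite inE => /orP[/s1/gt_eqF ->|/s2/lt_eqF ->].
  (* [(W x).[0]] is a multiple of [w]: otherwise subtracting a suitable multiple of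
  one from the other would give a weak dependence that is not strict. *)
  case: (arg_minP (P := mem S) (fun x => (W x).[0] / w x) x0S) => x xS' xmin.
  have {xS'}xS : x \in S := xS'.
  pose c := (W x).[0] / w x; pose r y := 1 * (W y).[0] + (- c) * w y.
  have rx : r x = 0 by rewrite /r /c mul1r mulNr divfK ?subrr ?sw.
  have r_div z : z \in S -> 0 <= r z / w z.
    by move=> zS; rewrite /r mul1r mulrDl !mulNr mulfK ?sw // subr_ge0 xmin.
  have wr : weakly_separating t u r.
    split=> z zin.
    - have := r_div z; rewrite inE zin => /(_ isT).
      by rewrite pmulr_lge0 // invr_gt0 s1.
    - have := r_div z; rewrite inE zin orbT => /(_ isT).
      by rewrite nmulr_lge0 // invr_lt0 s2.
    - by rewrite /r sW // s3 // !mulr0 addr0.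
  have r0 z : r z = 0.
    apply/eqP; apply: contraT => rz.
    have [r1 r2 _] := strict r wr (dependence_combine _ _ dW0 dw) (ex_intro _ z rz).
    by move: xS; rewrite inE => /orP[/r1|/r2]; rewrite rx ltxx.
  have WE z : (W z).[0] = c * w z.
    by apply/eqP; rewrite -subr_eq0 -[X in _ == X](r0 z) /r mul1r mulNr.
  have c0 : c != 0 by apply: contraNneq W0 => c0; rewrite WE c0 mul0r.
  suff : eventually (fun d => forall z, z \in S -> 0 < (W z).[d] / c * w z).
    apply: eventually_sub => d d0 H; apply/asboolP.
    exists (fun z => (W z).[d] / c).
      split=> z zin; last by rewrite sW ?mul0r.
        by have := H z; rewrite inE zin => /(_ isT); rewrite pmulr_lgt0 ?s1.
      by have := H z; rewrite inE zin orbT => /(_ isT); rewrite nmulr_lgt0 ?s2.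
    move=> i; rewrite ctu => ik; under eq_bigr do rewrite mulrAC.
    by rewrite -mulr_suml dW // mul0r.
  apply: eventually_all => z.
  have [zS|zS] := boolP (z \in S); last by exists 1.
  apply: eventually_sub (poly_pos_near0 (q := W z * (w z / c)%:P) _).
    by move=> d _; rewrite hornerM hornerC mulrA mulrAC.
  have E : c * w z * (w z / c) = w z ^+ 2 by field.
  by rewrite hornerM hornerC WE E exprn_even_gt0 //= sw.
have wrong (s : bool) : exists2 x, x \in S &
    eventually (fun d => ((x \in t) && ((-1) ^+ s * (W x).[d] < 0)) ||
                         ((x \in u) && (0 < (-1) ^+ s * (W x).[d]))).
  pose w x := (-1) ^+ s * (W x).[0].
  have dw : dependence g k w.
    by move=> i ik; under eq_bigr do rewrite -mulrA; rewrite -mulr_sumr dW0 // mulr0.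
  have w0 : exists x, w x != 0 by exists x0; rewrite /w mulf_neq0 // signr_eq0.
  have [x xP] : exists x, ((x \in t) && (w x < 0)) || ((x \in u) && (0 < w x)).
    apply: contrapT => nx; apply: N; exists w; split=> //; split=> x xin.
    - by rewrite leNgt; apply/negP => wx; apply: nx; exists x; rewrite xin wx.
    - by rewrite leNgt; apply/negP => wx; apply: nx; exists x; rewrite xin wx orbT.
    - by rewrite /w sW ?mulr0.
  exists x; first by rewrite inE; case/orP: xP => /andP[-> _]; rewrite ?orbT.
  case/orP: xP => /andP[xin wx].
    apply: eventually_sub (poly_pos_near0 (q := - ((-1) ^+ s)%:P * W x) _).
      by move=> d _; rewrite !hornerE xin => H; rewrite -oppr_gt0 -mulNr H.
    by rewrite !hornerE mulNr oppr_gt0.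
  apply: eventually_sub (poly_pos_near0 (q := ((-1) ^+ s)%:P * W x) _).
    by move=> d _; rewrite !hornerE xin => ->; rewrite orbT.
  by rewrite !hornerE.
have [x1 x1S H1] := wrong false; have [x2 x2S H2] := wrong true.
apply: eventually_sub (eventually_and perturbed_generic (eventually_and H1 H2)).
move=> d d0 [gen [h1 h2]].
(* A separating [w] would be proportional to [W] at [d], yet the two have opposite signs at [x1] and
   equal signs at [x2]. *)
apply/negbTE/asboolP => -[w [s1 s2 s3]]; rewrite ctu => dw.
have sw x : x \in S -> w x != 0.
  by rewrite inE => /orP[/s1/gt_eqF ->|/s2/lt_eqF ->].
have E := dependence_unique gen cS (sW d) s3 (dW d) dw x2S x1.
have W1 : (W x1).[d] * w x1 < 0.
  move: h1; rewrite !expr0 !mul1r => /orP[/andP[/s1 a b]|/andP[/s2 a b]].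
    by rewrite nmulr_rlt0.
  by rewrite pmulr_rlt0.
have W2 : 0 < (W x2).[d] * w x2.
  move: h2; rewrite !expr1 !mulN1r oppr_lt0 oppr_gt0 => /orP[/andP[/s1 a b]|/andP[/s2 a b]].
    by rewrite mulr_gt0.
  by rewrite nmulr_rgt0.
have : 0 <= ((W x1).[d] * w x1) * ((W x2).[d] * w x2).
  have -> : ((W x1).[d] * w x1) * ((W x2).[d] * w x2) = (w x1 * (W x2).[d]) * ((W x1).[d] * w x2).
    by ring.
  by rewrite E -expr2 sqr_ge0.
by rewrite leNgt nmulr_rlt0 // W2.
Qed.

Lemma exists_perturbation : exists h : X -> nat -> R, generic h k /\
  forall t u, [disjoint t & u] -> (#|t| + #|u| = k.+1)%N ->
    (forall w, weakly_separating t u w -> dependence g k w -> (exists x, w x != 0) ->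
       separating t u w) ->
    crosses h t u =
    `[< exists w, [/\ weakly_separating t u w, dependence g k w & exists x, w x != 0] >].
Proof.
pose Q t u d := [disjoint t & u] -> (#|t| + #|u| = k.+1)%N ->
    (forall w, weakly_separating t u w -> dependence g k w -> (exists x, w x != 0) ->
       separating t u w) ->
    crosses (perturbed d) t u =
    `[< exists w, [/\ weakly_separating t u w, dependence g k w & exists x, w x != 0] >].
have : eventually (fun d => forall t, forall u, Q t u d).
  apply: eventually_all => t; apply: eventually_all => u.
  have [[tu [ctu H]]|N] := asboolP ([disjoint t & u] /\ (#|t| + #|u| = k.+1)%N /\
      (forall w, weakly_separating t u w -> dependence g k w -> (exists x, w x != 0) ->
         separating t u w)).
    by apply: eventually_sub (crosses_perturbed tu ctu H) => d _ E _ _ _.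
  by exists 1 => // d _ _ tu ctu H; case: N.
move=> /(eventually_and perturbed_generic)[e e0 /(_ e e0 (lexx e))[gen H]].
by exists (perturbed e); split=> // t u; apply: H.
Qed.

End Perturbation.

Lemma odd_card_sum (I : finType) (P Q : pred I) :
  (odd #|[set i | P i && Q i]|)%:R = \sum_(i | P i) (Q i)%:R :> 'F_2.
Proof.
rewrite -natrF2 -sum1dep_card natr_sum big_mkcondr /=.
by apply: eq_bigr => i _; case: ifP.
Qed.

(** * Subdivisions of a complex *)

Section LinearSystems.
Variables (R : realFieldType) (A B : finType) (f : A -> B -> R).

Lemma exists_relation (S : {set A}) (T : {set B}) : (#|T| < #|S|)%N ->
  exists w, [/\ supported S w, forall b, b \in T -> \sum_a w a * f a b = 0
              & exists a, w a != 0].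
Proof.
move=> TS; pose g a i := if insub i is Some j then f a (enum_val (j : 'I_#|T|)) else 0.
have [w [sw dw w0]] := exists_dependence g TS; exists w; split=> // b bT.
have := dw _ (ltn_ord (enum_rank_in bT b)); apply: etrans; apply: eq_bigr => a _.
by rewrite /g valK enum_rankK_in.
Qed.

End LinearSystems.

Section Subdivision.
Variables (R : realFieldType) (V X : finType) (pos : X -> V -> R).
Variables (T : {set {set X}}) (M : {set {set V}}).
Implicit Types (r t : {set X}) (s : {set V}) (w : X -> R) (x y : X) (v : V).

Hypothesis M_sub : forall s1 s2, s1 \in M -> s2 \subset s1 -> s2 \in M.
Hypothesis pos_ge0 : forall x v, 0 <= pos x v.
Hypothesis T_sub : forall t1 t2, t1 \in T -> t2 \subset t1 -> t2 \in T.
(* Distinct simplices have disjoint relative interiors, stated in the cones they span. *)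
Hypothesis T_uniq : forall t1 t2 w1 w2, t1 \in T -> t2 \in T ->
  supported t1 w1 -> supported t2 w2 -> (forall x, 0 <= w1 x) -> (forall x, 0 <= w2 x) ->
  (forall v, \sum_x w1 x * pos x v = \sum_x w2 x * pos x v) -> w1 =1 w2.
Hypothesis T_cover : forall z : V -> R, (forall v, 0 <= z v) ->
  [set v | z v != 0] \in M -> exists t w, [/\ t \in T, supported t w,
    forall x, 0 <= w x & forall v, z v = \sum_x w x * pos x v].

(** [pos x] holds the barycentric coordinates of the vertex [x] of the subdivision [T] of [M]; the
    carrier spans the smallest face containing [t]. *)
Definition carrier t : {set V} := \bigcup_(x in t) [set v | pos x v != 0].

Definition cells s : {set {set X}} :=
  [set t in T | (#|t| == #|s|) && (carrier t \subset s)].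

(** The subdivided boundary of [s]. It refers only to proper faces, so it also makes sense for a
    simplex missing from [M]. *)
Definition rim s : {set {set X}} :=
  [set t in T | (#|t|.+1 == #|s|) && (carrier t \proper s)].

Lemma sub_carrier t x s : carrier t \subset s -> x \in t -> forall v, v \notin s -> pos x v = 0.
Proof.
move=> /bigcupsP H /H /fintype.subsetP xs v vs; apply/eqP.
by apply: contraNT vs => xv; apply: xs; rewrite inE.
Qed.

Lemma carrierS t1 t2 : t1 \subset t2 -> carrier t1 \subset carrier t2.
Proof.
move=> /fintype.subsetP tt; apply/bigcupsP => x /tt xt.
by apply: (bigcup_max x).
Qed.

(** The positive and negative parts of a relation are two nonnegative representations of one
    point. *)
Lemma T_indep t w : t \in T -> supported t w ->
  (forall v, \sum_x w x * pos x v = 0) -> forall x, w x = 0.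
Proof.
move=> tT sw w0 x.
have -> : w x = Num.max (w x) 0 - Num.max (- w x) 0.
  by rewrite -{2}oppr0 -Num.Theory.oppr_min opprK Num.Theory.addr_max_min addr0.
rewrite (@T_uniq t t (fun x => Num.max (w x) 0) (fun x => Num.max (- w x) 0)) ?subrr //.
- by move=> y /sw ->; rewrite maxxx.
- by move=> y /sw ->; rewrite oppr0 maxxx.
- by move=> y; rewrite le_max lexx orbT.
- by move=> y; rewrite le_max lexx orbT.
move=> v; apply/eqP; rewrite -subr_eq0 -sumrB -[X in _ == X](w0 v); apply/eqP.
apply: eq_bigr => y _; rewrite -mulrBl; congr (_ * _).
by rewrite -{2}oppr0 -Num.Theory.oppr_min opprK Num.Theory.addr_max_min addr0.
Qed.

Lemma T_eq t w1 w2 : t \in T -> supported t w1 -> supported t w2 ->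
  (forall v, \sum_x w1 x * pos x v = \sum_x w2 x * pos x v) -> w1 =1 w2.
Proof.
move=> tT s1 s2 E x; apply/eqP; rewrite -subr_eq0; apply/eqP.
apply: (T_indep (w := fun x => w1 x - w2 x) tT) => [y yt|v]; first by rewrite s1 // s2 // subrr.
by under eq_bigr do rewrite mulrBl; rewrite sumrB E subrr.
Qed.

Lemma card_carrier t s : t \in T -> carrier t \subset s -> (#|t| <= #|s|)%N.
Proof.
move=> tT ts; rewrite leqNgt; apply/negP => lt.
have [w [sw dw [x /eqP[]]]] := exists_relation pos lt.
apply: (T_indep tT sw) => v; have [vs|vs] := boolP (v \in s); first exact: dw.
rewrite big1 // => y _; have [yt|/sw ->] := boolP (y \in t); last by rewrite mul0r.
by rewrite (sub_carrier ts) ?mulr0.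
Qed.

Definition evalf (l : V -> R) x : R := \sum_v l v * pos x v.

Lemma sum_evalf (l : V -> R) w :
  \sum_x w x * evalf l x = \sum_v l v * \sum_x w x * pos x v.
Proof.
under eq_bigr do rewrite mulr_sumr; rewrite exchange_big /=; apply: eq_bigr => v _.
by rewrite mulr_sumr; apply: eq_bigr => x _; rewrite mulrCA.
Qed.

(** A cell has as many independent vertices as [s], so they span the coordinate space of [s]. *)
Lemma evalf_neq0 t s l : t \in cells s -> supported s l ->
  (forall x, x \in t -> evalf l x = 0) -> forall v, l v = 0.
Proof.
rewrite inE => /and3P[tT /eqP ct ts] sl lt v; apply/eqP; apply: contraT => lv.
have vs : v \in s by apply: contraNT lv => /sl ->.
have [|w [sw dw [x /eqP[]]]] := @exists_relation _ _ _ pos t (s :\ v).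
  by rewrite ct [X in (_ < X)%N](cardsD1 v) vs.
have dw' u : u != v -> \sum_x w x * pos x u = 0.
  have [us uv|us uv] := boolP (u \in s); first by apply: dw; rewrite !inE uv.
  rewrite big1 // => y _; have [yt|/sw ->] := boolP (y \in t); last by rewrite mul0r.
  by rewrite (sub_carrier ts) ?mulr0.
apply: (T_indep tT sw) => u; have [->|/dw'//] := eqVneq u v.
apply/eqP; have := sum_evalf l w; rewrite [LHS]big1; last first.
  by move=> y _; have [/lt ->|/sw ->] := boolP (y \in t); rewrite ?mulr0 ?mul0r.
rewrite (bigD1 v) //= [X in _ + X]big1 ?addr0; last by move=> u' /dw' ->; rewrite mulr0.
by move/esym/eqP; rewrite mulf_eq0 (negPf lv).
Qed.

Section Cofaces.
Variables (s : {set V}) (r : {set X}) (l : V -> R).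
Hypothesis sM : s \in M.
Hypothesis rT : r \in T.
Hypothesis card_r : #|r|.+1 = #|s|.
Hypothesis r_s : carrier r \subset s.
Hypothesis l_r : forall x, x \in r -> evalf l x = 0.

Let ones : X -> R := fun x => (x \in r)%:R.

(** The interior point [ones] of the cone on [r] is moved slightly towards [v]. A simplex that
    contains the moved points for arbitrarily small displacements contains [r] in the limit, and it
    has a vertex on the side of the hyperplane [l = 0] where [v] is. *)
Lemma coface_exists v : v \in s -> l v != 0 ->
  exists x, [/\ x \notin r, x |: r \in cells s & 0 < evalf l x * l v].
Proof.
move=> vs lv.
pose z (d : R) u := \sum_x ones x * pos x u + d * (u == v)%:R.
have z_ge0 d : 0 < d -> forall u, 0 <= z d u.
  move=> d0 u; rewrite addr_ge0 ?mulr_ge0 ?ler0n ?(ltW d0) //.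
  by rewrite sumr_ge0 // => x _; rewrite mulr_ge0 ?ler0n.
have z_s d u : u \notin s -> z d u = 0.
  move=> us; rewrite /z (negPf (_ : u != v)) ?mulr0 ?addr0; last first.
    by apply: contraNneq us => ->.
  rewrite big1 // => x _; rewrite /ones; case: (boolP (x \in r)) => xr; rewrite ?mul0r //.
  by rewrite (sub_carrier r_s) ?mulr0.
pose rep t d := exists w, [/\ supported t w, forall x, 0 <= w x &
   forall u, z d u = \sum_x w x * pos x u].
have ex_rep d : 0 < d -> exists2 t, t \in T & rep t d.
  move=> d0; have [||t [w [tT sw w0 E]]] := @T_cover (z d); first exact: z_ge0.
    apply: M_sub sM _; apply/fintype.subsetP => u; rewrite inE.
    by apply: contraNT => /z_s ->.
  by exists t => //; exists w.
(* Finitely many simplices cover all displacements, so one of them occurs for arbitrarily small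
   ones. *)
have [t [tT Ht]] : exists t, t \in T /\ forall e, 0 < e -> exists d, [/\ 0 < d, d <= e & rep t d].
  apply: contrapT => N.
  have : eventually (fun d : R => forall t, t \in T -> ~ rep t d).
    apply: eventually_all => t; have [tT|_] := boolP (t \in T); last by exists 1.
    apply: contrapT => N1; apply: N; exists t; split=> // e e0.
    apply: contrapT => N2; apply: N1; exists e => // d d0 de _ rd.
    by apply: N2; exists d.
  move=> [e e0 /(_ e e0 (lexx e)) H]; have [t tT /H] := ex_rep e e0; exact.
have [d1 [d1p _ [w1 [s1 p1 E1]]]] := Ht 1 ltr01.
have [d2 [d2p d21 [w2 [s2 p2 E2]]]] : exists d, [/\ 0 < d, d <= d1 / 2 & rep t d].
  by apply: Ht; rewrite divr_gt0.
have d12 : d1 - d2 != 0 by apply: lt0r_neq0; lra.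
(* Two displacements determine the weights on [t] as affine functions [w0 + d * we] of the
   displacement [d]. *)
pose we x := (w1 x - w2 x) / (d1 - d2); pose w0 x := w1 x - d1 * we x.
have swe : supported t we by move=> x xt; rewrite /we s1 // s2 // subrr mul0r.
have sw0 : supported t w0 by move=> x xt; rewrite /w0 s1 // swe // mulr0 subrr.
have sum_we u : \sum_x we x * pos x u = (u == v)%:R.
  have -> : \sum_x we x * pos x u = (\sum_x w1 x * pos x u - \sum_x w2 x * pos x u) / (d1 - d2).
    rewrite -sumrB mulr_suml; apply: eq_bigr => x _; rewrite /we; ring.
  by rewrite -E1 -E2 /z; field.
have sum_w0 u : \sum_x w0 x * pos x u = \sum_x ones x * pos x u.
  under eq_bigr do rewrite mulrBl -mulrA; rewrite sumrB -mulr_sumr sum_we -E1 /z; ring.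
have w_affine d w : supported t w -> (forall u, z d u = \sum_x w x * pos x u) ->
    w =1 (fun x => w0 x + d * we x).
  move=> sw E; apply: (T_eq tT sw) => [x xt|u]; first by rewrite sw0 // swe // mulr0 addr0.
  rewrite -E; under [RHS]eq_bigr do rewrite mulrDl -mulrA.
  by rewrite big_split /= -mulr_sumr sum_we sum_w0.
(* [w0] is the limit of nonnegative weights as [d] tends to 0. *)
have w0_ge0 x : 0 <= w0 x.
  rewrite leNgt; apply/negP => n.
  have [d [dp de [w [sw pw E]]]] : exists d, [/\ 0 < d, d <= - w0 x / (1 + `|we x|) / 2 & rep t d].
    by apply: Ht; rewrite !divr_gt0 ?oppr_gt0 // ltr_pwDl.
  have := pw x; rewrite (w_affine d w) //; apply/negP; rewrite -ltNge.
  have B : 0 < 1 + `|we x| by rewrite ltr_pwDl.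
  have : d * (1 + `|we x|) <= - w0 x / 2.
    have -> : - w0 x / 2 = - w0 x / (1 + `|we x|) / 2 * (1 + `|we x|).
      by field; rewrite gt_eqF.
    by rewrite ler_pM2r.
  have : d * we x <= d * `|we x| by rewrite ler_pM2l // ler_norm.
  by rewrite mulrDr mulr1; lra.
have ones_t x : w0 x = ones x.
  by apply: (T_uniq tT rT sw0) => // y; rewrite /ones ?ler0n // => /negPf ->.
have rt : r \subset t.
  apply/fintype.subsetP => x xr; apply: contraT => /sw0; rewrite ones_t /ones xr => /eqP.
  by rewrite oner_eq0.
pose t1 := r :|: [set x | w1 x != 0].
have t1t : t1 \subset t.
  rewrite finset.subUset rt; apply/fintype.subsetP => x; rewrite inE.
  by apply: contraNT => /s1 ->.
have t1s : carrier t1 \subset s.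
  apply/bigcupsP => x; rewrite !inE => /orP[xr|wx].
    by move/bigcupsP: r_s; apply.
  apply/fintype.subsetP => u; rewrite inE; apply: contraNT => us.
  have := z_s d1 u us; rewrite E1 => /eqP.
  rewrite psumr_eq0 => [/allP/(_ x (mem_index_enum x))|y _]; last by rewrite mulr_ge0.
  by rewrite mulf_eq0 (negPf wx).
have lz : \sum_x w1 x * evalf l x = d1 * l v.
  rewrite sum_evalf; transitivity (\sum_u l u * z d1 u).
    by apply: eq_bigr => u _; rewrite E1.
  under eq_bigr do rewrite /z mulrDr; rewrite big_split /= -sum_evalf big1 ?add0r.
    rewrite (bigD1 v) //= eqxx mulr1 mulrC big1 ?addr0 // => u /negPf ->.
    by rewrite !mulr0.
  by move=> x _; rewrite /ones; case: (boolP (x \in r)) => [/l_r->|]; rewrite ?mulr0 ?mul0r.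
have [x /andP[xr wx]] : exists x, (x \notin r) && (w1 x * evalf l x != 0).
  apply: contrapT => N; have := lz; rewrite big1 => [/esym/eqP|x _].
    by rewrite mulf_eq0 (negPf lv) gt_eqF.
  have [/l_r ->|xr] := boolP (x \in r); first by rewrite mulr0.
  by apply/eqP; apply: contraT => wx; case: N; exists x; rewrite xr.
have xt1 : x |: r \subset t1.
  rewrite finset.subUset finset.subsetUl sub1set !inE andbT.
  by apply/orP; right; apply: contraNneq wx => ->; rewrite mul0r.
have ct1 : t1 = x |: r.
  apply/esym/eqP; rewrite eqEcard xt1 cardsU1 xr add1n card_r.
  by apply: card_carrier => //; apply: T_sub tT t1t.
exists x; split=> //.
  rewrite inE (T_sub tT (fintype.subset_trans xt1 t1t)) cardsU1 xr add1n card_r eqxx.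
  by rewrite -ct1.
have : \sum_y w1 y * evalf l y = w1 x * evalf l x.
  rewrite (bigD1 x) //= big1 ?addr0 // => y yx.
  have [/l_r ->|yr] := boolP (y \in r); first by rewrite mulr0.
  have := set11 y; have : y \notin t1 by rewrite ct1 !inE negb_or yx.
  by rewrite !inE negb_or negbK => /andP[_ /eqP ->]; rewrite mul0r.
rewrite lz => E.
have wxp : 0 < w1 x.
  by rewrite lt_def p1 andbT; apply: contraNneq wx => ->; rewrite mul0r.
have : 0 < w1 x * evalf l x * l v.
  by rewrite -E -mulrA pmulr_rgt0 // -expr2 exprn_even_gt0.
by rewrite -mulrA pmulr_rgt0.
Qed.

(** The [#|s|.+1] vertices of the two cofaces satisfy a relation, and [l] forces opposite signs at
    [x] and [y]. Separating the signs produces a point with different representations in the two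
    cofaces, against [T_uniq]. *)
Lemma coface_unique x y : x \notin r -> y \notin r -> x |: r \in cells s ->
  y |: r \in cells s -> 0 < evalf l x * evalf l y -> x = y.
Proof.
move=> xr yr xs ys lxy; apply/eqP; apply: contraT => xy.
have [[xT _ xs'] [yT _ ys']] : [/\ x |: r \in T, true & carrier (x |: r) \subset s] /\
    [/\ y |: r \in T, true & carrier (y |: r) \subset s].
  by move: xs ys; rewrite !inE => /and3P[-> _ ->] /and3P[-> _ ->].
have [|w [sw dw w0]] := @exists_relation _ _ _ pos (x |: (y |: r)) s.
  by rewrite !cardsU1 !inE negb_or xy xr yr !add1n card_r.
have {}dw v : \sum_z w z * pos z v = 0.
  have [/dw//|vs] := boolP (v \in s); rewrite big1 // => z _.
  have [|/sw ->] := boolP (z \in x |: (y |: r)); last by rewrite mul0r.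
  rewrite in_setU1 => /orP[/eqP ->|zt]; first by rewrite (sub_carrier xs') ?setU11 ?mulr0.
  by rewrite (sub_carrier ys') ?mulr0.
have lw : w x * evalf l x + w y * evalf l y = 0.
  transitivity (\sum_z w z * evalf l z).
    rewrite (bigD1 x) //= (bigD1 y) ?(eq_sym y) //= big1 ?addr0 // => z /andP[zx zy].
    have [/l_r ->|zr] := boolP (z \in r); first by rewrite mulr0.
    by rewrite sw ?mul0r // !inE !negb_or zx zy.
  by rewrite sum_evalf big1 // => v _; rewrite dw mulr0.
have lx0 : evalf l x != 0 by apply: contraTneq lxy => ->; rewrite mul0r ltxx.
have wx0 : w x != 0.
  case: w0 => z; apply: contraNneq => wx; rewrite (T_indep yT _ dw) // => z'.
  rewrite in_setU1 => z'y; have [->//|z'x] := eqVneq z' x.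
  by apply: sw; rewrite !in_setU1 negb_or z'x.
have wxy : w x * w y < 0.
  have : w y * evalf l y * evalf l x = - (w x * evalf l x ^+ 2).
    by rewrite (_ : w y * evalf l y = - (w x * evalf l x)); [ring|apply/eqP; rewrite -addr_eq0 addrC lw].
  move=> E; have : w x * w y * (evalf l x * evalf l y) < 0.
    rewrite (_ : _ * _ = w x * (w y * evalf l y * evalf l x)); last by ring.
    rewrite E mulrN oppr_lt0 mulrA -expr2 mulr_gt0 //.
      by rewrite exprn_even_gt0.
    by rewrite exprn_even_gt0.
  by rewrite pmulr_llt0.
pose B := \sum_z `|w z|.
have BP z : - B <= w z /\ w z <= B.
  have : `|w z| <= B by rewrite /B (bigD1 z) //= lerDl sumr_ge0.
  by rewrite ler_norml => /andP[].
have main x1 y1 : x1 != y1 -> x1 \notin r -> y1 \notin r -> x1 |: r \in T -> y1 |: r \in T ->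
    supported (x1 |: (y1 |: r)) w -> 0 < w x1 -> w y1 < 0 -> False.
  move=> xy1 x1r y1r x1T y1T sw1 wx1 wy1.
  (* Adding [B] on [r] to both sides makes all weights nonnegative and leaves their difference equal
     to [w]. *)
  pose a z := if z \in r then B + w z else if z == x1 then w z else 0.
  pose b z := if z \in r then B else if z == y1 then - w z else 0.
  have /(_ x1) : a =1 b.
    apply: (T_uniq x1T y1T).
    - by move=> z; rewrite in_setU1 negb_or => /andP[/negPf zx /negPf zr]; rewrite /a zr zx.
    - by move=> z; rewrite in_setU1 negb_or => /andP[/negPf zy /negPf zr]; rewrite /b zr zy.
    - move=> z; rewrite /a; case: ifP => _; first by have [] := BP z; lra.
      by case: eqP => [->|//]; exact: ltW.
    - move=> z; rewrite /b; case: ifP => _; first by have [] := BP z; lra.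
      by case: eqP => [->|//]; lra.
    move=> v; apply/eqP; rewrite -subr_eq0 -sumrB -[X in _ == X](dw v); apply/eqP.
    apply: eq_bigr => z _; rewrite -mulrBl; congr (_ * _); rewrite /a /b.
    have [zr|zr] := boolP (z \in r); first by ring.
    have [->|zx] := eqVneq z x1; first by rewrite (negPf xy1) subr0.
    have [->|zy] := eqVneq z y1; first by ring.
    by rewrite sw1 ?subr0 // !inE !negb_or zx zy.
  by rewrite /a /b (negPf x1r) eqxx (negPf xy1) => e; rewrite e ltxx in wx1.
have swC : supported (y |: (x |: r)) w by move=> z; rewrite setUCA; exact: sw.
have [wx|wx|/esym wx] := ltgtP 0 (w x).
- by case: (main x y) => //; rewrite -(pmulr_rlt0 _ wx).
- by case: (main y x) => //; rewrite 1?eq_sym // -(nmulr_rlt0 _ wx).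
- by rewrite wx eqxx in wx0.
Qed.

End Cofaces.

Lemma cofaces_sub s r x : x \notin r -> x |: r \in cells s ->
  [&& r \in T, #|r|.+1 == #|s| & carrier r \subset s].
Proof.
move=> xr; rewrite inE cardsU1 xr add1n => /and3P[tT -> ts].
rewrite (T_sub tT (subsetU1 _ _)) (fintype.subset_trans _ ts) //.
exact: carrierS (subsetU1 _ _).
Qed.

(** If the carrier of [r] omits a vertex [v] of [s], then [s] lies on one side of [r], where the
    coordinate [v] is nonnegative, and there is one coface. If the carrier is [s], then [r] runs
    through the interior and has a coface on each side. *)
Lemma odd_cofaces s r : s \in M ->
  odd #|[set x | (x \notin r) && (x |: r \in cells s)]| = (r \in rim s).
Proof.
move=> sM; rewrite inE properE.
have [/and3P[rT /eqP cr rs]|N] := boolP [&& r \in T, #|r|.+1 == #|s| & carrier r \subset s];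
  last first.
  rewrite (_ : [set x | _] = set0) ?cards0.
    by symmetry; apply: contraNF N => /and4P[-> -> ->].
  apply/setP => x; rewrite !inE; apply: contraNF N => /andP[xr xs].
  by apply: cofaces_sub xr _; rewrite inE.
rewrite rT cr eqxx rs /=.
have neq0 l x : supported s l -> (forall y, y \in r -> evalf l y = 0) ->
    (exists v, l v != 0) -> x \notin r -> x |: r \in cells s -> evalf l x != 0.
  move=> sl lr [v /eqP lv] xr xs; apply/eqP => lx; apply: lv.
  by apply: (evalf_neq0 xs sl) => y; rewrite in_setU1 => /orP[/eqP ->|/lr].
have [sr|/subsetPn[v vs vr]] := boolP (s \subset carrier r); last first.
  pose l u : R := (u == v)%:R.
  have sl : supported s l by move=> u; rewrite /l; case: eqP => // ->; rewrite vs.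
  have lE x : evalf l x = pos x v.
    by rewrite /evalf (bigD1 v) //= /l eqxx mul1r big1 ?addr0 // => u /negPf ->; rewrite mul0r.
  have lr x : x \in r -> evalf l x = 0.
    by move=> xr; rewrite lE (sub_carrier (s := carrier r) _ xr).
  have lv : l v != 0 by rewrite /l eqxx oner_eq0.
  have [x [xr xs lx]] := coface_exists sM rT cr rs lr vs lv.
  rewrite (_ : [set x | _] = [set x]) ?cards1 //; apply/setP => y; rewrite !in_set1 inE.
  apply/andP/eqP => [[yr ys]|->//].
  apply: (coface_unique cr lr yr xr ys xs).
  have ge0 z : 0 <= evalf l z by rewrite lE.
  by rewrite mulr_gt0 // lt_def ge0 andbT; apply: (neq0 l) => //; exists v.
(* A hyperplane through [r]. It contains the point [z], whose coordinates on [s] are all positive,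
   so [l] takes both signs on the vertices of [s]. *)
have [|l [sl lr [v lv]]] := @exists_relation _ _ _ (fun v x => pos x v) s r.
  by rewrite -cr.
have {}lr x : x \in r -> evalf l x = 0 by exact: lr.
pose z u := \sum_(x in r) pos x u.
have z_gt0 u : u \in s -> 0 < z u.
  move=> us; have /bigcupP[x xr] := fintype.subsetP sr _ us; rewrite inE => xu.
  rewrite /z (bigD1 x) //= ltr_pwDl ?lt_def ?xu ?pos_ge0 //.
  by rewrite sumr_ge0.
have lz : \sum_u l u * z u = 0.
  under eq_bigr do rewrite mulr_sumr; rewrite exchange_big big1 // => x xr; exact: lr.
have sign (e : bool) : exists2 u, u \in s & 0 < (-1) ^+ e * l u.
  apply: contrapT => N.
  have n u : u \in s -> (-1) ^+ e * l u * z u <= 0.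
    move=> us; rewrite pmulr_lle0 ?z_gt0 // leNgt; apply/negP => p.
    by apply: N; exists u.
  have : \sum_u - ((-1) ^+ e * l u * z u) = 0.
    by rewrite sumrN; under eq_bigr do rewrite -mulrA; rewrite -mulr_sumr lz mulr0 oppr0.
  move/eqP; rewrite psumr_eq0 => [/allP/(_ v (mem_index_enum v))|u _].
    have vs : v \in s by apply: contraNT lv => /sl ->.
    by rewrite oppr_eq0 !mulf_eq0 signr_eq0 (negPf lv) gt_eqF ?z_gt0.
  by rewrite oppr_ge0; have [/n//|/sl ->] := boolP (u \in s); rewrite mulr0 mul0r.
have [v1 v1s] := sign false; rewrite expr0 mul1r => l1.
have [v2 v2s] := sign true; rewrite expr1 mulN1r oppr_gt0 => l2.
have [x1 [x1r x1s lx1]] := coface_exists sM rT cr rs lr v1s (lt0r_neq0 l1).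
have [x2 [x2r x2s lx2]] := coface_exists sM rT cr rs lr v2s (ltr0_neq0 l2).
rewrite pmulr_lgt0 // in lx1; rewrite nmulr_lgt0 // in lx2.
have x12 : x1 != x2 by apply: contraTneq lx1 => ->; rewrite -leNgt ltW.
rewrite (_ : [set x | _] = [set x1; x2]) ?cards2 ?x12 //; apply/setP => y; rewrite in_set2 inE.
apply/andP/orP => [[yr ys]|[]/eqP-> //].
have := neq0 l y sl lr (ex_intro _ v lv) yr ys.
rewrite real_neqr_lt ?num_real // => /orP[ly|ly]; [right|left]; apply/eqP.
  by apply: (coface_unique cr lr yr x2r ys x2s); rewrite nmulr_lgt0.
by apply: (coface_unique cr lr yr x1r ys x1s); rewrite mulr_gt0.
Qed.

(** The facet [s :\ v] contains [r] exactly if [v] is outside the carrier. As the carrier has at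
    least [#|r|] vertices, at most one [v] qualifies. *)
Lemma odd_facets s r :
  odd #|[set v in s | r \in cells (s :\ v)]| = (r \in rim s).
Proof.
rewrite inE properE.
have [/and3P[rT /eqP cr rs]|N] := boolP [&& r \in T, #|r|.+1 == #|s| & carrier r \subset s];
  last first.
  rewrite (_ : [set v in s | _] = set0) ?cards0.
    by symmetry; apply: contraNF N => /and4P[-> -> ->].
  apply/setP => v; rewrite !inE; apply: contraNF N => /and4P[vs -> /eqP cr rs].
  by rewrite cr [X in _ == X](cardsD1 v) vs eqxx (fintype.subset_trans rs) ?subD1set.
rewrite (_ : [set v in s | _] = s :\: carrier r); last first.
  apply/setP => v; rewrite !inE rT /= andbC [RHS]andbC.
  have [vs|] := boolP (v \in s); rewrite ?andbF // !andbT.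
  have -> : #|r| == #|s :\ v| by move: cr; rewrite (cardsD1 v s) vs => -[->].
  apply/idP/idP => [/fintype.subsetP H|vr]; last by rewrite subsetD1 rs.
  by apply/negP => /H; rewrite !inE eqxx.
rewrite rT cr eqxx rs /=.
have cD : (#|s :\: carrier r| <= 1)%N.
  by rewrite cardsD (setIidPr rs) -cr leq_subLR addn1 ltnS card_carrier.
rewrite -setD_eq0 -cards_eq0; by case: #|_| cD => [|[|]].
Qed.

Lemma sum_sym_F2 (I : finType) (f : I -> I -> 'F_2) :
  (forall i j, f i j = f j i) -> \sum_i \sum_(j | j != i) f i j = 0.
Proof.
move=> fC; pose lt (i j : I) := (enum_rank i < enum_rank j)%N.
have -> : \sum_i \sum_(j | j != i) f i j =
    \sum_i \sum_(j | lt i j) f i j + \sum_i \sum_(j | lt j i) f i j.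
  rewrite -big_split; apply: eq_bigr => i _; rewrite (bigID (lt i)) /=; congr (_ + _);
    apply: eq_bigl => j; rewrite /lt -(inj_eq enum_rank_inj) -val_eqE /=; lia.
rewrite [X in _ + X](exchange_big_dep xpredT) //=.
have -> : \sum_j \sum_(i | lt j i) f i j = \sum_i \sum_(j | lt i j) f i j.
  by apply: eq_bigr => j _; apply: eq_bigr => i _; apply: fC.
by rewrite addFF.
Qed.

(** The boundary of a boundary vanishes: the rim is the sum of the chains of the facets, and in its
    boundary the chain of [s] without [u] and [v] arises in both orders. *)
Lemma rim_even s r : (forall v, v \in s -> s :\ v \in M) ->
  odd #|[set x | (x \notin r) && (x |: r \in rim s)]| = false.
Proof.
move=> sM; suff : (odd #|[set x | (x \notin r) && (x |: r \in rim s)]|)%:R = 0 :> 'F_2.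
  by case: (odd _) => // /eqP; rewrite oner_eq0.
rewrite odd_card_sum.
under eq_bigr => x _ do rewrite -odd_facets odd_card_sum.
rewrite exchange_big /=.
under eq_bigr => v vs do rewrite -odd_card_sum odd_cofaces ?sM // -odd_facets odd_card_sum.
pose f u v : 'F_2 := if (u \in s) && (v \in s) then (r \in cells (s :\ v :\ u))%:R else 0.
rewrite -[RHS](sum_sym_F2 (f := f)); last first.
  by move=> u v; rewrite /f andbC setDDl [_ :|: _]setUC -setDDl.
rewrite big_mkcond; apply: eq_bigr => v _; rewrite /f.
have [vs|_] := boolP (v \in s); last by rewrite big1 // => u _; rewrite andbF.
rewrite [LHS]big_mkcond [RHS]big_mkcond; apply: eq_bigr => u _; rewrite in_setD1 /=.
by rewrite setDDl [_ :|: _]setUC -setDDl; case: eqP => //= _; case: ifP.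
Qed.

End Subdivision.

(** * The chain map of a subdivision and its cone *)

Section ChainMap.
Variables (R : realFieldType) (V Y : finType) (K : {set {set V}}) (N : nat).
Variables (phi : {set V} -> {set {set Y}}) (h : Y -> nat -> R).
Implicit Types (s t : {set V}) (a b r : {set Y}).

Hypothesis K_sub : forall s t, s \in K -> t \subset s -> t \in K.
Hypothesis phi0 : phi set0 = [set set0].
Hypothesis phi_card : forall s a, s \in K -> a \in phi s -> #|a| = #|s|.
Hypothesis phi_boundary : forall s r, s \in K ->
  odd #|[set y | (y \notin r) && (y |: r \in phi s)]| = odd #|[set v in s | r \in phi (s :\ v)]|.
Hypothesis phi_disjoint : forall s t a b, s \in K -> t \in K -> [disjoint s & t] ->
  a \in phi s -> b \in phi t -> [disjoint a & b].
Hypothesis h_generic : generic h N.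

Definition pairing (f : {set Y} -> {set Y} -> bool) s t : 'F_2 :=
  \sum_(a in phi s) \sum_(b in phi t) (f a b)%:R.

Lemma chain_boundary s (F : {set Y} -> 'F_2) : s \in K ->
  \sum_(v in s) \sum_(a in phi (s :\ v)) F a = \sum_(a in phi s) \sum_(y in a) F (a :\ y).
Proof.
move=> sK; rewrite (sum_boundary (mem (phi s)) F).
under eq_bigr do rewrite big_mkcond; rewrite exchange_big /=; apply: eq_bigr => r _.
rewrite phi_boundary // odd_card_sum mulr_suml; apply: eq_bigr => v _.
by case: ifP; rewrite ?mul1r ?mul0r.
Qed.

(** The relations for crossings extend bilinearly to chains, because [phi] commutes with boundaries
    and keeps disjoint simplices disjoint. *)
Lemma pairing_parity (W : {set V}) (n : nat) (a b c : V) : #|W| = n.*2.+1 ->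
  a \notin W -> b \notin W -> c \notin W -> a != b -> a != c -> b != c ->
  (n.*2.+1 <= N)%N ->
  (forall s x, s \subset W -> (#|s| <= n)%N -> x \in [set a; b; c] -> x |: s \in K) ->
  \sum_s \sum_(u | disjoint_pair W n s u)
    (pairing (crosses h) (c |: s) (a |: u) + pairing (crosses h) (c |: s) (b |: u)
     + pairing (crosses h) (b |: s) (a |: u)) = 1.
Proof.
move=> cW aW bW cW' ab ac bc nN KW.
apply: (@van_kampen_parity V _ (pairing (above h)) K N) => // [s t sK tK st stN|s t sK tK st stN|v vK].
- rewrite /pairing [X in _ + X]exchange_big /= -big_split; apply: eq_bigr => x xs /=.
  rewrite -big_split; apply: eq_bigr => y yt /=.
  have xy := phi_disjoint sK tK st xs yt.
  rewrite (crosses_above h_generic xy) ?(phi_card sK xs) ?(phi_card tK yt) //.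
  by do 2!case: above; rewrite /= ?addFF ?addr0 ?add0r.
- transitivity (\sum_(x in phi s) \sum_(y in phi t)
     (\sum_(v in x) (above h (x :\ v) y)%:R + \sum_(v in y) (above h x (y :\ v))%:R : 'F_2)).
    under [RHS]eq_bigr do rewrite big_split; rewrite big_split /=; congr (_ + _).
      rewrite (chain_boundary (fun x => \sum_(y in phi t) (above h x y)%:R) sK).
      by apply: eq_bigr => x _; rewrite exchange_big.
    rewrite exchange_big; apply: eq_bigr => x _.
    by rewrite (chain_boundary (fun y => (above h x y)%:R) tK).
  apply: eq_bigr => x xs; apply: eq_bigr => y yt.
  have xy := phi_disjoint sK tK st xs yt.
  by rewrite (crosses_boundary h_generic xy) ?(phi_card sK xs) ?(phi_card tK yt).
- rewrite /pairing phi0.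
  transitivity (\sum_(x in phi [set v]) (1 : 'F_2)).
    apply: eq_bigr => x xs; rewrite big_set1 (_ : crosses _ _ _ = true) //; apply/asboolP.
    have /cards1P[y ->] : #|x| == 1%N by rewrite (phi_card vK xs) cards1.
    rewrite cards1 cards0; exists (fun z => (z == y)%:R) => //; split=> z; rewrite !inE.
    + by move=> /eqP ->; rewrite eqxx ltr01.
    + by [].
    + by rewrite orbF => /negPf ->.
  (* At the empty face the boundary formula is the augmentation: the chain of a vertex has an odd
     number of points. *)
  have := phi_boundary set0 vK; rewrite (_ : [set u in _ | _] = [set v]) ?cards1; last first.
    apply/setP => u; rewrite !inE; have [->|] //= := eqVneq u v.
    by rewrite setDv phi0 set11.
  move=> o; rewrite sumr_const natrF2 (_ : odd _ = true) // -[RHS]/(odd 1) -o; congr (odd _).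
  rewrite -(card_imset _ (@set1_inj Y)); apply: eq_card => x; apply/idP/imsetP.
    move=> xs; have /cards1P[y yx] : #|x| == 1%N by rewrite (phi_card vK xs) cards1.
    by exists y; rewrite // inE in_set0 setU0 -yx.
  by move=> [y]; rewrite !inE setU0 => ys ->.
Qed.

End ChainMap.

Section ConeChainMap.
Variables (R : realFieldType) (V X : finType) (pos : X -> V -> R).
Variables (T : {set {set X}}) (M : {set {set V}}).
Implicit Types (r t : {set X}) (s : {set V}) (w : X -> R) (x y : X) (v : V).

Hypothesis M_set0 : set0 \in M.
Hypothesis M_sub : forall s1 s2, s1 \in M -> s2 \subset s1 -> s2 \in M.
Hypothesis pos_ge0 : forall x v, 0 <= pos x v.
Hypothesis pos_sum : forall x, \sum_v pos x v = 1.
Hypothesis T_set0 : set0 \in T.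
Hypothesis T_sub : forall t1 t2, t1 \in T -> t2 \subset t1 -> t2 \in T.
Hypothesis T_uniq : forall t1 t2 w1 w2, t1 \in T -> t2 \in T ->
  supported t1 w1 -> supported t2 w2 -> (forall x, 0 <= w1 x) -> (forall x, 0 <= w2 x) ->
  (forall v, \sum_x w1 x * pos x v = \sum_x w2 x * pos x v) -> w1 =1 w2.
Hypothesis T_cover : forall z : V -> R, (forall v, 0 <= z v) ->
  [set v | z v != 0] \in M -> exists t w, [/\ t \in T, supported t w,
    forall x, 0 <= w x & forall v, z v = \sum_x w x * pos x v].

Definition base (a : {set option X}) : {set X} := Some @^-1: a.

(* A simplex missing from [M] is filled by the cone from [None] over its boundary. *)
Definition cone_chain s : {set {set option X}} :=
  [set a : {set option X} | if s \in M then (None \notin a) && (base a \in cells pos T s)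
           else (None \in a) && (base a \in rim pos T s)].

Lemma card_base (a : {set option X}) : #|a| = ((None \in a) + #|base a|)%N.
Proof.
rewrite (cardsD1 None); congr (_ + _)%N; rewrite -[RHS](card_imset _ (@Some_inj _)).
apply: eq_card => -[x|]; rewrite !inE /=.
  by rewrite (mem_imset _ _ (@Some_inj _)) inE.
by apply/esym/negP => /imsetP[].
Qed.

Lemma baseU1 x (a : {set option X}) : base (Some x |: a) = x |: base a.
Proof. by apply/setP => y; rewrite !inE. Qed.

Lemma baseN1 (a : {set option X}) : base (None |: a) = base a.
Proof. by apply/setP => y; rewrite !inE. Qed.

Lemma odd_some (Q : pred (option X)) : ~~ Q None ->
  #|[set y | Q y]| = #|[set x | Q (Some x)]|.
Proof.
move=> QN; rewrite card_base inE (negPf QN) add0n.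
by apply: eq_card => x; rewrite !inE.
Qed.

Lemma cone_chain0 : cone_chain set0 = [set set0].
Proof.
apply/setP => a; rewrite !inE M_set0 cards0.
apply/idP/eqP => [/and3P[aN aT /andP[/eqP c _]]|->].
  by apply/eqP; rewrite -cards_eq0 card_base (negPf aN) c.
rewrite inE (_ : base set0 = set0); last by apply/setP => x; rewrite !inE.
by rewrite T_set0 cards0 /carrier big_set0 sub0set.
Qed.

Lemma cone_chain_card s a : a \in cone_chain s -> #|a| = #|s|.
Proof.
rewrite inE card_base; case: ifP => _ /andP[aN].
  by rewrite inE => /and3P[_ /eqP -> _]; rewrite (negPf aN).
by rewrite inE => /and3P[_ /eqP <- _]; rewrite aN.
Qed.

(** For a missing simplex, the boundary of the cone is the rim plus the cone over the boundary of
    the rim, and the latter is zero by [rim_even]. *)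
Lemma cone_chain_boundary s (r : {set option X}) : (forall v, v \in s -> s :\ v \in M) ->
  odd #|[set y | (y \notin r) && (y |: r \in cone_chain s)]| =
  odd #|[set v in s | r \in cone_chain (s :\ v)]|.
Proof.
move=> sM.
have -> : [set v in s | r \in cone_chain (s :\ v)] =
    [set v in s | (None \notin r) && (base r \in cells pos T (s :\ v))].
  apply/setP => v; rewrite !inE; have [vs|//] := boolP (v \in s).
  by rewrite /= sM.
have [rN|rN] := boolP (None \in r).
  rewrite [X in _ = odd #|pred_of_set X|](_ : _ = set0) ?cards0; last first.
    by apply/setP => v; rewrite !inE andbF.
  rewrite odd_some ?rN //.
  have [ms|ms] := boolP (s \in M).
    rewrite (_ : [set x | _] = set0) ?cards0 //; apply/setP => x; rewrite !inE ms rN.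
    by rewrite orbT andbF.
  rewrite -[RHS]/false -(rim_even M_sub pos_ge0 T_sub T_uniq T_cover (base r) sM) //.
  congr odd; apply: eq_card => x.
  by rewrite !inE (negPf ms) rN orbT /= baseU1.
rewrite /= odd_facets //.
have [ms|ms] := boolP (s \in M).
  rewrite odd_some; last by rewrite !inE ms eqxx andbF.
  rewrite -(odd_cofaces M_sub pos_ge0 T_sub T_uniq T_cover (base r) ms).
  congr odd; apply: eq_card => x.
  by rewrite !inE ms (negPf rN) /= baseU1.
rewrite (_ : [set y | _] = if base r \in rim pos T s then [set None] else set0).
  by case: ifP; rewrite ?cards1 ?cards0.
apply/setP => -[x|].
  rewrite inE; have -> : (Some x |: r \in cone_chain s) = false.
    by rewrite inE (negPf ms) in_setU1 /= (negPf rN).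
  rewrite andbF; case: ifP => _; first by rewrite in_set1.
  by rewrite in_set0.
rewrite inE rN inE (negPf ms) setU11 baseN1 /=.
by case: ifP; rewrite ?in_set1 ?inE.
Qed.

Lemma cone_chain_carrier s a x : a \in cone_chain s -> Some x \in a ->
  [set v | pos x v != 0] \subset s.
Proof.
move=> as_ xa; have xb : x \in base a by rewrite inE.
have : carrier pos (base a) \subset s.
  move: as_; rewrite inE; case: ifP => _ /andP[_]; rewrite inE => /and3P[_ _ //].
  exact: proper_sub.
apply: fintype.subset_trans; exact: (bigcup_max x).
Qed.

(** A common vertex of the subdivision would have its nonempty carrier in both [s] and [t]. The apex
    occurs in at most one chain, because one of the simplices is in [M]. *)
Lemma cone_chain_disjoint s (t : {set V}) a b : (s \in M) || (t \in M) -> [disjoint s & t] ->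
  a \in cone_chain s -> b \in cone_chain t -> [disjoint a & b].
Proof.
move=> stM st as_ bt; rewrite -setI_eq0; apply/eqP/setP => -[x|]; rewrite !inE; last first.
  apply/negP => /andP[aN bN]; move: as_ bt; rewrite !inE aN bN /=.
  by case/orP: stM => ->.
apply/negP => /andP[xa xb].
have [v xv] : exists v, pos x v != 0.
  apply: contrapT => N; have /eqP := pos_sum x; rewrite big1 ?(eq_sym 0) ?oner_eq0 // => v _.
  by apply/eqP; apply: contraT => xv; case: N; exists v.
have vs := fintype.subsetP (cone_chain_carrier as_ xa) v.
have vt := fintype.subsetP (cone_chain_carrier bt xb) v.
by move: vs vt; rewrite inE xv => /(_ isT) vs /(_ isT); rewrite (disjointFr st vs).
Qed.

End ConeChainMap.

From mathcomp Require Import classical_sets functions reals.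

(** * Embedded polyhedra *)

Section IndexedSimplices.
Variables (R : realType) (X : finType) (E : lmodType R) (f : X -> E).
Implicit Types (t u : {set X}) (s : {fset E}) (y : E) (w : X -> R).
Hypothesis f_inj : injective f.

(** Passes from subsets of a finite type, where the combinatorics takes place, to the finite point
    sets of geometric complexes. *)
Definition vertices t : {fset E} := [fset f x | x in t]%fset.

Lemma mem_vertices t x : (f x \in vertices t) = (x \in t).
Proof.
apply/imfsetP/idP => [[z zt /f_inj ->] //|xt]; by exists x.
Qed.

Lemma verticesP t y : reflect (exists2 x, x \in t & y = f x) (y \in vertices t).
Proof. by apply: (iffP (imfsetP _ _ _ _)). Qed.

Lemma sum_vertices t (V : nmodType) (G : E -> V) :
  \sum_(y <- vertices t) G y = \sum_(x in t) G (f x).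
Proof.
rewrite big_imfset /=; last by move=> x z _ _; apply: f_inj.
by rewrite big_enum_cond /=; apply: eq_bigl => x; rewrite andbT.
Qed.

Lemma card_vertices t : #|` vertices t| = #|t|.
Proof. by rewrite card_imfset //= cardE. Qed.

Lemma vertices_inj : injective vertices.
Proof. by move=> t u tu; apply/setP => x; rewrite -!mem_vertices tu. Qed.

Lemma verticesS t u : (vertices t `<=` vertices u)%fset = (t \subset u).
Proof.
apply/fsubsetP/fintype.subsetP => [H x|H y /verticesP[x xt ->]].
  by rewrite -!mem_vertices => /H.
by rewrite mem_vertices H.
Qed.

Lemma verticesI t u : (vertices t `&` vertices u)%fset = vertices (t :&: u).
Proof.
apply/fsetP => y; rewrite in_fsetI; apply/andP/verticesP => [[/verticesP[x xt ->]]|[x]].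
  by rewrite mem_vertices => xu; exists x; rewrite // inE xt.
by rewrite inE => /andP[xt xu] ->; rewrite !mem_vertices.
Qed.

Lemma sub_vertices t s : (s `<=` vertices t)%fset -> exists2 u : {set X}, u \subset t & s = vertices u.
Proof.
move=> /fsubsetP st; exists [set x | f x \in s].
  by apply/fintype.subsetP => x; rewrite inE => /st; rewrite mem_vertices.
apply/fsetP => y; apply/idP/verticesP => [ys|[x]]; last by rewrite inE => ? ->.
by have /verticesP[x xt yx] := st y ys; exists x; rewrite // inE -yx.
Qed.

Lemma sum_supp t w (G : X -> E) : supported t w ->
  \sum_(x in t) w x *: G x = \sum_x w x *: G x.
Proof.
move=> sw; rewrite [RHS](bigID (mem t)) /= [X in _ + X]big1 ?addr0 // => x /sw ->.
by rewrite scale0r.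
Qed.

Lemma sum_supp1 t w : supported t w -> \sum_(x in t) w x = \sum_x w x.
Proof.
by move=> sw; rewrite [RHS](bigID (mem t)) /= [X in _ + X]big1 ?addr0 // => x /sw ->.
Qed.

Lemma lift_weight t w : exists w' : E -> R, forall x, w' (f x) = w x.
Proof.
exists (fun y => \sum_x if f x == y then w x else 0) => x.
by rewrite (bigD1 x) //= eqxx big1 ?addr0 // => z zx; rewrite (inj_eq f_inj) (negPf zx).
Qed.

Lemma hull_vertices t y : hull (vertices t) y <->
  exists w, [/\ supported t w, forall x, 0 <= w x, \sum_x w x = 1 & y = \sum_x w x *: f x].
Proof.
split=> [[w [w0 w1 ->]]|[w [sw w0 w1 ->]]].
  pose w' x := if x \in t then w (f x) else 0.
  have sw : supported t w' by move=> x /negPf xt; rewrite /w' xt.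
  exists w'; split=> // [x||].
  - by rewrite /w'; case: ifP => // xt; rewrite w0 ?mem_vertices.
  - rewrite -(sum_supp1 sw) -[RHS]w1 sum_vertices; apply: eq_bigr => x xt.
    by rewrite /w' xt.
  - rewrite -(sum_supp _ sw) sum_vertices; apply: eq_bigr => x xt.
    by rewrite /w' xt.
have [w' wE] := lift_weight t w; exists w'; split=> [v /verticesP[x _ ->]||].
- by rewrite wE.
- by rewrite sum_vertices -w1 -(sum_supp1 sw); apply: eq_bigr => x _; rewrite wE.
- by rewrite sum_vertices -(sum_supp _ sw); apply: eq_bigr => x _; rewrite wE.
Qed.

Lemma aff_indep_vertices t : aff_indep (vertices t) <->
  forall w, supported t w -> \sum_x w x = 0 -> \sum_x w x *: f x = 0 -> forall x, w x = 0.
Proof.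
split=> [ind w sw w0 wf x|ind w w0 wf y /verticesP[x xt ->]].
  have [xt|/sw//] := boolP (x \in t); have [w' wE] := lift_weight t w.
  rewrite -wE; apply: ind; rewrite ?mem_vertices ?sum_vertices //.
    by rewrite -[RHS]w0 -(sum_supp1 sw); apply: eq_bigr => z _; rewrite wE.
  by rewrite -[RHS]wf -(sum_supp _ sw); apply: eq_bigr => z _; rewrite wE.
pose w' x := if x \in t then w (f x) else 0.
have sw : supported t w' by move=> z /negPf zt; rewrite /w' zt.
have w0' : \sum_x w' x = 0.
  rewrite -(sum_supp1 sw) -[RHS]w0 sum_vertices; apply: eq_bigr => z zt.
  by rewrite /w' zt.
have wf' : \sum_x w' x *: f x = 0.
  rewrite -(sum_supp _ sw) -[RHS]wf sum_vertices; apply: eq_bigr => z zt.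
  by rewrite /w' zt.
by have := ind w' sw w0' wf' x; rewrite /w' xt.
Qed.

(** Affinity is given along segments only; one vertex is split off at a time, by induction on the
    number of nonzero weights. *)
Lemma affine_sum (F : lmodType R) (g : E -> F) t w : affine_on (hull (vertices t)) g ->
  supported t w -> (forall x, 0 <= w x) -> \sum_x w x = 1 ->
  g (\sum_x w x *: f x) = \sum_x w x *: g (f x).
Proof.
move=> gt; have [n] := ubnP #|[set x | w x != 0]|; elim: n w => // n IHn w nn sw w0 w1.
have vtx x : x \in t -> hull (vertices t) (f x).
  move=> xt; apply/hull_vertices; exists (fun z => (z == x)%:R); split=> [z|z||].
  - by apply: contraNeq; rewrite pnatr_eq0 eqb0 negbK => /eqP ->.
  - exact: ler0n.
  - by rewrite (bigD1 x) //= eqxx big1 ?addr0 // => z /negPf ->.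
  - rewrite (bigD1 x) //= eqxx scale1r big1 ?addr0 // => z /negPf ->.
    by rewrite scale0r.
have [x wx] : exists x, w x != 0.
  apply: contrapT => N; have /eqP := w1; rewrite big1 ?(eq_sym 0) ?oner_eq0 // => x _.
  by apply/eqP; apply: contraT => wx; case: N; exists x.
have xt : x \in t by apply: contraNT wx => /sw ->.
have split_sum (V : lmodType R) (G : X -> V) (u : X -> R) :
    \sum_z u z *: G z = u x *: G x + \sum_(z | z != x) u z *: G z by rewrite (bigD1 x).
have w1' : \sum_(z | z != x) w z = 1 - w x by rewrite -w1 [in RHS](bigD1 x) //= addrC addrK.
have [wx1|wx1] := eqVneq (w x) 1.
  have z0 z : z != x -> w z = 0.
    move=> zx; move/eqP: w1'; rewrite wx1 subrr psumr_eq0 // => /allP/(_ z).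
    by rewrite mem_index_enum zx => /(_ isT)/eqP.
  rewrite !split_sum !big1 ?addr0 ?wx1 ?scale1r // => z /z0 ->; exact: scale0r.
have wx_lt1 : w x < 1.
  rewrite lt_neqAle wx1 -subr_ge0 -w1' sumr_ge0 //.
have c0 : 1 - w x != 0 by rewrite subr_eq0 eq_sym.
pose u z := if z == x then 0 else w z / (1 - w x).
have su : supported t u by move=> z zt; rewrite /u sw // mul0r if_same.
have u0 z : 0 <= u z.
  by rewrite /u; case: ifP => // _; rewrite divr_ge0 // subr_ge0 ltW.
have u1 : \sum_z u z = 1.
  rewrite (bigD1 x) //= /u eqxx add0r.
  under eq_bigr => z /negPf zx do rewrite zx.
  by rewrite -mulr_suml w1' divff.
have sumE (V : lmodType R) (G : X -> V) :
    \sum_z w z *: G z = w x *: G x + (1 - w x) *: \sum_z u z *: G z.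
  rewrite !split_sum /u eqxx scale0r add0r scaler_sumr; congr (_ + _).
  apply: eq_bigr => z /negPf ->; by rewrite scalerA mulrC divfK.
rewrite !sumE gt.
- congr (_ + _ *: _); apply: IHn => //.
  rewrite ltnS in nn; apply: leq_trans nn; rewrite (cardsD1 x [set z | w z != 0]) inE wx add1n ltnS.
  apply: subset_leq_card; apply/fintype.subsetP => z; rewrite !inE /u.
  have [->|zx] := eqVneq z x; first by rewrite eqxx.
  by rewrite mulf_eq0 negb_or => /andP[].
- by rewrite w0 ltW.
- exact: vtx.
- by apply/hull_vertices; exists u.
Qed.

End IndexedSimplices.

Lemma index_complex (R : realType) (E : lmodType R) (T : {fset {fset E}}) :
  (forall s t : {fset E}, s \in T -> (t `<=` s)%fset -> t \in T) ->
  exists (X : finType) (e : X -> E) (T' : {set {set X}}),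
    [/\ injective e, forall x, [set x] \in T', forall t, (t \in T') = (vertices e t \in T)
      & forall s, s \in T -> exists2 t, t \in T' & s = vertices e t].
Proof.
move=> T_sub; pose A := (\bigcup_(s <- T) s)%fset.
pose T' := [set t : {set A} | vertices val t \in T].
exists A, val, T'; split.
- exact: val_inj.
- move=> x; rewrite inE; have /bigfcupP[s /andP[sT _] xs] := fsvalP x.
  apply: T_sub sT _; apply/fsubsetP => y /verticesP[z].
  by rewrite inE => /eqP -> ->.
- by move=> t; rewrite inE.
- move=> s sT; have sE : s = vertices val [set x : A | val x \in s].
    apply/fsetP => y; apply/idP/verticesP => [ys|[x]]; last by rewrite inE => ? ->.
    have yA : y \in A by apply/bigfcupP; exists s; rewrite ?sT.
    by exists [` yA]%fset; rewrite ?inE.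
  by exists [set x : A | val x \in s]; rewrite // inE -sE.
Qed.

(** * The triangulation of the domain and its image under the embedding *)

Section EmbeddedComplex.
Variables (R : realType) (V X : finType) (F : lmodType R).
Variables (M : {set {set V}}) (e : X -> {ffun V -> R^o}) (T : {set {set X}}).
Variable f : {ffun V -> R^o} -> F.
Implicit Types (t u : {set X}) (w : X -> R) (x : X) (v : V).

Hypothesis M_complex : is_complex M.
Hypothesis M_vertex : exists v, [set v] \in M.
Hypothesis e_inj : injective e.
Hypothesis T_vertex : forall x, [set x] \in T.
Hypothesis T_sub : forall t u, t \in T -> u \subset t -> u \in T.
Hypothesis T_indep : forall t, t \in T -> aff_indep (vertices e t).
Hypothesis T_meet : forall t u y, t \in T -> u \in T -> hull (vertices e t) y ->
  hull (vertices e u) y -> hull (vertices e (t :&: u)) y.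
Hypothesis T_union : forall y, realization M y <-> exists2 t, t \in T & hull (vertices e t) y.
Hypothesis f_affine : forall t, t \in T -> affine_on (hull (vertices e t)) f.
Hypothesis f_inj : forall y z, realization M y -> realization M z -> f y = f z -> y = z.

Definition coord x v : R := e x v.
Definition image x : F := f (e x).

Lemma sum_e w v : (\sum_x w x *: e x) v = \sum_x w x * coord x v.
Proof. by rewrite sum_ffunE; apply: eq_bigr => x _; rewrite ffunE. Qed.

Lemma e_real x : realization M (e x).
Proof.
apply/T_union; exists [set x]; rewrite ?T_vertex //; apply/(hull_vertices e_inj).
exists (fun z => (z == x)%:R); split=> [z|z||].
- by rewrite inE => /negPf ->.
- exact: ler0n.
- by rewrite (bigD1 x) //= eqxx big1 ?addr0 // => z /negPf ->.
- rewrite (bigD1 x) //= eqxx scale1r big1 ?addr0 // => z /negPf ->.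
  by rewrite scale0r.
Qed.

Lemma coord_ge0 x v : 0 <= coord x v.
Proof. by have [H _ _] := e_real x; apply: H. Qed.

Lemma coord_sum x : \sum_v coord x v = 1.
Proof. by have [_ H _] := e_real x. Qed.

Lemma sum_coord w : \sum_v \sum_x w x * coord x v = \sum_x w x.
Proof.
rewrite exchange_big; apply: eq_bigr => x _.
by rewrite -mulr_sumr coord_sum mulr1.
Qed.

Lemma hull_T t w : supported t w -> (forall x, 0 <= w x) -> \sum_x w x = 1 ->
  hull (vertices e t) (\sum_x w x *: e x).
Proof. by move=> sw w0 w1; apply/(hull_vertices e_inj); exists w. Qed.

Lemma simplex_real t w : t \in T -> supported t w -> (forall x, 0 <= w x) ->
  \sum_x w x = 1 -> realization M (\sum_x w x *: e x).
Proof. by move=> tT sw w0 w1; apply/T_union; exists t => //; apply: hull_T. Qed.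

Lemma affine_unique t w1 w2 : t \in T -> supported t w1 -> supported t w2 ->
  \sum_x w1 x = \sum_x w2 x -> \sum_x w1 x *: e x = \sum_x w2 x *: e x -> w1 =1 w2.
Proof.
move=> tT s1 s2 E1 E2 x; apply/eqP; rewrite -subr_eq0; apply/eqP.
have /(aff_indep_vertices e_inj) ind := T_indep tT.
apply: (ind (fun x => w1 x - w2 x)) => [y yt||]; first by rewrite s1 // s2 // subrr.
  by rewrite sumrB E1 subrr.
by under eq_bigr do rewrite scalerBl; rewrite sumrB E2 subrr.
Qed.

Lemma scale_weights (G : X -> F) (c : R) w :
  \sum_x (c * w x) *: G x = c *: \sum_x w x *: G x.
Proof. by rewrite scaler_sumr; apply: eq_bigr => x _; rewrite scalerA. Qed.

(** By [T_meet] the common point also has weights on the common face, and affine independence in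
    each simplex identifies [w1] and [w2] with them. *)
Lemma convex_unique t u w1 w2 : t \in T -> u \in T ->
  supported t w1 -> supported u w2 -> (forall x, 0 <= w1 x) -> (forall x, 0 <= w2 x) ->
  \sum_x w1 x = 1 -> \sum_x w2 x = 1 ->
  \sum_x w1 x *: e x = \sum_x w2 x *: e x -> w1 =1 w2.
Proof.
move=> tT uT s1 s2 p1 p2 n1 n2 E.
have [w3 [s3 p3 n3 E3]] : exists w, [/\ supported (t :&: u) w, forall x, 0 <= w x,
    \sum_x w x = 1 & \sum_x w1 x *: e x = \sum_x w x *: e x].
  apply/(hull_vertices e_inj); apply: T_meet => //; first exact: hull_T.
  by rewrite E; apply: hull_T.
have s3t : supported t w3 by move=> x xt; apply: s3; rewrite inE (negPf xt).
have s3u : supported u w3 by move=> x xu; apply: s3; rewrite inE (negPf xu) andbF.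
have E13 : w1 =1 w3 by apply: (affine_unique tT) => //; rewrite n1.
have E23 : w2 =1 w3 by apply: (affine_unique uT); rewrite ?n2 // -E.
by move=> x; rewrite E13 E23.
Qed.

Lemma total_eq0 w : (forall x, 0 <= w x) -> \sum_x w x = 0 -> forall x, w x = 0.
Proof.
move=> p /eqP; rewrite psumr_eq0 // => /allP H x.
by apply/eqP; apply: H; rewrite mem_index_enum.
Qed.

Lemma normalize w : (forall x, 0 <= w x) -> \sum_x w x != 0 ->
  [/\ 0 < \sum_x w x, forall x, 0 <= (\sum_x w x)^-1 * w x
    & \sum_z (\sum_x w x)^-1 * w z = 1].
Proof.
move=> p n; have c : 0 < \sum_x w x by rewrite lt_def n sumr_ge0.
split=> [//|x|]; first by rewrite mulr_ge0 // invr_ge0 ltW.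
by rewrite -mulr_sumr mulVf.
Qed.

(** The coordinates of each vertex sum to 1, so the two totals agree, and scaling them to 1 reduces
    the claim from cones to points of the polyhedron. *)
Lemma T_uniq t u w1 w2 : t \in T -> u \in T ->
  supported t w1 -> supported u w2 -> (forall x, 0 <= w1 x) -> (forall x, 0 <= w2 x) ->
  (forall v, \sum_x w1 x * coord x v = \sum_x w2 x * coord x v) -> w1 =1 w2.
Proof.
move=> tT uT s1 s2 p1 p2 E.
have n12 : \sum_x w1 x = \sum_x w2 x.
  by rewrite -!sum_coord; apply: eq_bigr => v _; rewrite E.
have [z|nz] := eqVneq (\sum_x w1 x) 0.
  by move=> x; rewrite !total_eq0 // -n12.
have [c q1 m1] := normalize p1 nz; have := normalize p2; rewrite -n12 => /(_ nz)[_ q2 m2].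
move=> x; apply: (mulfI (x := (\sum_x w1 x)^-1)); first by rewrite invr_eq0.
apply: (@convex_unique t u (fun x => _ * w1 x) (fun x => _ * w2 x)) => //.
- by move=> y yt; rewrite s1 ?mulr0.
- by move=> y yu; rewrite s2 ?mulr0.
apply/ffunP => v; rewrite !sum_e.
under eq_bigr do rewrite -mulrA; under [RHS]eq_bigr do rewrite -mulrA.
by rewrite -!mulr_sumr E.
Qed.

Lemma T_set0 : finset.set0 \in T.
Proof.
have [v vM] := M_vertex; have [_ M_sub] := M_complex.
have : realization M [ffun u => (u == v)%:R : R^o].
  split=> [u||]; first by rewrite ffunE ler0n.
    by rewrite (bigD1 v) //= ffunE eqxx big1 ?addr0 // => u /negPf uv; rewrite ffunE uv.
  apply: M_sub vM _; apply/fintype.subsetP => u; rewrite !inE ffunE.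
  by apply: contraNT => /negPf ->.
by case/T_union => t tT _; apply: T_sub tT (finset.sub0set _).
Qed.

Lemma T_cover (z : V -> R) : (forall v, 0 <= z v) -> [set v | z v != 0] \in M ->
  exists t w, [/\ t \in T, supported t w, forall x, 0 <= w x
    & forall v, z v = \sum_x w x * coord x v].
Proof.
move=> z0 zM; have [s0|nz] := eqVneq (\sum_v z v) 0.
  (* The zero vector is represented on the empty simplex. *)
  exists finset.set0, (fun=> 0); split=> // [|v]; first exact: T_set0.
  rewrite big1 => [|x _]; last by rewrite mul0r.
  move/eqP: s0; rewrite psumr_eq0 // => /allP/(_ v (mem_index_enum _)) /eqP; exact.
have c : 0 < \sum_v z v by rewrite lt_def nz sumr_ge0.
have : realization M [ffun v => (\sum_v z v)^-1 * z v : R^o].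
  split=> [v||].
  - by rewrite ffunE mulr_ge0 // invr_ge0 ltW.
  - by under eq_bigr do rewrite ffunE; rewrite -mulr_sumr mulVf.
  - rewrite (_ : [set v | _] = [set v | z v != 0]) //; apply/setP => v.
    by rewrite !inE ffunE mulf_eq0 invr_eq0 (negPf nz).
case/T_union => t tT /(hull_vertices e_inj)[w [sw w0 w1 E]].
exists t, (fun x => (\sum_v z v) * w x); split=> // [x xt|x|v].
- by rewrite sw ?mulr0.
- by rewrite mulr_ge0 // ltW.
under eq_bigr do rewrite -mulrA; rewrite -mulr_sumr -sum_e -E ffunE.
by rewrite mulVKf.
Qed.

Lemma image_sum t w : t \in T -> supported t w -> (forall x, 0 <= w x) -> \sum_x w x = 1 ->
  f (\sum_x w x *: e x) = \sum_x w x *: image x.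
Proof. by move=> tT; apply: (affine_sum e_inj); apply: f_affine. Qed.

Lemma image_unique t u w1 w2 : t \in T -> u \in T ->
  supported t w1 -> supported u w2 -> (forall x, 0 <= w1 x) -> (forall x, 0 <= w2 x) ->
  \sum_x w1 x = \sum_x w2 x ->
  \sum_x w1 x *: image x = \sum_x w2 x *: image x -> w1 =1 w2.
Proof.
move=> tT uT s1 s2 p1 p2 n12 E.
have [z|nz] := eqVneq (\sum_x w1 x) 0.
  by move=> x; rewrite !total_eq0 // -n12.
have [c q1 m1] := normalize p1 nz; have := normalize p2; rewrite -n12 => /(_ nz)[_ q2 m2].
have s1' : supported t (fun x => (\sum_x w1 x)^-1 * w1 x) by move=> y yt; rewrite s1 ?mulr0.
have s2' : supported u (fun x => (\sum_x w1 x)^-1 * w2 x) by move=> y yt; rewrite s2 ?mulr0.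
move=> x; apply: (mulfI (x := (\sum_x w1 x)^-1)); first by rewrite invr_eq0.
apply: (convex_unique tT uT s1' s2') => //.
apply: f_inj; [exact: simplex_real tT _ _ _|exact: simplex_real uT _ _ _|].
by rewrite (image_sum tT) // (image_sum uT) // !scale_weights E.
Qed.

Lemma image_indep t w : t \in T -> supported t w -> \sum_x w x = 0 ->
  \sum_x w x *: image x = 0 -> forall x, w x = 0.
Proof.
move=> tT sw w0 wf x.
have maxB y : Num.max (w y) 0 - Num.max (- w y) 0 = w y.
  by rewrite -{2}oppr0 -oppr_min opprK addr_max_min addr0.
have : (fun x => Num.max (w x) 0) =1 (fun x => Num.max (- w x) 0).
  apply: (image_unique tT tT).
  - by move=> y /sw ->; rewrite maxxx.
  - by move=> y /sw ->; rewrite oppr0 maxxx.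
  - by move=> y; rewrite le_max lexx orbT.
  - by move=> y; rewrite le_max lexx orbT.
  - apply/eqP; rewrite -subr_eq0 -sumrB; apply/eqP; rewrite -[RHS]w0.
    by apply: eq_bigr => y _; apply: maxB.
  - apply/eqP; rewrite -subr_eq0 -sumrB; apply/eqP; rewrite -[RHS]wf.
    by apply: eq_bigr => y _; rewrite -scalerBl maxB.
by move=> /(_ x) E; rewrite -(maxB x) E subrr.
Qed.

Lemma image_inj : injective image.
Proof. by move=> x y /f_inj E; apply: e_inj; apply: E; apply: e_real. Qed.

Lemma images_disjoint t u w1 w2 : t \in T -> u \in T ->
  [disjoint carrier coord t & carrier coord u] ->
  supported t w1 -> supported u w2 -> (forall x, 0 <= w1 x) -> (forall x, 0 <= w2 x) ->
  \sum_x w1 x = \sum_x w2 x -> \sum_x w1 x *: image x = \sum_x w2 x *: image x ->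
  forall x, w1 x = 0 /\ w2 x = 0.
Proof.
move=> tT uT tu s1 s2 p1 p2 n12 E x.
have E12 := image_unique tT uT s1 s2 p1 p2 n12 E.
suff w10 : w1 x = 0 by rewrite -E12 w10.
have [xt|/s1 //] := boolP (x \in t); have [xu|/s2 <- //] := boolP (x \in u).
have [v xv] : exists v, coord x v != 0.
  apply: contrapT => N; have /eqP := coord_sum x; rewrite big1 ?(eq_sym 0) ?oner_eq0 // => v _.
  by apply/eqP; apply: contraT => xv; case: N; exists v.
have vt : v \in carrier coord t by apply/bigcupP; exists x; rewrite ?inE.
have vu : v \in carrier coord u by apply/bigcupP; exists x; rewrite ?inE.
by rewrite (disjointFr tu vt) in vu.
Qed.

Definition part (L : {set {set V}}) : {set {set X}} := [set t in T | carrier coord t \in L].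

Definition image_complex (L : {set {set V}}) : {fset {fset F}} :=
  [fset vertices image t | t in part L]%fset.

Lemma image_complexP L s : reflect (exists2 t, t \in part L & s = vertices image t)
  (s \in image_complex L).
Proof. by apply: (iffP (imfsetP _ _ _ _)). Qed.

Lemma carrier_support t w : supported t w -> (forall x, 0 <= w x) ->
  [set v | (\sum_x w x *: e x) v != 0] = carrier coord [set x | w x != 0].
Proof.
move=> sw w0; apply/setP => v; rewrite inE sum_e; apply/idP/bigcupP => [H|[x]].
  apply: contrapT => N; move: H; rewrite big1 ?eqxx // => x _.
  have [->|wx] := eqVneq (w x) 0; first by rewrite mul0r.
  have [->|cx] := eqVneq (coord x v) 0; first by rewrite mulr0.
  by case: N; exists x; rewrite inE.
rewrite !inE => wx cx; rewrite psumr_neq0 => [|y _]; last by rewrite mulr_ge0 ?coord_ge0.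
apply/hasP; exists x; rewrite ?mem_index_enum //= lt_def mulf_neq0 //.
by rewrite mulr_ge0 ?coord_ge0.
Qed.

(** A point of [L] lies in the simplex of its nonzero weights; by [carrier_support] the carrier of
    that simplex is the support of the point, hence in [L]. *)
Lemma image_triangulation (L : {set {set V}}) : subcomplex L M ->
  triangulates (image_complex L) (f @` realization L)%classic.
Proof.
move=> [[L0 L_sub] LM].
have part_sub t u : t \in part L -> u \subset t -> u \in part L.
  rewrite !inE => /andP[tT tL] ut; rewrite (T_sub tT ut) /=.
  exact: L_sub tL (carrierS _ ut).
split; first split.
- move=> s /image_complexP[t]; rewrite inE => /andP[tT _] ->.
  apply/(aff_indep_vertices image_inj) => w sw w0 wf x; exact: image_indep tT sw w0 wf x.
- move=> s s' /image_complexP[t tL ->] /(sub_vertices image_inj)[u ut ->].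
  by apply/image_complexP; exists u => //; apply: part_sub tL ut.
- move=> s s' /image_complexP[t tL ->] /image_complexP[u uL ->] y.
  move=> [/(hull_vertices image_inj)[w1 [s1 p1 n1 E1]] /(hull_vertices image_inj)[w2 [s2 p2 n2 E2]]].
  rewrite (verticesI image_inj); apply/(hull_vertices image_inj); exists w1; split=> //.
  move: tL uL; rewrite !inE => /andP[tT _] /andP[uT _].
  have E : w1 =1 w2 by apply: (image_unique tT uT); rewrite ?n1 ?n2 // -E1.
  by move=> x; rewrite inE negb_and => /orP[/s1//|/s2]; rewrite E.
apply/seteqP; split=> [y [z zL <-]|y [s /image_complexP[t tL ->]]].
  have zM : realization M z.
    by case: zL => z0 z1 zs; split=> //; apply: (fintype.subsetP LM).
  have [t tT /(hull_vertices e_inj)[w [sw w0 w1 zE]]] := (T_union z).1 zM.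
  exists (vertices image [set x | w x != 0]).
    apply/image_complexP; exists [set x | w x != 0] => //; rewrite inE.
    rewrite -(carrier_support sw w0) -zE; case: zL => _ _ ->; rewrite andbT.
    apply: T_sub tT _; apply/fintype.subsetP => x; rewrite inE.
    by apply: contraNT => /sw ->.
  apply/(hull_vertices image_inj); exists w; split=> //.
    by move=> x; rewrite inE negbK => /eqP.
  by rewrite zE (image_sum tT).
move=> /(hull_vertices image_inj)[w [sw w0 w1 ->]].
move: tL; rewrite inE => /andP[tT tL].
exists (\sum_x w x *: e x); last by rewrite (image_sum tT).
have [r0 r1 _] := simplex_real tT sw w0 w1; split=> //.
rewrite (carrier_support sw w0); apply: L_sub tL _; apply: carrierS.
by apply/fintype.subsetP => x; rewrite inE; apply: contraNT => /sw ->.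
Qed.

End EmbeddedComplex.

Lemma sum_option (A : nmodType) (X : finType) (G : option X -> A) :
  \sum_y G y = G None + \sum_x G (Some x).
Proof.
rewrite (bigD1 None) //=; congr (_ + _).
rewrite (reindex_omap Some id) => [|[x|]] //=; apply: eq_bigl => x.
by rewrite eqxx.
Qed.

(** * Cones over a generic point *)

Section Homogeneous.
Variables (R : realType) (D : nat).

(** The leading 1 expresses that the weights of a dependence sum to zero; coordinates beyond [D] are
    filled with 0. *)
Definition homogeneous (Y : finType) (G : Y -> 'rV[R]_D) (y : Y) (i : nat) : R :=
  if i is j.+1 then (if insub j is Some k then G y 0 k else 0) else 1.

Lemma dependence_homogeneous (Y : finType) (G : Y -> 'rV[R]_D) w :
  dependence (homogeneous G) D.+1 w <-> \sum_y w y = 0 /\ \sum_y w y *: G y = 0.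
Proof.
split=> [d|[d0 d1] [|i]].
  split.
    by under eq_bigr do rewrite -[w _]mulr1; exact: (d 0%N isT).
  apply/rowP => k; rewrite summxE mxE.
  under eq_bigr => y _ do rewrite mxE -[G y 0 k]/(oapp (G y 0) 0 (Some k)) -(valK k).
  have := d k.+1; rewrite ltnS ltn_ord => /(_ isT); apply: etrans.
  by apply: eq_bigr => y _; rewrite /homogeneous; case: insubP.
  by move=> _; rewrite -[RHS]d0; apply: eq_bigr => y _; rewrite mulr1.
rewrite ltnS => iD; move/rowP: d1 => /(_ (Ordinal iD)); rewrite summxE mxE; apply: etrans.
by apply: eq_bigr => y _; rewrite mxE /= insubT.
Qed.

(* Each subset of at most [D] points lies in a hyperplane, and these finitely many
hyperplanes do not cover the moment curve. *)
Lemma exists_apex (X : finType) (G : X -> 'rV[R]_D) : exists p : 'rV[R]_D,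
  forall mu : X -> R, (#|[set x | mu x != 0%R]| <= D)%N -> \sum_x mu x = 1 ->
  \sum_x mu x *: G x != p.
Proof.
pose curve (d : R) : 'rV[R]_D := \row_i d ^+ i.+1.
pose h x (i : 'I_D.+1) := homogeneous G x i.
have ex (A : {set X}) : exists q : {poly R}, q != 0 /\ ((#|A| <= D)%N ->
    forall mu, supported A mu -> \sum_x mu x = 1 -> forall d, q.[d] != 0 ->
    \sum_x mu x *: G x != curve d).
  have [AD|_] := boolP (#|A| <= D)%N; last by exists 1; rewrite oner_neq0.
  have [|al [_ alA [i0 ali]]] := @exists_relation _ _ _ (fun i x => h x i) [set: 'I_D.+1] A.
    by rewrite cardsT card_ord ltnS.
  exists (\poly_(i < D.+1) al (inord i)); split.
    apply: contraNneq ali => /polyP/(_ i0); rewrite coef_poly ltn_ord coef0 inord_val.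
    by move=> ->.
  move=> _ mu smu mu1 d; rewrite horner_poly; apply: contraNneq => E.
  have : \sum_(i < D.+1) al i * \sum_x mu x * h x i = 0.
    under eq_bigr do rewrite mulr_sumr; rewrite exchange_big big1 //= => x _.
    have [xA|/smu ->] := boolP (x \in A); last first.
      by rewrite big1 // => i _; rewrite mul0r mulr0.
    by under eq_bigr do rewrite mulrCA; rewrite -mulr_sumr alA // mulr0.
  move=> H; apply/eqP; apply: etrans H; apply: eq_bigr => i _; rewrite inord_val; congr (_ * _).
  case: (unliftP ord0 i) => [j ->|->]; last first.
    by rewrite expr0 -mu1; apply: eq_bigr => x _; rewrite mulr1.
  rewrite lift0; move/rowP: E => /(_ j); rewrite summxE mxE => <-.
  apply: eq_bigr => x _; rewrite mxE /h /homogeneous lift0.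
  by rewrite -[in insub _](_ : val j = j) // valK.
have [q qP] := choice ex.
have [e e0 /(_ e e0 (lexx e)) qe] : eventually (fun d => forall A, (q A).[d] != 0).
  by apply: eventually_all => A; apply: poly_neq0_near0; have [] := qP A.
exists (curve e) => mu cmu mu1.
apply: ((qP [set x | mu x != 0]).2 cmu) => //.
by move=> x; rewrite inE negbK => /eqP.
Qed.

End Homogeneous.

Section Hulls.
Variables (R : realType) (D : nat) (Y : finType) (G : Y -> 'rV[R]_D).
Implicit Types (a b : {set Y}).
Hypothesis G_inj : injective G.

Lemma weak_of_hulls a b w1 w2 : [disjoint a & b] -> supported a w1 -> supported b w2 ->
  (forall y, 0 <= w1 y) -> (forall y, 0 <= w2 y) -> \sum_y w1 y = 1 -> \sum_y w2 y = 1 ->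
  \sum_y w1 y *: G y = \sum_y w2 y *: G y ->
  [/\ weakly_separating a b (fun y => w1 y - w2 y),
      dependence (homogeneous G) D.+1 (fun y => w1 y - w2 y)
    & exists y, w1 y - w2 y != 0].
Proof.
move=> ab s1 s2 p1 p2 n1 n2 E; split.
- split=> y.
  + by move=> ya; rewrite s2 ?subr0 ?(disjointFr ab ya).
  + by move=> yb; rewrite s1 ?sub0r ?oppr_le0 ?(disjointFl ab yb).
  + by rewrite inE negb_or => /andP[/s1 -> /s2 ->]; rewrite subrr.
- apply/dependence_homogeneous; split; first by rewrite sumrB n1 n2 subrr.
  by under eq_bigr do rewrite scalerBl; rewrite sumrB E subrr.
apply: contrapT => N; have /eqP := n1; rewrite big1 ?(eq_sym 0) ?oner_eq0 // => y _.
have [ya|/s1 //] := boolP (y \in a).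
have -> : w1 y = w1 y - w2 y by rewrite (s2 y) ?subr0 ?(disjointFr ab ya).
by apply/eqP; apply: contraT => wy; case: N; exists y.
Qed.

Lemma hulls_meet a b : [disjoint a & b] ->
  (exists w, [/\ weakly_separating a b w, dependence (homogeneous G) D.+1 w
               & exists y, w y != 0]) <->
  (exists y, hull (vertices G a) y /\ hull (vertices G b) y).
Proof.
move=> ab; split=> [[w [[wa wb sw] /dependence_homogeneous[w0 wG] [y wy]]]|]; last first.
  move=> [y [/(hull_vertices G_inj)[w1 [s1 p1 n1 E1]] /(hull_vertices G_inj)[w2 [s2 p2 n2 E2]]]].
  by exists (fun y => w1 y - w2 y); apply: weak_of_hulls => //; rewrite -E1.
pose w1 y := if y \in a then w y else 0; pose w2 y := if y \in b then - w y else 0.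
have wE z : w z = w1 z - w2 z.
  rewrite /w1 /w2; case: ifP => [/(disjointFr ab) ->|za]; first by rewrite subr0.
  case: ifP => [zb|zb]; first by rewrite opprK add0r.
  by rewrite subr0 sw // inE za zb.
have p1 z : 0 <= w1 z by rewrite /w1; case: ifP => // /wa.
have p2 z : 0 <= w2 z by rewrite /w2; case: ifP => // /wb; rewrite oppr_ge0.
have n12 : \sum_z w1 z = \sum_z w2 z.
  apply/eqP; rewrite -subr_eq0 -sumrB -[X in _ == X]w0; apply/eqP.
  by apply: eq_bigr => z _.
have nz : \sum_z w1 z != 0.
  apply: contraNneq wy => z; rewrite wE (total_eq0 p1 z) (total_eq0 p2) ?subrr //.
  by rewrite -n12.
have [c q1 m1] := normalize p1 nz; have := normalize p2; rewrite -n12 => /(_ nz)[_ q2 m2].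
exists (\sum_z ((\sum_y w1 y)^-1 * w1 z) *: G z); split; apply/(hull_vertices G_inj).
  exists (fun z => (\sum_y w1 y)^-1 * w1 z); split=> // z za.
  by rewrite /w1 (negPf za) mulr0.
exists (fun z => (\sum_y w1 y)^-1 * w2 z); split=> // [z zb|].
  by rewrite /w2 (negPf zb) mulr0.
rewrite !scale_weights; congr (_ *: _); apply/eqP; rewrite -subr_eq0 -sumrB -[X in _ == X]wG.
by apply/eqP; apply: eq_bigr => z _; rewrite -scalerBl -wE.
Qed.

End Hulls.

Section Apex.
Variables (R : realType) (D : nat) (V X : finType) (pos : X -> V -> R).
Variables (T : {set {set X}}) (M : {set {set V}}) (G : X -> 'rV[R]_D) (p : 'rV[R]_D).
Implicit Types (t u : {set X}) (a b r : {set option X}) (s : {set V}).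

Hypothesis T_sub : forall t u, t \in T -> u \subset t -> u \in T.
Hypothesis T_uniq : forall t u w1 w2, t \in T -> u \in T ->
  supported t w1 -> supported u w2 -> (forall x, 0 <= w1 x) -> (forall x, 0 <= w2 x) ->
  (forall v, \sum_x w1 x * pos x v = \sum_x w2 x * pos x v) -> w1 =1 w2.
Hypothesis G_inj : injective G.
Hypothesis G_indep : forall t w, t \in T -> supported t w -> \sum_x w x = 0 ->
  \sum_x w x *: G x = 0 -> forall x, w x = 0.
Hypothesis G_disjoint : forall t u w1 w2, t \in T -> u \in T ->
  [disjoint carrier pos t & carrier pos u] ->
  supported t w1 -> supported u w2 -> (forall x, 0 <= w1 x) -> (forall x, 0 <= w2 x) ->
  \sum_x w1 x = \sum_x w2 x -> \sum_x w1 x *: G x = \sum_x w2 x *: G x ->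
  forall x, w1 x = 0 /\ w2 x = 0.
Hypothesis D_gt0 : (0 < D)%N.
Hypothesis apex : forall mu : X -> R, (#|[set x | mu x != 0%R]| <= D)%N ->
  \sum_x mu x = 1 -> \sum_x mu x *: G x != p.

Definition coned (y : option X) : 'rV[R]_D := if y is Some x then G x else p.

(** The condition on [p] for a single point, available because [0 < D], separates the apex from
    every vertex. *)
Lemma coned_inj : injective coned.
Proof.
have pG x : G x <> p.
  move=> E; have := apex (mu := fun z => (z == x)%:R).
  rewrite (bigD1 x) //= eqxx big1 ?addr0 => [|z /negPf -> //].
  rewrite (bigD1 x) //= eqxx big1 ?addr0 => [|z /negPf -> //]; last by rewrite scale0r.
  rewrite scale1r E eqxx => /(_ _ erefl) H; suff : false by [].
  apply: H; rewrite (_ : [set z | _] = [set x]) ?cards1 //.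
  by apply/setP => z; rewrite !inE pnatr_eq0 eqb0 negbK.
by move=> [x|] [y|] //= E; [rewrite (G_inj E)|case: (pG x)|case: (pG y)].
Qed.

(** Solving the relation for [p] makes it an affine combination of the other points of the
    support. *)
Lemma apex_weight (w : option X -> R) : w None != 0 -> \sum_y w y = 0 ->
  \sum_y w y *: coned y = 0 -> (D < #|[set x | w (Some x) != 0%R]|)%N.
Proof.
move=> wN; rewrite !sum_option /= => w0 wG; rewrite ltnNge; apply/negP => c.
have := apex (mu := fun x => (- (w None)^-1) * w (Some x)).
rewrite (_ : [set x | _] = [set x | w (Some x) != 0]); last first.
  by apply/setP => x; rewrite !inE mulf_eq0 oppr_eq0 invr_eq0 (negPf wN).
rewrite -mulr_sumr (_ : \sum_x _ = - w None); last first.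
  by apply/eqP; rewrite -addr_eq0 addrC w0.
rewrite mulrNN mulVf // => /(_ c erefl)/eqP; apply.
under eq_bigr do rewrite -scalerA; rewrite -scaler_sumr (_ : \sum_x _ = - (w None *: p)).
  by rewrite scalerN scaleNr opprK scalerA mulVf // scale1r.
by apply/eqP; rewrite -addr_eq0 addrC wG.
Qed.

Lemma sub_support (w : option X -> R) a : supported a w ->
  [set x | w (Some x) != 0] \subset base a.
Proof.
move=> sw; apply/fintype.subsetP => x; rewrite !inE; apply: contraNT => /sw ->.
by rewrite eqxx.
Qed.

Lemma coned_indep a w : base a \in T -> (#|base a| <= D)%N -> supported a w ->
  \sum_y w y = 0 -> \sum_y w y *: coned y = 0 -> forall y, w y = 0.
Proof.
move=> aT ca sw w0 wG.
have [wN|wN] := eqVneq (w None) 0; last first.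
  have := apex_weight wN w0 wG.
  by rewrite ltnNge (leq_trans (subset_leq_card (sub_support sw))).
move: w0 wG; rewrite !sum_option /= wN scale0r !add0r => w0 wG [x|//].
apply: (G_indep aT _ w0 wG) => z za; apply: sw; move: za; by rewrite inE.
Qed.

(** The positive and negative parts would give a common point of the images of two simplices with
    disjoint carriers. *)
Lemma no_dependence a b w : None \notin a -> None \notin b -> base a \in T -> base b \in T ->
  [disjoint carrier pos (base a) & carrier pos (base b)] ->
  weakly_separating a b w -> dependence (homogeneous coned) D.+1 w -> forall y, w y = 0.
Proof.
move=> aN bN aT bT ab [wa wb sw] /dependence_homogeneous[].
have wN : w None = 0 by apply: sw; rewrite inE negb_or aN.
rewrite !sum_option /= wN scale0r !add0r => w0 wG.
pose w1 x := if x \in base a then Num.max (w (Some x)) 0 else 0.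
pose w2 x := if x \in base b then Num.max (- w (Some x)) 0 else 0.
have wE x : w (Some x) = w1 x - w2 x.
  rewrite /w1 /w2; have := wa (Some x); have := wb (Some x); have := sw (Some x).
  rewrite !inE; case: (Some x \in a); case: (Some x \in b) => /= s0 b0 a0.
  - have -> : w (Some x) = 0 by apply/eqP; rewrite eq_le a0 // b0.
    by rewrite oppr0 subrr.
  - by rewrite max_l ?subr0 // a0.
  - by rewrite max_l ?opprK ?add0r // oppr_ge0 b0.
  - by rewrite s0 // subr0.
suff H x : w1 x = 0 /\ w2 x = 0.
  by move=> [x|//]; rewrite wE; have [-> ->] := H x; rewrite subrr.
apply: (G_disjoint aT bT ab).
- by move=> z /negPf zt; rewrite /w1 zt.
- by move=> z /negPf zt; rewrite /w2 zt.
- by move=> z; rewrite /w1; case: ifP => // _; rewrite le_max lexx orbT.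
- by move=> z; rewrite /w2; case: ifP => // _; rewrite le_max lexx orbT.
- apply/eqP; rewrite -subr_eq0 -sumrB -[X in _ == X]w0; apply/eqP.
  by apply: eq_bigr => z _; rewrite wE.
- apply/eqP; rewrite -subr_eq0 -sumrB -[X in _ == X]wG; apply/eqP.
  by apply: eq_bigr => z _; rewrite wE scalerBl.
Qed.

(** By [no_dependence] the apex has nonzero weight, so more than [D] other vertices do as well. At
    most [D.+1] are available, hence no weight is zero. *)
Lemma dependence_strict a b w : None \notin b -> base a \in T -> base b \in T ->
  [disjoint a & b] -> [disjoint carrier pos (base a) & carrier pos (base b)] ->
  (#|base a| + #|base b| <= D.+1)%N ->
  weakly_separating a b w -> dependence (homogeneous coned) D.+1 w -> (exists y, w y != 0) ->
  separating a b w.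
Proof.
move=> bN aT bT ab cab card_ab ww dw [y wy]; have [wa wb sw] := ww.
have [w0 wG] := (dependence_homogeneous _ _).1 dw.
have wN : w None != 0.
  apply: contra_neq wy => wN.
  have aE : base (a :\ None) = base a by apply/setP => x; rewrite !inE.
  apply: (@no_dependence (a :\ None) b) => //; rewrite ?aE ?setD11 //.
  split=> // [z|z]; first by rewrite inE => /andP[_ /wa].
  have [->//|zN] := eqVneq z None.
  by rewrite !inE zN /= => H; apply: sw; rewrite inE.
have big := apex_weight wN w0 wG.
have all x : x \in base a :|: base b -> w (Some x) != 0.
  move=> xab; apply: contraTneq big => wx; rewrite -leqNgt.
  have : [set z | w (Some z) != 0] \subset (base a :|: base b) :\ x.
    apply/fintype.subsetP => z; rewrite !inE => wz.
    have [zx|_ /=] := eqVneq z x; first by rewrite zx wx eqxx in wz.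
    by apply: contraNT wz => zab; rewrite sw // inE.
  move/subset_leq_card/leq_trans; apply.
  have := leq_trans (leq_card_setU (base a) (base b)) card_ab.
  by rewrite (cardsD1 x) xab.
have aN : None \in a by apply: contraNT wN => aN; rewrite sw // inE negb_or aN.
split=> // [[x|] xin|[x|] xin].
- by rewrite lt_def wa // all // !inE xin.
- by rewrite lt_def wa // wN.
- by rewrite lt_neqAle wb // all // !inE xin orbT.
- by rewrite xin in bN.
Qed.

Lemma vertices_coned r : None \notin r -> vertices coned r = vertices G (base r).
Proof.
move=> rN; apply/fsetP => y; apply/verticesP/verticesP.
  by move=> [[x|] xr ->]; [exists x; rewrite ?inE|rewrite xr in rN].
by move=> [x]; rewrite inE => xr ->; exists (Some x).
Qed.

(** Turns parities of cofaces over [option X] into a boundary of point sets. Faces through the apex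
    have an even number of cofaces and are absent from [Z]. *)
Lemma cone_boundary (Z : {fset {fset 'rV[R]_D}}) s k : #|s| = k.+2 -> s \notin M ->
  (forall v, v \in s -> s :\ v \in M) ->
  (forall r, odd #|[set y | (y \notin r) && (y |: r \in cone_chain pos T M s)]| =
             odd #|[set v in s | r \in cone_chain pos T M (s :\ v)]|) ->
  (forall z, z \in Z <-> exists2 t, t \in rim pos T s & z = vertices G t) ->
  is_boundary k [fset vertices coned a | a in cone_chain pos T M s]%fset Z.
Proof.
move=> cs sM sD bd ZP z; set C := [fset vertices coned a | a in cone_chain pos T M s]%fset.
have CP y : reflect (exists2 a, a \in cone_chain pos T M s & y = vertices coned a) (y \in C).
  by apply: (iffP (imfsetP _ _ _ _)) => -[a aC ->]; exists a.
(* A point set that is not spanned by indexed vertices is neither a face of the chain nor in [Z]. *)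
have [[r zE]|N] := asboolP (exists r, z = vertices coned r); last first.
  rewrite (_ : [fset t in C | (z `<=` t)%fset]%fset = fset0) ?cardfs0 /= ?andbF.
    apply/negP => /ZP[t]; rewrite !inE => /and3P[_ /eqP ct _] zE; apply: N.
    exists [set Some x | x in t]; rewrite vertices_coned; last by apply/imsetP => -[].
    rewrite zE; congr vertices; apply/setP => x; by rewrite inE (mem_imset _ _ (@Some_inj _)).
  apply/fsetP => y; rewrite !inE /=; apply/negP => /andP[/CP[a _ ->]].
  by move=> /(sub_vertices coned_inj)[r _ zE]; apply: N; exists r.
rewrite zE (card_vertices coned_inj).
have -> : (vertices coned r \in Z) = (None \notin r) && (base r \in rim pos T s).
  apply/idP/andP => [/ZP[t tr E]|[rN rr]]; last by apply/ZP; exists (base r); rewrite ?vertices_coned.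
  have rN : None \notin r.
    apply/negP => Nr; have : coned None \in vertices coned r by rewrite (mem_vertices coned_inj).
    by rewrite E => /verticesP[x _] /(@coned_inj None (Some x)).
  split=> //; move: E; rewrite vertices_coned // => /(vertices_inj G_inj) ->.
  exact: tr.
have [cr|cr] := eqVneq #|r| k.+1; last first.
  apply/negP => /andP[rN]; rewrite inE => /and3P[_ /eqP c _]; case/eqP: cr.
  by apply/eqP; rewrite -eqSS -cs -c (card_base r) (negPf rN).
have -> : #|` [fset t in C | (vertices coned r `<=` t)%fset]%fset| =
    #|[set y | (y \notin r) && (y |: r \in cone_chain pos T M s)]|.
  have -> : [fset t in C | (vertices coned r `<=` t)%fset]%fset =
      [fset vertices coned (y |: r) | y in
        [set y | (y \notin r) && (y |: r \in cone_chain pos T M s)]]%fset.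
    apply/fsetP => t; rewrite !inE /=; apply/andP/imfsetP => [[/CP[a aC ->]]|[y /= + ->]].
      rewrite (verticesS coned_inj) => ra.
      have : #|a :\: r| == 1%N by rewrite cardsD (finset.setIidPr ra) (cone_chain_card aC) cs cr subSnn.
      case/cards1P => y ay.
      have ayr : y |: r = a.
        rewrite -ay; apply/setP => z'; rewrite !inE.
        by have [/(fintype.subsetP ra) ->|] := boolP (z' \in r); rewrite ?orbT ?orbF.
      exists y; rewrite ?ayr //= inE ayr aC andbT.
      by have := set11 y; rewrite -ay inE => /andP[].
    rewrite inE => /andP[yr yC]; split; first by apply/CP; exists (y |: r).
    by rewrite (verticesS coned_inj) finset.subsetUr.
  rewrite card_in_imfset /= ?cardE // => y z' /=; rewrite !inE => /andP[yr _] /andP[zr _].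
  move=> /(vertices_inj coned_inj) E; have : y \in z' |: r by rewrite -E setU11.
  by rewrite in_setU1 (negPf yr) orbF => /eqP.
rewrite bd -(odd_facets T_uniq); have [rN|rN] := boolP (None \in r) => /=.
  rewrite (_ : [set v in s | _] = finset.set0) ?cards0 //.
  apply/setP => v; rewrite !inE; have [vs|//] := boolP (v \in s).
  by rewrite /= sD // rN.
congr odd; apply: eq_card => v; rewrite !inE; have [vs|//] := boolP (v \in s).
by rewrite /= sD // rN.
Qed.

End Apex.

(** * Spheres *)

Section StandardTriangulation.
Variables (R : realType) (V : finType).
Implicit Types (K : {set {set V}}) (s t : {set V}) (v : V) (x y : {ffun V -> R^o}).

Definition point_mass v : {ffun V -> R^o} := [ffun u => (u == v)%:R : R^o].

Lemma point_mass_inj : injective point_mass.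
Proof.
move=> u v /ffunP/(_ u); rewrite !ffunE eqxx; case: eqP => // _ /eqP.
by rewrite oner_eq0.
Qed.

Lemma sum_point_mass (w : V -> R) : \sum_v w v *: point_mass v = [ffun v => w v : R^o].
Proof.
apply/ffunP => v; rewrite sum_ffunE (bigD1 v) //= !ffunE eqxx big1 => [|u uv].
  by rewrite addr0 /GRing.scale /= mulr1.
by rewrite !ffunE eq_sym (negPf uv) scaler0.
Qed.

Lemma hull_point_mass s x : hull (vertices point_mass s) x <->
  [/\ supported s x, forall v, 0 <= x v & \sum_v x v = 1].
Proof.
split=> [/(hull_vertices point_mass_inj)[w [sw w0 w1 ->]]|[sx x0 x1]].
  rewrite sum_point_mass; split=> [v vs|v|]; rewrite ?ffunE //; first exact: sw.
  by rewrite -[RHS]w1; apply: eq_bigr => v _; rewrite ffunE.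
apply/(hull_vertices point_mass_inj); exists x; split=> //.
by rewrite sum_point_mass; apply/ffunP => v; rewrite ffunE.
Qed.

Lemma standard_triangulation K : is_complex K ->
  triangulates [fset vertices point_mass s | s in K]%fset (realization K).
Proof.
move=> [K0 K_sub].
have TP z : reflect (exists2 s, s \in K & z = vertices point_mass s)
    (z \in [fset vertices point_mass s | s in K]%fset).
  by apply: (iffP (imfsetP _ _ _ _)) => -[s sK ->]; exists s.
split; first split.
- move=> z /TP[s sK ->]; apply/(aff_indep_vertices point_mass_inj) => w _ _.
  by rewrite sum_point_mass => /ffunP H v; have := H v; rewrite !ffunE.
- move=> z z' /TP[s sK ->] /(sub_vertices point_mass_inj)[u us ->].
  by apply/TP; exists u => //; apply: K_sub sK us.
- move=> z z' /TP[s sK ->] /TP[t tK ->] x [/hull_point_mass[s1 x0 x1] /hull_point_mass[s2 _ _]].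
  rewrite (verticesI point_mass_inj); apply/hull_point_mass; split=> // v.
  by rewrite inE negb_and => /orP[/s1|/s2].
apply/seteqP; split=> [x [x0 x1 xK]|x [z /TP[s sK ->] /hull_point_mass[sx x0 x1]]].
  exists (vertices point_mass [set v | x v != 0]); first by apply/TP; exists [set v | x v != 0].
  by apply/hull_point_mass; split=> // v; rewrite inE negbK => /eqP.
split=> //; apply: K_sub sK _; apply/fintype.subsetP => v; rewrite inE.
by apply: contraNT => /sx ->.
Qed.

Lemma PL_of_affine (E : lmodType R) K (g : {ffun V -> R^o} -> E) : is_complex K ->
  (forall (c : R) x y, g (c *: x + (1 - c) *: y) = c *: g x + (1 - c) *: g y) ->
  PL_map (realization K) g.
Proof.
move=> Kc lin; exists [fset vertices point_mass s | s in K]%fset.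
by split; [exact: standard_triangulation|move=> s _ c x y _ _ _; exact: lin].
Qed.

End StandardTriangulation.

Section Spheres.
Variables (R : realType) (V : finType).
Implicit Types (s t : {set V}) (v : V) (x : {ffun V -> R^o}).

Lemma sphereP (p : nat) (y : {ffun 'I_p.+2 -> R^o}) : sphere R p y <->
  [/\ forall i, 0 <= y i, \sum_i y i = 1 & exists i, y i = 0].
Proof.
split=> [[y0 y1 ys]|[y0 y1 [i yi]]]; split=> //.
  apply: contrapT => N; move: ys; rewrite !inE /= (_ : [set v | _] = [set: 'I_p.+2]).
    by rewrite cardsT card_ord ltnn.
  apply/setP => i; rewrite !inE; apply/negP => /eqP yi; apply: N; by exists i.
rewrite !inE /= -ltnS -[X in (_ < X)%N]card_ord -cardsT; apply: proper_card.
apply/properP; split; first exact: finset.subsetT.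
by exists i; rewrite ?inE // yi eqxx.
Qed.

Lemma exists_enumeration s (k : nat) : #|s| = k ->
  exists2 phi : 'I_k -> V, injective phi & forall v, v \in s -> exists i, v = phi i.
Proof.
move=> <-; exists enum_val; first exact: enum_val_inj.
by move=> v vs; exists (enum_rank_in vs v); rewrite enum_rankK_in.
Qed.

End Spheres.

Section SphereModels.
Variables (R : realType) (V : finType).
Implicit Types (s t : {set V}) (v : V) (x : {ffun V -> R^o}).

Definition simplex_boundary s : {set {set V}} := [set t : {set V} | t \proper s].

(* The join of the two points [a], [b] with the boundary of the simplex [s]. *)
Definition suspension (a b : V) s : {set {set V}} :=
  [set t : {set V} | [&& t \subset a |: (b |: s), ~~ ([set a; b] \subset t) & ~~ (s \subset t)]].

Lemma simplex_boundary_complex s : s != finset.set0 -> is_complex (simplex_boundary s).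
Proof.
move=> s0; split=> [|t u]; first by rewrite inE finset.proper0.
by rewrite !inE => ts ut; apply: sub_proper_trans ut ts.
Qed.

Lemma suspension_complex a b s : s != finset.set0 -> is_complex (suspension a b s).
Proof.
move=> s0; split=> [|t u].
  rewrite inE finset.sub0set !finset.subset0 s0 andbT /=.
  by apply/set0Pn; exists a; rewrite set21.
rewrite !inE => /and3P[ts abt st] ut; apply/and3P; split.
- exact: fintype.subset_trans ut ts.
- by apply: contra abt => /fintype.subset_trans; apply.
- by apply: contra st => /fintype.subset_trans; apply.
Qed.

Lemma sum_enumeration (k : nat) (phi : 'I_k -> V) s (F : V -> R) : injective phi ->
  (forall v, v \in s <-> exists i, v = phi i) -> (forall v, v \notin s -> F v = 0) ->
  \sum_v F v = \sum_i F (phi i).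
Proof.
move=> phi_inj sP F0; rewrite (bigID (mem s)) /= [X in _ + X]big1 ?addr0; last by move=> v /F0.
have -> : s = [set phi i | i in 'I_k].
  apply/setP => v; apply/idP/imsetP => [/sP[i ->]|[i _ ->]]; first by exists i.
  by apply/sP; exists i.
by rewrite big_imset //= => i j _ _; apply: phi_inj.
Qed.

Lemma simplex_boundary_sphere s (p : nat) : #|s| = p.+2 ->
  PL_homeomorphic (realization (simplex_boundary s)) (sphere R p).
Proof.
move=> cs; have [phi phi_inj sP'] := exists_enumeration cs.
have phi_s i : phi i \in s.
  have : [set phi i | i in 'I_p.+2] = s.
    apply/esym/eqP; rewrite eqEcard card_imset // card_ord cs leqnn andbT.
    by apply/fintype.subsetP => v /sP'[j ->]; apply: imset_f.
  by move=> <-; apply: imset_f.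
have sP v : v \in s <-> exists i, v = phi i by split=> [/sP'|[i ->]].
exists (fun x => [ffun i => x (phi i)]).
  apply: PL_of_affine; first by apply: simplex_boundary_complex; rewrite -cards_eq0 cs.
  by move=> c x y; apply/ffunP => i; rewrite !ffunE.
have supp x : realization (simplex_boundary s) x -> forall v, v \notin s -> x v = 0.
  move=> [_ _]; rewrite inE => /proper_sub/fintype.subsetP xs v vs; apply/eqP.
  by apply: contraNT vs => xv; apply: xs; rewrite inE.
split.
- move=> x xK; have sx := supp x xK; have [x0 x1] := xK; rewrite inE => /properP[_ [v vs]].
  rewrite inE negbK => /eqP xv; apply/sphereP; split=> [i||].
  + by rewrite ffunE.
  + by rewrite -[RHS]x1 (sum_enumeration phi_inj sP sx); apply: eq_bigr => i _; rewrite ffunE.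
  + by have [i vi] := sP' v vs; exists i; rewrite ffunE -vi.
- move=> x y; rewrite !inE => xK yK /ffunP E; apply/ffunP => v.
  have [/sP'[i ->]|vs] := boolP (v \in s); first by have := E i; rewrite !ffunE.
  by rewrite (supp x xK) ?(supp y yK).
- move=> y /sphereP[y0 y1 [i0 yi0]].
  pose x : {ffun V -> R^o} := [ffun v => \sum_i if phi i == v then y i else 0].
  have xE i : x (phi i) = y i.
    rewrite ffunE (bigD1 i) //= eqxx big1 ?addr0 // => j ji.
    by rewrite (inj_eq phi_inj) (negPf ji).
  have sx v : v \notin s -> x v = 0.
    move=> vs; rewrite ffunE big1 // => i _; case: eqP => // e.
    by rewrite -e phi_s in vs.
  exists x; last by apply/ffunP => i; rewrite ffunE xE.
  split=> [v||].
  + by have [/sP'[i ->]|/sx ->//] := boolP (v \in s); rewrite xE.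
  + by rewrite (sum_enumeration phi_inj sP sx) -[RHS]y1; apply: eq_bigr => i _.
  + rewrite inE; apply/properP; split.
      by apply/fintype.subsetP => v; rewrite inE; apply: contraNT => /sx ->.
    by exists (phi i0); rewrite ?phi_s // inE xE yi0 eqxx.
Qed.

(* [a] goes to the last vertex of the simplex and [b] to the barycentre of the
opposite face. *)
Lemma suspension_sphere a b s (n : nat) : #|s| = n.+1 -> a \notin s -> b \notin s -> a != b ->
  PL_homeomorphic (realization (suspension a b s)) (sphere R n).
Proof.
move=> cs as_ bs ab; have [phi phi_inj sP'] := exists_enumeration cs.
have phi_s i : phi i \in s.
  have : [set phi i | i in 'I_n.+1] = s.
    apply/esym/eqP; rewrite eqEcard card_imset // card_ord cs leqnn andbT.
    by apply/fintype.subsetP => v /sP'[j ->]; apply: imset_f.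
  by move=> <-; apply: imset_f.
have sP v : v \in s <-> exists i, v = phi i by split=> [/sP'|[i ->]].
have phi_a i : (phi i == a) = false by apply: contraNF as_ => /eqP <-.
have phi_b i : (phi i == b) = false by apply: contraNF bs => /eqP <-.
pose g x : {ffun 'I_n.+2 -> R^o} :=
  [ffun i : 'I_n.+2 => if insub (i : nat) is Some j then x (phi j) + x b / n.+1%:R else x a].
have gphi x (j : 'I_n.+1) : g x (widen_ord (leqnSn n.+1) j) = x (phi j) + x b / n.+1%:R.
  by rewrite ffunE /= valK.
have ga x : g x ord_max = x a by rewrite ffunE insubF //= ltnn.
have n0 : n.+1%:R != 0 :> R by rewrite pnatr_eq0.
have n0p : 0 < n.+1%:R :> R by rewrite ltr0n.
have ordP (P : 'I_n.+2 -> Prop) : (forall j, P (widen_ord (leqnSn n.+1) j)) -> P ord_max ->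
    forall i, P i.
  move=> H1 H2 i; have [lt|ge] := ltnP i n.+1.
    by rewrite (_ : i = widen_ord (leqnSn n.+1) (Ordinal lt)) //; apply: val_inj.
  rewrite (_ : i = ord_max) //; apply: val_inj => /=; have := ltn_ord i; lia.
have sum_x x : (forall v, v \notin a |: (b |: s) -> x v = 0) ->
    \sum_v x v = x a + x b + \sum_j x (phi j).
  move=> sx; rewrite (bigD1 a) //= (bigD1 b) /= 1?eq_sym // addrA; congr (_ + _).
  have <- : \sum_v (if (v != a) && (v != b) then x v else 0) = \sum_j x (phi j).
    rewrite (sum_enumeration phi_inj sP) => [|v vs].
      by apply: eq_bigr => j _; rewrite phi_a phi_b.
    by case: ifP => // /andP[va vb]; apply: sx; rewrite !inE !negb_or va vb.
  by rewrite big_mkcond.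
have sum_g x : \sum_i g x i = x a + x b + \sum_j x (phi j).
  rewrite big_ord_recr /= ga; under eq_bigr do rewrite gphi.
  rewrite big_split /= sumr_const card_ord -[X in _ + X + _]mulr_natr divfK //.
  by rewrite addrC [\sum_j _ + _]addrC addrA.
have KP x : realization (suspension a b s) x <->
    [/\ forall v, 0 <= x v, \sum_v x v = 1, forall v, v \notin a |: (b |: s) -> x v = 0,
        x a = 0 \/ x b = 0 & exists j, x (phi j) = 0].
  split=> [[x0 x1]|[x0 x1 sx xab [j xj]]].
    rewrite inE => /and3P[xs xab /subsetPn[v vs xv]]; split=> //.
    - move=> v' vs'; apply/eqP; apply: contraNT vs' => xv'.
      by apply: (fintype.subsetP xs); rewrite inE.
    - case/subsetPn: xab => u; rewrite !inE negbK => /orP[] /eqP -> /eqP; by [left|right].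
    - by have [j vj] := sP' v vs; exists j; apply/eqP; move: xv; rewrite inE negbK vj.
  split=> //; rewrite inE; apply/and3P; split.
  - by apply/fintype.subsetP => v; rewrite inE; apply: contraNT => /sx ->.
  - apply/subsetPn; case: xab => e; [exists a|exists b]; by rewrite !inE ?e ?eqxx ?orbT.
  - by apply/subsetPn; exists (phi j); rewrite // inE xj eqxx.
exists g.
  apply: PL_of_affine; first by apply: suspension_complex; rewrite -cards_eq0 cs.
  move=> c x y; apply/ffunP; apply: ordP => [j|].
    rewrite gphi !ffunE /= !valK /GRing.scale /=; ring.
  by rewrite ga !ffunE /= !insubF //= ltnn.
split.
- move=> x /KP[x0 x1 sx xab [j xj]]; apply/sphereP; split.
  + by apply: ordP => [i|]; rewrite ?gphi ?ga ?addr_ge0 ?divr_ge0 ?ler0n.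
  + by rewrite sum_g -sum_x.
  + case: xab => e; first by exists ord_max; rewrite ga.
    by exists (widen_ord (leqnSn n.+1) j); rewrite gphi xj e mul0r addr0.
- move=> x y; rewrite !inE => /KP[x0 _ sx xab [i xi]] /KP[y0 _ sy yab [j yj]] E.
  have Ea : x a = y a by rewrite -!ga E.
  have Ephi k : x (phi k) + x b / n.+1%:R = y (phi k) + y b / n.+1%:R by rewrite -!gphi E.
  (* Some coordinate [phi j] of each point vanishes, so its share from [b] is the least of the first
     [n.+1] coordinates of the image. *)
  have Eb : x b = y b.
    have le1 : x b / n.+1%:R <= y b / n.+1%:R.
      by have := Ephi j; rewrite yj add0r => <-; rewrite lerDr.
    have le2 : y b / n.+1%:R <= x b / n.+1%:R.
      by have := Ephi i; rewrite xi add0r => ->; rewrite lerDr.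
    have /eqP : x b / n.+1%:R = y b / n.+1%:R by apply/eqP; rewrite eq_le le1.
    by rewrite (inj_eq (mulIf _)) ?invr_eq0 // => /eqP.
  apply/ffunP => v; have [|vs] := boolP (v \in a |: (b |: s)); last by rewrite sx // sy.
  rewrite !in_setU1 => /or3P[/eqP ->|/eqP ->|/sP'[k ->]] //.
  by have := Ephi k; rewrite Eb => /addIr.
- move=> y /sphereP[y0 y1 yz].
  pose y' (j : 'I_n.+1) := y (widen_ord (leqnSn n.+1) j).
  (* For the inverse, the least of the first [n.+1] coordinates is the share attributed to [b]. *)
  case: (arg_minP (P := xpredT) y' (i0 := ord0)) => // i _ imin.
  pose x : {ffun V -> R^o} := [ffun v => if v == a then y ord_max else
     if v == b then n.+1%:R * y' i else \sum_j if phi j == v then y' j - y' i else 0].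
  have xa : x a = y ord_max by rewrite ffunE eqxx.
  have xb : x b = n.+1%:R * y' i by rewrite ffunE eq_sym (negPf ab) eqxx.
  have xphi j : x (phi j) = y' j - y' i.
    rewrite ffunE phi_a phi_b (bigD1 j) //= eqxx big1 ?addr0 // => k kj.
    by rewrite (inj_eq phi_inj) (negPf kj).
  have sx v : v \notin a |: (b |: s) -> x v = 0.
    rewrite !inE !negb_or => /and3P[va vb vs]; rewrite ffunE (negPf va) (negPf vb).
    rewrite big1 // => j _; case: eqP => // e; by rewrite -e phi_s in vs.
  have gx : g x = y.
    apply/ffunP; apply: ordP => [j|]; last by rewrite ga xa.
    by rewrite gphi xphi xb mulrAC divff // mul1r subrK.
  exists x => //; apply/KP; split=> //.
  + move=> v; have [|/sx -> //] := boolP (v \in a |: (b |: s)).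
    rewrite !in_setU1 => /or3P[/eqP ->|/eqP ->|/sP'[k ->]].
    * by rewrite xa.
    * by rewrite xb mulr_ge0 // ?ler0n // /y'.
    * by rewrite xphi subr_ge0; apply: imin.
  + by rewrite sum_x // -sum_g gx.
  + have [k yk] := yz; move: k yk; apply: ordP => [k yk|ymax]; last by left; rewrite xa.
    right; rewrite xb (_ : y' i = 0) ?mulr0 //; apply/eqP; rewrite eq_le y0 andbT.
    by rewrite -yk; apply: (imin k).
  + by exists i; rewrite xphi subrr.
Qed.

End SphereModels.

(** * The complex M^(n) *)

Section MComplex.
Variable n : nat.
Hypothesis n_gt0 : (0 < n)%N.
Implicit Types (s t u : {set M_vertex n}).

Definition left_part s : {set 'I_(2 * n).+1} := inl @^-1: s.
Definition right_part s : {set 'I_3} := inr @^-1: s.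

Lemma join_parts s : join_simplex (left_part s) (right_part s) = s.
Proof.
apply/setP => -[i|j]; rewrite inE; apply/orP/idP => [[]/imsetP[k]|H].
- by rewrite inE => ki [->].
- by [].
- by left; apply/imsetP; exists i; rewrite ?inE.
- by [].
- by rewrite inE => kj [->].
- by right; apply/imsetP; exists j; rewrite ?inE.
Qed.

Lemma parts_join (x : {set 'I_(2 * n).+1}) (y : {set 'I_3}) :
  left_part (join_simplex x y) = x /\ right_part (join_simplex x y) = y.
Proof.
split; apply/setP => i; rewrite !inE; apply/orP/idP => [[]/imsetP[k]|H] //.
- by move=> ki [->].
- by left; apply/imsetP; exists i.
- by move=> ki [->].
- by right; apply/imsetP; exists i.
Qed.

(* The simplices of [J * {a, b, c}]. *)
Definition full_join : {set {set M_vertex n}} :=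
  [set s | (#|left_part s| <= n)%N && (#|right_part s| <= 1)%N].

Lemma M_complexE s : (s \in M_complex n) =
  (s \in full_join) && ~~ ((#|left_part s| == n) && (right_part s == [set vertex_c])).
Proof.
rewrite !inE andbC; congr (_ && ~~ _).
  apply/imset2P/andP => [[x y]|[sL sR]].
    rewrite !inE /= prednK // => xn y1 ->; have [-> ->] := parts_join x y.
    by [].
  by exists (left_part s) (right_part s); rewrite ?inE /= ?prednK ?join_parts.
apply/imsetP/andP => [[x]|[/eqP sL /eqP sR]].
  rewrite !inE /= prednK // => /andP[_ xn] ->; have [-> ->] := parts_join x [set vertex_c].
  by rewrite xn eqxx.
exists (left_part s); last by rewrite -sR join_parts.
by rewrite !inE /= prednK // sL leqnn eqxx.
Qed.

Lemma card_parts s : #|s| = (#|left_part s| + #|right_part s|)%N.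
Proof.
rewrite -{1}(join_parts s) /join_simplex cardsU.
rewrite (_ : _ :&: _ = finset.set0) ?cards0 ?subn0.
  by rewrite !card_imset // => i j [].
by apply/setP => v; rewrite !inE; apply/negP => /andP[/imsetP[i _ ->] /imsetP[]].
Qed.

Lemma left_partS s t : s \subset t -> left_part s \subset left_part t.
Proof. exact: preimsetS. Qed.

Lemma right_partS s t : s \subset t -> right_part s \subset right_part t.
Proof. exact: preimsetS. Qed.

Lemma full_join_sub s t : s \in full_join -> t \subset s -> t \in full_join.
Proof.
rewrite !inE => /andP[sL sR] ts; apply/andP; split.
  exact: leq_trans (subset_leq_card (left_partS ts)) sL.
exact: leq_trans (subset_leq_card (right_partS ts)) sR.
Qed.

Lemma M_complex_sub s t : s \in M_complex n -> t \subset s -> t \in M_complex n.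
Proof.
rewrite !M_complexE => /andP[sK sN] ts; rewrite (full_join_sub sK ts) /=.
apply: contra sN => /andP[/eqP tL /eqP tR]; move: sK; rewrite inE => /andP[sL sR].
have := left_partS ts; have := right_partS ts; rewrite tR => Rts Lts.
rewrite eqn_leq sL -{1}tL (subset_leq_card Lts) eq_sym eqEcard Rts cards1.
exact: sR.
Qed.

Lemma M_complex_is_complex : is_complex (M_complex n).
Proof.
split; last exact: M_complex_sub.
rewrite M_complexE inE (_ : left_part _ = finset.set0); last by apply/setP => i; rewrite !inE.
rewrite (_ : right_part _ = finset.set0); last by apply/setP => i; rewrite !inE.
by rewrite !cards0 eq_sym eqn0Ngt n_gt0.
Qed.

(** The missing simplices have [n.+1] vertices, the largest number in the join, so they are not
    proper faces. *)
Lemma full_join_facet s v : s \in full_join -> v \in s -> s :\ v \in M_complex n.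
Proof.
move=> sK vs; rewrite M_complexE (full_join_sub sK (subsetDl _ _)) /=.
apply/negP => /andP[/eqP L /eqP Rr]; move: sK; rewrite inE => /andP[sL sR].
have := card_parts s; rewrite (cardsD1 v) vs (card_parts (s :\ v)) L Rr cards1.
lia.
Qed.

Lemma not_M_complex s : s \in full_join -> s \notin M_complex n -> inr vertex_c \in s.
Proof.
move=> sK; rewrite M_complexE sK /= negbK => /andP[_ /eqP Rr].
by have : vertex_c \in right_part s by [rewrite Rr set11]; rewrite inE.
Qed.

Definition vertices_J : {set M_vertex n} := [set inl i | i in 'I_(2 * n).+1].

Lemma vertices_J_inr j : (inr j : M_vertex n) \notin vertices_J.
Proof. by apply/imsetP => -[]. Qed.

Lemma card_vertices_J : #|vertices_J| = n.*2.+1.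
Proof. by rewrite card_imset ?card_ord ?mul2n // => i j []. Qed.

Lemma parts_cone j s : s \subset vertices_J ->
  #|left_part (inr j |: s)| = #|s| /\ right_part (inr j |: s) = [set j].
Proof.
move=> sW; have sR : right_part (inr j |: s) = [set j].
  apply/setP => k; rewrite !inE; have -> : (inr k \in s) = false.
    by apply: contraNF (vertices_J_inr k) => /(fintype.subsetP sW).
  by rewrite orbF.
split=> //; have := card_parts (inr j |: s); rewrite sR cards1 cardsU1.
have -> : inr j \notin s by apply: contra (vertices_J_inr j); apply: (fintype.subsetP sW).
by rewrite addn1 add1n => -[].
Qed.

Lemma cone_full_join j s : s \subset vertices_J -> (#|s| <= n)%N -> inr j |: s \in full_join.
Proof. by move=> sW sn; rewrite inE; have [-> ->] := parts_cone j sW; rewrite cards1 sn. Qed.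

Lemma cone_M_complex j s : s \subset vertices_J -> (#|s| <= n)%N -> j != vertex_c ->
  inr j |: s \in M_complex n.
Proof.
move=> sW sn jc; rewrite M_complexE cone_full_join //=.
have [_ ->] := parts_cone j sW; rewrite (inj_eq (@set1_inj _)) (negPf jc).
by rewrite andbF.
Qed.

Lemma cone_c_notin s : s \subset vertices_J -> #|s| = n -> inr vertex_c |: s \notin M_complex n.
Proof.
move=> sW sn; rewrite M_complexE cone_full_join ?sn //=.
by have [-> ->] := parts_cone vertex_c sW; rewrite sn !eqxx.
Qed.

End MComplex.

Arguments vertices_J_inr {n} j.

(** * The linked spheres in the embedded complex *)

Section Linking.
Variables (R : realType) (n : nat) (X : finType).
Variables (e : X -> {ffun M_vertex n -> R^o}) (T : {set {set X}}).
Variable f : {ffun M_vertex n -> R^o} -> 'rV[R]_(2 * n).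
Local Notation M := (M_complex n).
Implicit Types (t : {set X}) (s u : {set M_vertex n}).

Hypothesis n_gt0 : (0 < n)%N.
Hypothesis e_inj : injective e.
Hypothesis T_vertex : forall x, [set x] \in T.
Hypothesis T_sub : forall t1 t2 : {set X}, t1 \in T -> t2 \subset t1 -> t2 \in T.
Hypothesis T_indep : forall t, t \in T -> aff_indep (vertices e t).
Hypothesis T_meet : forall t1 t2 y, t1 \in T -> t2 \in T -> hull (vertices e t1) y ->
  hull (vertices e t2) y -> hull (vertices e (t1 :&: t2)) y.
Hypothesis T_union : forall y, realization M y <-> exists2 t, t \in T & hull (vertices e t) y.
Hypothesis f_affine : forall t, t \in T -> affine_on (hull (vertices e t)) f.
Hypothesis f_inj : forall y z, realization M y -> realization M z -> f y = f z -> y = z.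

Let pos := coord e.
Let G := image e f.
Let a : M_vertex n := inr ord0.
Let b : M_vertex n := inr (inord 1).
Let c : M_vertex n := inr vertex_c.

Let M_point : exists v, [set v] \in M.
Proof.
exists a; rewrite -[[set a]]finset.setU0; apply: cone_M_complex => //.
- exact: finset.sub0set.
- by rewrite cards0.
Qed.

Let M_cx := M_complex_is_complex n_gt0.
Let pos_ge0 := coord_ge0 e_inj T_vertex T_union.
Let pos_sum := coord_sum e_inj T_vertex T_union.
Let uniq := T_uniq e_inj T_vertex T_indep T_meet T_union.
Let cover := T_cover M_cx M_point e_inj T_sub T_union.
Let T0 := T_set0 M_cx M_point T_sub T_union.
Let G_inj : injective G := image_inj e_inj T_vertex T_union f_inj.
Let G_indep := image_indep e_inj T_indep T_meet T_union f_affine f_inj.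
Let G_disjoint := images_disjoint e_inj T_vertex T_indep T_meet T_union f_affine f_inj.
Let bc : b != c. Proof. by apply/eqP => -[/(congr1 val)]; rewrite /= inordK. Qed.
Let ab : a != b. Proof. by apply/eqP => -[/(congr1 val)]; rewrite /= inordK. Qed.
Let ac : a != c. Proof. by []. Qed.

Local Notation chain := (cone_chain pos T M).

Lemma sum_chain (F : {set option X} -> 'F_2) s : s \in M ->
  \sum_(y in chain s) F y = \sum_(t in cells pos T s) F [set Some x | x in t].
Proof.
move=> sM; rewrite -(big_imset (h := fun t : {set X} => [set Some x | x in t])) /=; last first.
  by move=> t1 t2 _ _; apply: imset_inj; apply: Some_inj.
apply: eq_bigl => y; rewrite inE sM; apply/andP/imsetP => [[yN yc]|[t tc ->]].
  exists (base y) => //; apply/setP => -[x|].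
    by rewrite (mem_imset _ _ (@Some_inj _)) inE.
  by rewrite (negPf yN); apply/esym/negP => /imsetP[].
split; first by apply/imsetP => -[].
rewrite (_ : base _ = t) //; apply/setP => x.
by rewrite inE (mem_imset _ _ (@Some_inj _)).
Qed.

Lemma base_some t : base [set Some x | x in t] = t.
Proof. by apply/setP => x; rewrite inE (mem_imset _ _ (@Some_inj _)). Qed.

Lemma none_some t : None \notin [set Some x | x in t].
Proof. by apply/imsetP => -[]. Qed.

Section FixedSimplex.
Variable s : {set M_vertex n}.
Hypothesis s_J : s \subset vertices_J n.
Hypothesis card_s : #|s| = n.

Let B := vertices_J n :\: s.
Let L1 := simplex_boundary (c |: s).
Let L2 := suspension a b B.
Let top_cells := [set t in part e T L2 | #|t| == n.+1].

Let card_B : #|B| = n.+1.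
Proof. by rewrite cardsD (finset.setIidPr s_J) card_vertices_J card_s -addnn -addSn addnK. Qed.

Let card_cs : #|c |: s| = n.+1.
Proof.
rewrite cardsU1 card_s (_ : c \notin s) //.
by apply: contra (vertices_J_inr vertex_c); apply: (fintype.subsetP s_J).
Qed.

Let cs_K : c |: s \in full_join n. Proof. by apply: cone_full_join; rewrite ?card_s. Qed.

Lemma L1_M : subcomplex L1 M.
Proof.
split; first by apply: simplex_boundary_complex; rewrite -cards_eq0 card_cs.
apply/fintype.subsetP => t; rewrite inE => /properP[ts [v vs vt]].
apply: (M_complex_sub n_gt0 (full_join_facet n_gt0 cs_K vs)).
by rewrite finset.subsetD1 ts vt.
Qed.

Let notinB j : (inr j : M_vertex n) \notin B.
Proof. by rewrite inE (negPf (vertices_J_inr j)) andbF. Qed.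

(** At most one of [a] and [b] is in [t]; if neither is, [b] is added. *)
Lemma L2_top (t : {set M_vertex n}) : t \in L2 -> exists u x, [/\ u \proper B, x \in [set a; b] & t \subset x |: u].
Proof.
rewrite inE => /and3P[ts abt Bt].
exists (t :&: B), (if a \in t then a else b); split.
- by rewrite properE finset.subsetIr finset.subsetI subxx andbT.
- by case: ifP; rewrite !inE eqxx ?orbT.
apply/fintype.subsetP => v vt; have := fintype.subsetP ts v vt; rewrite !in_setU1 finset.in_setI vt /=.
move=> /or3P[/eqP va|/eqP vb|-> //]; last by rewrite orbT.
  by rewrite -va vt eqxx.
rewrite vb; case: ifP => [ta|_]; last by rewrite eqxx.
case/negP: abt; apply/fintype.subsetP => z; rewrite !inE => /orP[/eqP ->|/eqP ->] //.
by rewrite -vb.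
Qed.

Let cone_M x (u : {set M_vertex n}) : u \proper B -> x \in [set a; b] -> x |: u \in M.
Proof.
move=> uB; have uJ : u \subset vertices_J n.
  exact: fintype.subset_trans (proper_sub uB) (subsetDl _ _).
have un : (#|u| <= n)%N by rewrite -ltnS -card_B proper_card.
rewrite in_set2 => /orP[]/eqP->; apply: cone_M_complex => //.
Qed.

Lemma L2_M : subcomplex L2 M.
Proof.
split; first by apply: suspension_complex; rewrite -cards_eq0 card_B.
apply/fintype.subsetP => t /L2_top[u [x [uB xab tx]]].
exact: M_complex_sub (cone_M uB xab) tx.
Qed.

Lemma L1_L2_disjoint : disjoint_complexes L1 L2.
Proof.
apply/setP => t; rewrite finset.in_setI finset.in_set1; apply/andP/eqP => [[]|->].
  rewrite !inE => /proper_sub tcs /and3P[tab _ _]; apply/eqP.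
  rewrite -finset.subset0; apply/fintype.subsetP => v vt.
  have := fintype.subsetP tcs v vt; have := fintype.subsetP tab v vt.
  rewrite !inE => /or3P[/eqP ->|/eqP ->|/andP[/negPf -> vJ]].
  - by rewrite (negPf ac) /= => /(fintype.subsetP s_J); rewrite (negPf (vertices_J_inr _)).
  - by rewrite (negPf bc) /= => /(fintype.subsetP s_J); rewrite (negPf (vertices_J_inr _)).
  - by rewrite orbF => /eqP vc; rewrite vc (negPf (vertices_J_inr _)) in vJ.
by split; [case: L1_M => -[]|case: L2_M => -[]].
Qed.

Lemma L_homeomorphic : Lambda R n.-1 n M (L1, L2).
Proof.
split => /=; [exact: L1_M|exact: L2_M|exact: L1_L2_disjoint| |].
  by apply: simplex_boundary_sphere; rewrite card_cs prednK.
by apply: suspension_sphere; rewrite ?card_B //; apply: notinB.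
Qed.

(* The top-dimensional simplices of the suspension are the [a * u] and [b * u] for
the [n]-subsets [u] of [B]. *)
Lemma sum_top_cells (F : {set option X} -> 'F_2) :
  \sum_(u | disjoint_pair (vertices_J n) n s u)
     (\sum_(y in chain (a |: u)) F y + \sum_(y in chain (b |: u)) F y) =
  \sum_(t in top_cells) F [set Some x | x in t].
Proof.
have topE t : (t \in top_cells) = [&& t \in T, carrier pos t \in L2 & #|t| == n.+1].
  by rewrite [LHS]inE [t \in part _ _ _]inE -andbA.
have pairP u : disjoint_pair (vertices_J n) n s u -> [/\ u \subset B, #|u| = n & u \proper B].
  move=> /and5P[_ uJ su _ /eqP cu].
  have uB : u \subset B.
    by rewrite finset.subsetD uJ disjoint_sym su.
  by split=> //; rewrite properEcard uB cu card_B ltnSn.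
have notinBsub j u : u \subset B -> (inr j : M_vertex n) \notin u.
  by move=> uB; apply: contra (notinB j); apply: (fintype.subsetP uB).
have coneI x u : x \in [set a; b] -> u \subset B -> (x |: u) :&: B = u.
  move=> xab uB; apply/setP => v; rewrite finset.in_setI in_setU1.
  have [vu|_] := boolP (v \in u); first by rewrite orbT (fintype.subsetP uB).
  by rewrite orbF; apply/negP => /andP[/eqP ->]; move: xab; rewrite in_set2 => /orP[]/eqP->;
    apply/negP; apply: notinB.
have cellsE x u : x \in [set a; b] -> disjoint_pair (vertices_J n) n s u ->
    cells pos T (x |: u) = [set t in top_cells | carrier pos t == x |: u].
  move=> xab /pairP[uB cu uBp].
  have xu : x \notin u.
    apply: contra (_ : x \notin B); first exact: (fintype.subsetP uB).
    by move: xab; rewrite !inE => /orP[]/eqP->; rewrite (negPf (vertices_J_inr _)) andbF.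
  have cxu : #|x |: u| = n.+1 by rewrite cardsU1 xu cu.
  have xuL : x |: u \in L2.
    rewrite inE; apply/and3P; split.
    - rewrite finset.subUset finset.sub1set; move: xab; rewrite !inE => /orP[]/eqP->;
        rewrite eqxx ?orbT /=; apply: fintype.subset_trans uB _;
        exact: fintype.subset_trans (subsetU1 b _) (subsetU1 a _).
    - apply/negP => /fintype.subsetP H; have := H a (set21 _ _); have := H b (set22 _ _).
      rewrite !in_setU1 !(negPf (notinBsub _ _ uB)) !orbF => /eqP bx /eqP ax.
      by move: ab; rewrite ax bx eqxx.
    - apply: contraL uBp => BxU; rewrite properE negb_and negbK; apply/orP; right.
      apply/fintype.subsetP => v vB; have := fintype.subsetP BxU v vB.
      rewrite in_setU1 => /orP[/eqP vx|//]; move: vB; rewrite vx.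
      by move: xab; rewrite !inE => /orP[]/eqP->; rewrite (negPf (vertices_J_inr _)) andbF.
  apply/setP => t; rewrite [LHS]inE [RHS]inE topE.
  apply/and3P/andP => [[tT /eqP ct tx]|[/and3P[tT _ /eqP ct] /eqP tx]].
    have tE : carrier pos t = x |: u.
      by apply/eqP; rewrite eqEcard tx -ct; apply: (card_carrier uniq tT).
    by rewrite tE tT xuL ct cxu !eqxx.
  by rewrite tT ct cxu tx eqxx subxx.
have chainE x u : x \in [set a; b] -> disjoint_pair (vertices_J n) n s u ->
    \sum_(y in chain (x |: u)) F y =
    \sum_(t in top_cells) (carrier pos t == x |: u)%:R * F [set Some z | z in t].
  move=> xab Du; have [_ _ uB] := pairP u Du.
  rewrite sum_chain ?cone_M // cellsE // big_mkcond [RHS]big_mkcond.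
  apply: eq_bigr => t _; rewrite inE.
  by case: (t \in top_cells) => //=; case: eqP; rewrite ?mul1r ?mul0r.
under eq_bigr => u Du do rewrite !chainE ?inE ?eqxx ?orbT // -big_split.
rewrite exchange_big /=; apply: eq_bigr => t.
rewrite topE => /and3P[tT tL /eqP ct].
under eq_bigr do rewrite -mulrDl; rewrite -mulr_suml.
(* The carrier of a top cell has at least [n.+1] vertices, so it is all of [x |: u0]; this
   determines the set [u] and the choice between [a] and [b], and the cell is counted once. *)
have [u0 [x [u0B xab tu0]]] := L2_top tL.
have cu0 : (#|u0| <= n)%N by rewrite -ltnS -card_B proper_card.
have ct' : (n.+1 <= #|carrier pos t|)%N by rewrite -ct (card_carrier uniq tT).
have xu0 : (#|x |: u0| <= n.+1)%N.
  by rewrite cardsU1; case: (_ \notin _) => //=; rewrite ?add1n ?add0n ?ltnS // leqW.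
have tE : carrier pos t = x |: u0 by apply/eqP; rewrite eqEcard tu0 (leq_trans xu0).
have u0B' := proper_sub u0B.
have cu0n : #|u0| = n.
  apply/eqP; rewrite eqn_leq cu0 -ltnS; apply: leq_trans ct' _; rewrite tE cardsU1.
  by case: (_ \notin _); rewrite ?add1n ?add0n.
have D0 : disjoint_pair (vertices_J n) n s u0.
  have [u0J su0] := andP (etrans (esym (finset.subsetD _ _ _)) u0B').
  by rewrite /disjoint_pair s_J u0J disjoint_sym su0 card_s cu0n !eqxx.
rewrite (bigD1 u0) //= [X in _ + X]big1 => [|u /andP[Du uu0]]; last first.
  have [uB _ _] := pairP u Du; rewrite tE.
  have neq y : y \in [set a; b] -> (x |: u0 == y |: u) = false.
    move=> yab; apply: contraNF uu0 => /eqP E.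
    by rewrite -(coneI y u) // -E coneI.
  by rewrite !neq ?set21 ?set22 // addr0.
rewrite tE addr0; suff -> : (x |: u0 == a |: u0)%:R + (x |: u0 == b |: u0)%:R = 1 :> 'F_2.
  by rewrite mul1r.
have ba0 : (a |: u0 == b |: u0) = false.
  apply: contraNF ab => /eqP E; have := setU11 a u0; rewrite E in_setU1.
  by rewrite (negPf (notinBsub _ _ u0B')) orbF.
move: xab; rewrite in_set2 => /orP[]/eqP->; rewrite eqxx ?ba0 ?addr0 //.
by rewrite eq_sym ba0 add0r.
Qed.

Variable p : 'rV[R]_(2 * n).
Hypothesis apex : forall mu : X -> R, (#|[set x | mu x != 0%R]| <= 2 * n)%N ->
  \sum_x mu x = 1 -> \sum_x mu x *: G x != p.
Variable h : option X -> nat -> R.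
Local Notation g := (homogeneous (coned G p)).
Hypothesis h_crosses : forall y z : {set option X}, [disjoint y & z] ->
  (#|y| + #|z| = (2 * n).+2)%N ->
  (forall w, weakly_separating y z w -> dependence g (2 * n).+1 w -> (exists x, w x != 0) ->
     separating y z w) ->
  crosses h y z = `[< exists w, [/\ weakly_separating y z w, dependence g (2 * n).+1 w
                                  & exists x, w x != 0] >].

Let D_gt0 : (0 < 2 * n)%N. Proof. by rewrite muln_gt0. Qed.
Let F := coned G p.
Let F_inj : injective F := coned_inj G_inj D_gt0 apex.
Let cs_M : c |: s \notin M. Proof. exact: cone_c_notin. Qed.

Let rim_of y : y \in chain (c |: s) ->
  [/\ None \in y, base y \in T, #|base y| = n & carrier pos (base y) \subset c |: s].
Proof.
rewrite inE (negPf cs_M) => /andP[yN]; rewrite inE card_cs eqSS => /and3P[yT /eqP cy].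
by move=> /proper_sub ys; split.
Qed.

Let top_of t : t \in top_cells ->
  [/\ t \in T, #|t| = n.+1 & carrier pos t \subset a |: (b |: B)].
Proof.
rewrite inE => /andP[]; rewrite inE => /andP[tT]; rewrite inE => /and3P[tab _ _] /eqP ct.
by split.
Qed.

Let cs_ab : [disjoint c |: s & a |: (b |: B)].
Proof.
rewrite -setI_eq0.
apply/eqP/setP => v; rewrite finset.in_setI finset.in_set0; apply/negP => /andP[].
rewrite !in_setU1 => /orP[/eqP -> /or3P[|/eqP E|]|vs /or3P[/eqP E|/eqP E|]].
- by rewrite (negPf (_ : c != a)) // eq_sym.
- by move: bc; rewrite E eqxx.
- by rewrite (negPf (notinB _)).
- by have := fintype.subsetP s_J _ vs; rewrite E (negPf (vertices_J_inr _)).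
- by have := fintype.subsetP s_J _ vs; rewrite E (negPf (vertices_J_inr _)).
- by rewrite inE vs.
Qed.

Let chain_top_disjoint y t : y \in chain (c |: s) -> t \in top_cells ->
  [disjoint y & [set Some x | x in t]].
Proof.
move=> yc tt; have [tT ct tab] := top_of tt.
rewrite disjoint_sym disjoint_subset; apply/fintype.subsetP => q /imsetP[x xt ->].
rewrite inE; apply/negP => xy; have xcs := cone_chain_carrier yc xy.
have [v xv] : exists v, pos x v != 0.
  apply: contrapT => N; have /eqP := pos_sum x; rewrite big1 ?(eq_sym 0) ?oner_eq0 // => v _.
  by apply/eqP; apply: contraT => xv; case: N; exists v.
have vcs : v \in c |: s by apply: (fintype.subsetP xcs); rewrite inE.
have : v \in a |: (b |: B).
  by apply: (fintype.subsetP tab); apply/bigcupP; exists x; rewrite ?inE.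
by rewrite (disjointFr cs_ab vcs).
Qed.

(** Besides the apex there are [n] vertices in [y] and [n.+1] in [t], the largest total that
    [dependence_strict] admits for [D = 2 * n]. *)
Let strict y t w : y \in chain (c |: s) -> t \in top_cells ->
  weakly_separating y [set Some x | x in t] w -> dependence g (2 * n).+1 w ->
  (exists x, w x != 0) -> separating y [set Some x | x in t] w.
Proof.
move=> yc tt; have [yN yT cy ys] := rim_of yc; have [tT ct tab] := top_of tt.
have car : [disjoint carrier pos (base y) & carrier pos (base [set Some x | x in t])].
  by rewrite base_some; apply: disjointWl ys _; apply: disjointWr tab _.
apply: (dependence_strict G_disjoint apex) => //; rewrite ?base_some ?none_some //.
  exact: chain_top_disjoint.
by rewrite cy ct addnS mul2n addnn.
Qed.

Let crosses_hulls y t : y \in chain (c |: s) -> t \in top_cells ->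
  crosses h y [set Some x | x in t] =
  `[< exists z, hull (vertices F y) z /\ hull (vertices G t) z >].
Proof.
move=> yc tt; have yt := chain_top_disjoint yc tt.
have [tT ct tab] := top_of tt; have cy := cone_chain_card yc.
rewrite h_crosses //.
- have := hulls_meet F_inj yt.
  rewrite (vertices_coned G p (none_some _)) base_some => H.
  by apply/asboolP/asboolP => /H.
- rewrite cy card_cs card_imset ?ct; last exact: Some_inj.
  by rewrite addnS addSn mul2n addnn.
- by move=> w; apply: strict.
Qed.

(** The image of the cone chain of the missing simplex is bounded by the image of [L1]. It meets the
    image of [L2] in strict dependences only, and the crossings after perturbation count exactly
    these meetings. *)
Lemma bounding_link :
  \sum_(u | disjoint_pair (vertices_J n) n s u)
     (pairing chain (crosses h) (c |: s) (a |: u) +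
      pairing chain (crosses h) (c |: s) (b |: u)) = 1 ->
  bounding_intersection n.-1 n (f @` realization L1)%classic (f @` realization L2)%classic 1.
Proof.
move=> odd_sum.
have tri := image_triangulation e_inj T_vertex T_sub T_indep T_meet T_union f_affine f_inj.
pose TX := image_complex e T f L1; pose TY := image_complex e T f L2.
pose C := [fset vertices F y | y in chain (c |: s)]%fset.
have CP z : reflect (exists2 y, y \in chain (c |: s) & z = vertices F y) (z \in C).
  by apply: (iffP (imfsetP _ _ _ _)) => -[y yc ->]; exists y.
have facetsY : facets n TY = [fset vertices G t | t in top_cells]%fset.
  apply/fsetP => z; rewrite !inE /=; apply/andP/imfsetP => [[/image_complexP[t tL ->] /eqP cz]|].
    exists t => //; apply/setIdP; split=> //.
    by rewrite -(card_vertices G_inj) cz.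
  move=> [t /= tt ->]; rewrite (card_vertices G_inj); move: tt; rewrite inE => /andP[tL ->].
  by split=> //; apply/image_complexP; exists t.
exists TX, TY, C; split.
- exact: tri L1_M.
- exact: tri L2_M.
- move=> z /CP[y yc ->]; have [yN yT cy ys] := rim_of yc.
  rewrite (card_vertices F_inj) (cone_chain_card yc) card_cs prednK //; split=> //.
  apply/(aff_indep_vertices F_inj) => w sw w0 wF.
  by apply: (coned_indep G_indep apex yT _ sw w0 wF); rewrite cy leq_pmull.
- apply: (cone_boundary uniq G_inj D_gt0 apex) => //.
  + by rewrite card_cs prednK.
  + by move=> v; apply: full_join_facet.
  + move=> r; apply: (cone_chain_boundary (M_complex_sub n_gt0) pos_ge0 T_sub uniq cover).
    by move=> v; apply: full_join_facet.
  + move=> z; rewrite !inE; split=> [/andP[/image_complexP[t tL ->]]|[t tr ->]].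
      rewrite (card_vertices G_inj) prednK // => /eqP ct; exists t => //.
      move: tL; rewrite !inE => /andP[tT tcs]; rewrite tT ct card_cs eqxx /=.
      exact: tcs.
    move: tr; rewrite inE card_cs eqSS => /and3P[tT /eqP ct tcs].
    rewrite (card_vertices G_inj) ct prednK // eqxx andbT.
    by apply/image_complexP; exists t; rewrite // !inE tT.
split.
(* A common point of two faces yields a weak dependence; strictness makes all its weights nonzero,
   so the faces are the whole simplices. *)
- move=> z t z' t' /CP[y yc ->]; rewrite facetsY => /imfsetP[u /= ut ->].
  move=> /(sub_vertices F_inj)[y' y'y ->] /(sub_vertices G_inj)[u' u'u ->] [x [Hx Hx']].
  have [w1 [s1 p1 n1 E1]] := (hull_vertices F_inj _ _).1 Hx.
  have Hx2 : hull (vertices F [set Some x | x in u']) x.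
    by rewrite (vertices_coned G p (none_some _)) base_some.
  have [w2 [s2 p2 n2 E2]] := (hull_vertices F_inj _ _).1 Hx2.
  have u'u' : [set Some x | x in u'] \subset [set Some x | x in u] by apply: imsetS.
  have S1 : supported y w1 by move=> q qy; apply: s1; apply: contra qy; apply: (fintype.subsetP y'y).
  have S2 : supported [set Some x | x in u] w2.
    by move=> q qu; apply: s2; apply: contra qu; apply: (fintype.subsetP u'u').
  have yu := chain_top_disjoint yc ut.
  have E12 : \sum_q w1 q *: F q = \sum_q w2 q *: F q by rewrite -E1.
  have [W1 W2 W3] := weak_of_hulls yu S1 S2 p1 p2 n1 n2 E12.
  have [P1 P2 _] := strict yc ut W1 W2 W3.
  have -> : y' = y.
    apply/eqP; rewrite finset.eqEsubset y'y; apply/fintype.subsetP => q qy; apply: contraT => qy'.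
    by have := P1 q qy; rewrite s1 // sub0r oppr_gt0 ltNge p2.
  have -> // : u' = u.
  apply/eqP; rewrite finset.eqEsubset u'u; apply/fintype.subsetP => q qu; apply: contraT => qu'.
  have := P2 (Some q); rewrite (mem_imset _ _ (@Some_inj _)) => /(_ qu).
  by rewrite s2 ?subr0 ?ltNge ?p1 // (mem_imset _ _ (@Some_inj _)).
rewrite /intersection_number facetsY -[RHS]odd_sum.
rewrite big_imfset /=; last by move=> y z _ _; apply: vertices_inj F_inj _ _.
rewrite big_enum /=.
under [RHS]eq_bigr do rewrite -big_split.
rewrite [RHS]exchange_big /=; apply: eq_bigr => y yc.
rewrite sum_top_cells big_imfset /=; last by move=> t u _ _; apply: vertices_inj G_inj _ _.
rewrite big_enum /=; apply: eq_bigr => t tt.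
rewrite crosses_hulls //.
Qed.

End FixedSimplex.

(** In the van Kampen number, the terms that pair [b * s] with [a * u] vanish because [f] embeds
    both simplices. The remaining sum is odd, so some [s] contributes 1 to it. *)
Lemma exists_linked_spheres : exists s, [/\ s \subset vertices_J n, #|s| = n
  & bounding_intersection n.-1 n (f @` realization (simplex_boundary (c |: s)))%classic
      (f @` realization (suspension a b (vertices_J n :\: s)))%classic 1].
Proof.
have [p apex] := exists_apex G.
have [h [h_generic h_crosses]] := exists_perturbation (homogeneous (coned G p)) (2 * n).+1.
have disj (s t : {set M_vertex n}) y z : s \in full_join n -> t \in full_join n -> [disjoint s & t] ->
    y \in chain s -> z \in chain t -> [disjoint y & z].
  move=> sK tK st; apply: (cone_chain_disjoint pos_sum) => //.
  have [//|sM] := boolP (s \in M); have [//|tM] /= := boolP (t \in M).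
  have := disjointFr st (not_M_complex n_gt0 sK sM).
  by rewrite (not_M_complex n_gt0 tK tM).
have odd_total : \sum_(s : {set M_vertex n}) \sum_(u | disjoint_pair (vertices_J n) n s u)
    (pairing chain (crosses h) (c |: s) (a |: u) + pairing chain (crosses h) (c |: s) (b |: u)
     + pairing chain (crosses h) (b |: s) (a |: u)) = 1.
  apply: (pairing_parity (K := full_join n) (N := (2 * n).+1)) => //.
  - exact: full_join_sub.
  - exact: (cone_chain0 pos M_cx.1 T0).
  - by move=> s y _; apply: cone_chain_card.
  - move=> s r sK; apply: (cone_chain_boundary (M_complex_sub n_gt0) pos_ge0 T_sub uniq cover).
    by move=> v; apply: full_join_facet.
  - exact: card_vertices_J.
  - exact: vertices_J_inr.
  - exact: vertices_J_inr.
  - exact: vertices_J_inr.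
  - by rewrite mul2n.
  - move=> s x sJ cs xabc; suff [j ->] : exists j, x = inr j by apply: cone_full_join.
    move: xabc; rewrite !inE -orbA => /or3P[]/eqP->.
    + by exists ord0.
    + by exists (inord 1).
    + by exists vertex_c.
have crosses0 s u : disjoint_pair (vertices_J n) n s u ->
    pairing chain (crosses h) (b |: s) (a |: u) = 0.
  move=> /and5P[sJ uJ su /eqP cs /eqP cu].
  have bM : b |: s \in M by apply: cone_M_complex; rewrite ?cs.
  have aM : a |: u \in M by apply: cone_M_complex; rewrite ?cu.
  have bs : b \notin s by apply: contra (vertices_J_inr (inord 1)); apply: (fintype.subsetP sJ).
  have au : a \notin u by apply: contra (vertices_J_inr ord0); apply: (fintype.subsetP uJ).
  have cbs : #|b |: s| = n.+1 by rewrite cardsU1 bs cs.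
  have cau : #|a |: u| = n.+1 by rewrite cardsU1 au cu.
  have abd : [disjoint b |: s & a |: u].
    rewrite disjoint_setU1l disjoint_setU1r su andbT in_setU1 negb_or eq_sym ab /=.
    apply/andP; split.
      by apply: contra (vertices_J_inr (inord 1)); apply: (fintype.subsetP uJ).
    by apply: contra (vertices_J_inr ord0); apply: (fintype.subsetP sJ).
  rewrite /pairing big1 // => y yb; rewrite big1 // => z za.
  have yz : [disjoint y & z].
    by apply: disj abd yb za; move: bM aM; rewrite !M_complexE // => /andP[? _] /andP[].
  have cy := cone_chain_card yb; have cz := cone_chain_card za.
  move: yb za; rewrite [y \in _]inE [z \in _]inE bM aM.
  move=> /andP[yN]; rewrite inE => /and3P[yT _ ys] /andP[zN]; rewrite inE => /and3P[zT _ zu].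
  have car : [disjoint carrier pos (base y) & carrier pos (base z)].
    by apply: disjointWl ys _; apply: disjointWr zu _.
  have none w : weakly_separating y z w -> dependence (homogeneous (coned G p)) (2 * n).+1 w ->
      ~ exists x, w x != 0.
    move=> ww dw [x]; rewrite (no_dependence G_disjoint yN zN yT zT car ww dw).
    by rewrite eqxx.
  rewrite h_crosses //.
  - rewrite (_ : `[< _ >] = false) //; apply/asboolP => -[w [ww dw wx]].
    exact: none ww dw wx.
  - by rewrite cy cz cbs cau addnS addSn mul2n addnn.
  - by move=> w ww dw wx; case: (none w ww dw).
pose P s := \sum_(u | disjoint_pair (vertices_J n) n s u)
    (pairing chain (crosses h) (c |: s) (a |: u) + pairing chain (crosses h) (c |: s) (b |: u)).
have [s Ps] : exists s, P s != 0.
  apply: contrapT => N; have /eqP := odd_total; rewrite big1 ?(eq_sym 0) ?oner_eq0 // => s _.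
  transitivity (P s).
    by apply: eq_bigr => u Du; rewrite (crosses0 s u Du) addr0.
  by apply/eqP; apply: contraT => Ps; case: N; exists s.
(* A nonzero sum has a term, which supplies the size and the position of [s]. *)
have [u /and5P[sJ _ _ /eqP cs _]] : exists u, disjoint_pair (vertices_J n) n s u.
  apply: contrapT => N; move: Ps; rewrite /P big1 ?eqxx // => u Du.
  by case: N; exists u.
exists s; split=> //; apply: (bounding_link sJ cs apex h_crosses).
move: Ps; rewrite -/(P s); move: (P s) => x.
by case: x => [[|[|//]] ? //] _; apply: val_inj.
Qed.

End Linking.

Local Open Scope classical_set_scope.

Theorem theorem1p2 (R : realType) (n : nat) (n_gt0 : (0 < n)%N)
    (f : {ffun M_vertex n -> R^o} -> 'rV[R]_(2 * n))
    (f_emb : PL_embedding (realization (M_complex n)) f) :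
  exists2 l : {set {set M_vertex n}} * {set {set M_vertex n}},
    Lambda R n.-1 n (M_complex n) l &
    lk2 n.-1 n (f @` realization l.1) (f @` realization l.2) = 1.
Proof.
have [[Tf [[[geo1 geo2 geo3] Treal] aff]] inj] := f_emb.
have [X [e [T [e_inj T_vertex TE T_idx]]]] := index_complex geo2.
have T_sub (t1 t2 : {set X}) : t1 \in T -> t2 \subset t1 -> t2 \in T.
  by rewrite !TE => tT tt; apply: geo2 tT _; rewrite verticesS.
have T_union y : realization (M_complex n) y <-> exists2 t, t \in T & hull (vertices e t) y.
  rewrite Treal; split=> [[s /T_idx[t tT ->] sy]|[t tT ty]]; first by exists t.
  by exists (vertices e t); rewrite -?TE.
have [|||||s [sJ cs lk]] := @exists_linked_spheres R n X e T f n_gt0 e_inj T_vertex T_sub.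
- by move=> t; rewrite TE => /geo1.
- move=> t1 t2 y; rewrite !TE => t1T t2T y1 y2.
  by rewrite -(verticesI e_inj); apply: geo3 t1T t2T _ _.
- exact: T_union.
- by move=> t; rewrite TE => /aff.
- by move=> y z ym zm; apply: inj; rewrite inE.
exists (simplex_boundary (inr vertex_c |: s),
        suspension (inr ord0 : M_vertex n) (inr (inord 1)) (vertices_J n :\: s)%SET).
  exact: L_homeomorphic.
(* [lk2] is 1 as soon as one bounding chain has odd intersection number. *)
by rewrite /lk2 asboolT.
Qed.
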